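(* Suppose that $a<0$, $a+b>0$ and $\psi\in C([-1,0];\mathbb{R})$. Let $X$ be the unique continuous adapted process satisfying $$dX(t)=\Big(aX(t)+\frac{b}{1+t}\int_{-1}^t X(s)\,ds\Big)\,dt+\sigma\,dB(t),\quad t\ge 0;\qquad X(t)=\psi(t),\quad t\in[-1,0].$$ Then: (a) There exists an $\mathcal{F}^B(\infty)$-measurable normal random variable $C$ such that $$\lim_{t\to\infty}\frac{X(t)}{t^{-(1+b/a)}}=C,\quad\text{a.s.}$$ (b) $C$ is given by $$C=|a|^{-1-\frac ba}\,b\Big\{\psi(0)\,U\big(1-\tfrac ba,2,|a|\big)+\int_{-1}^0\psi(s)\,ds\;U\big(-\tfrac ba,1,|a|\big)\Big\}+\sigma\int_0^\infty\frac{b}{|a|^{1+\frac ba}}(1+s)\,U\big(1-\tfrac ba,2,|a|(1+s)\big)\,dB(s).$$ (c) The mean and variance of $C$ are $$\mathbb{E}[C]=|a|^{-1-\frac ba}\,b\Big\{\psi(0)\,U\big(1-\tfrac ba,2,|a|\big)+\int_{-1}^0\psi(s)\,ds\;U\big(-\tfrac ba,1,|a|\big)\Big\},$$ $$\mathrm{Var}[C]=\sigma^2\frac{b^2}{|a|^{2+\frac{2b}{a}}}\int_0^\infty(1+s)^2\,U\big(1-\tfrac ba,2,|a|(1+s)\big)^2\,ds>0.$$ (d) The mean and variance of $X$ satisfy $$\lim_{t\to\infty}\frac{\mathbb{E}[X(t)]}{t^{-1-b/a}}=\mathbb{E}[C],\qquad\lim_{t\to\infty}\frac{\mathrm{Va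r}[X(t)]}{t^{-2-2b/a}}=\mathrm{Var}[C].$$
   Context: $a,b\in\mathbb{R}$, $\sigma>0$, $\psi$ is deterministic, and $B$ is a standard one-dimensional Brownian motion on a complete probability space with a filtration satisfying the usual conditions, to which $B$ is adapted. $\mathcal{F}^B(\infty)$ is the (completed) $\sigma$-algebra generated by $\{B(s):s\ge0\}$. ''a.s.'' means almost surely. $U(\alpha,\beta,z)$ denotes the Tricomi confluent hypergeometric function: for real $\alpha,\beta$ and $z>0$ it is the solution of Kummer's equation $z w''(z)+(\beta-z)w'(z)-\alpha w(z)=0$ determined by $z^{\alpha}U(\alpha,\beta,z)\to1$ as $z\to\infty$. *)

(* Defs.v *)
From mathcomp Require Export all_boot all_order all_algebra.
From mathcomp Require Export all_classical all_reals all_analysis.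
Export numFieldNormedType.Exports.

Set Implicit Arguments.
Unset Strict Implicit.
Unset Printing Implicit Defensive.

Import Order.TTheory GRing.Theory Num.Theory.

Local Open Scope classical_set_scope.
Local Open Scope ring_scope.

Section Tricomi.
Context {R : realType}.

Definition is_tricomiU (alpha beta : R) (w : R -> R) : Prop :=
  (forall z, 0 < z ->
    [/\ derivable w z 1, derivable (derive1 w) z 1 &
        z * derive1 (derive1 w) z + (beta - z) * derive1 w z - alpha * w z = 0]) /\
  z `^ alpha * w z @[z --> +oo] --> (1 : R).

(* The conditions determine [w] on ]0, +oo[ only; the value of [tricomiU] at a
   non-positive argument is arbitrary. *)
Definition tricomiU (alpha beta : R) : R -> R :=
  xget (cst 0) [set w | is_tricomiU alpha beta w].

End Tricomi.

(* Processes have type [R -> T -> R] (time first). Only their values at the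
   relevant times ([0, +oo[, or [-1, +oo[ for a solution) are constrained. *)
Section Processes.
Context {d : measure_display} {T : measurableType d} {R : realType}.
Variable P : probability T R.
Implicit Types (F : R -> set (set T)) (B X : R -> T -> R) (G : set (set T)).

Definition measurable_wrt G (Y : T -> R) : Prop :=
  forall A : set R, measurable A -> G (Y @^-1` A).

Record usual_filtration F : Prop := {
  filtration_sigma : forall t, 0 <= t -> sigma_algebra setT (F t) ;
  filtration_sub : forall t, 0 <= t -> F t `<=` measurable ;
  filtration_mono : forall s t, 0 <= s -> s <= t -> F s `<=` F t ;
  filtration_null : forall t, 0 <= t -> P.-negligible `<=` F t ;
  filtration_right : forall t, 0 <= t ->
    \bigcap_(s in [set s | t < s]) F s `<=` F t }.

Definition adapted F X : Prop := forall t, 0 <= t -> measurable_wrt (F t) (X t).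

(* [s] is the standard deviation; it is nonzero because [normal_prob m 0] is
   not a Dirac mass but an unrelated default measure. *)
Definition is_normal (Y : T -> R) (m s : R) : Prop :=
  [/\ measurable_fun setT Y, 0 < s &
      forall A : set R, measurable A -> P (Y @^-1` A) = normal_prob m s A].

(* Mutual independence over all finite grids; independence of a subfamily is
   the case where the other [A i] are [setT]. *)
Definition independent_increments B : Prop :=
  forall (n : nat) (t : nat -> R) (A : nat -> set R),
    0 <= t 0%N -> {homo t : i j / (i <= j)%N >-> i <= j} ->
    (forall i, measurable (A i)) ->
    P (\bigcap_(i < n) ((B (t i.+1) \- B (t i)) @^-1` A i)) =
    (\prod_(i < n) P ((B (t i.+1) \- B (t i))%R @^-1` A i))%E.

Record brownian_motion B : Prop := {
  bm_measurable : forall t, 0 <= t -> measurable_fun setT (B t) ;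
  bm_zero : {ae P, forall w, B 0 w = 0} ;
  bm_continuous : {ae P, forall w, {within `[0, +oo[, continuous (B^~ w)}} ;
  bm_normal : forall s t, 0 <= s -> s < t ->
    is_normal (B t \- B s) 0 (Num.sqrt (t - s)) ;
  bm_independent : independent_increments B }.

Definition completed_natural_sigma B : set (set T) :=
  <<s [set E | exists t (A : set R),
                 [/\ 0 <= t, measurable A & E = B t @^-1` A]]
      `|` P.-negligible >>.

Definition step_fun (n : nat) (t c : nat -> R) (s : R) : R :=
  \sum_(i < n) c i * \1_(`]t i, t i.+1] : set R) s.

Definition step_integral B (n : nat) (t c : nat -> R) (w : T) : R :=
  \sum_(i < n) c i * (B (t i.+1) w - B (t i) w).

(* [I] is a version of the stochastic integral of the deterministic function
   [f] over [0, +oo[ against [B]: the L^2(P)-limit of the elementary integrals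
   of step functions converging to [f] in L^2([0, +oo[). By Ito's isometry it is
   a.s. unique and independent of the approximating sequence. *)
Definition is_wiener_integral B (f : R -> R) (I : T -> R) : Prop :=
  [/\ measurable_fun (`[0, +oo[ : set R) f, measurable_fun setT I &
    exists (n : nat -> nat) (t c : nat -> nat -> R),
    [/\ forall k, 0 <= t k 0%N /\ {homo t k : i j / (i <= j)%N >-> i <= j},
        (\int[lebesgue_measure]_(s in `[0%R, +oo[)
            ((f s - step_fun (n k) (t k) (c k) s) ^+ 2)%:E)%E
          @[k --> \oo] --> (0 : \bar R) &
        'E_P[(fun w => (I w - step_integral B (n k) (t k) (c k) w) ^+ 2)%R]%E
          @[k --> \oo] --> (0 : \bar R)]].

(* The noise is additive, so the equation is a pathwise integral equation. *)
Record is_solution F B (a b sigma : R) (psi : R -> R) X : Prop := {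
  sol_adapted : adapted F X ;
  sol_continuous : {ae P, forall w, {within `[-1, +oo[, continuous (X^~ w)}} ;
  sol_initial : {ae P, forall w, forall t, -1 <= t <= 0 -> X t w = psi t} ;
  sol_equation : {ae P, forall w, forall t, 0 <= t ->
    X t w = psi 0
      + \int[lebesgue_measure]_(s in `[0, t])
          (a * X s w
           + b / (1 + s) * (\int[lebesgue_measure]_(u in `[-1, s]) X u w))
      + sigma * B t w} }.

End Processes.

(* Main.v *)
From HB Require Import structures.
Require Import Defs.
From mathcomp Require Import measurable_realfun ring lra.

Set Implicit Arguments.
Unset Strict Implicit.
Unset Printing Implicit Defensive.

Import Order.TTheory GRing.Theory Num.Theory.

Local Open Scope classical_set_scope.
Local Open Scope ring_scope.

(** Write al = -a > 0, ka = b/al = -b/a > 1, eps = (ka - 1)/2, so that the claimed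
    growth rate t^(-(1 + b/a)) of X is t^(2 eps).

    _One path at a time._ Because the noise is additive, Z = X - sigma B and
    Y(t) = int_{-1}^t X solve ordinary differential equations in which a Brownian path
    appears but is not differentiated. Let u(t) = U(ka, 1, al(1+t)) and
    v(t) = (1+t) U(1+ka, 2, al(1+t)). They solve the adjoint system, so v X + u Y would be
    constant without noise; with noise the derivative of v Z + u Y is -sigma v' B, which is
    integrable because v' is O(t^(-ka-1)) and B is O(t^(1+eps)). Hence v Z + u Y has a limit M.
    Eliminating Y by means of u Y = M - v X leaves a scalar linear equation for X, with
    integrating factor e^(al t)/u, and l'Hopital's rule gives X ~ rho M t^(2 eps) with
    rho = ka al^ka ([path_limit]). The same M is, up to sigma and its deterministic part,
    the limit of the Riemann sums of v against dB ([step_sum_dist]). Both facts come with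
    an explicit rate, linear in a constant L that bounds the dyadic increments of the path.

    _Special functions._ U(p+1, p+2-r, z) is the Laplace transform at z of
    s^p (1+s)^(-r), divided by Gamma(p+1) ([tricomiUE]). Contiguous relations give Kummer's
    equation and the derivatives of u and v; a Wronskian argument gives uniqueness.

    _Probability._ Gaussian moments of all dyadic increments, summed with weights, show that
    L can be taken to be a square integrable random variable ([random_dyadic_bound]).
    All almost sure convergences above therefore hold in L^2 as well, which gives the
    Wiener integral, and the convergence of means and variances ([moments_cvg]). Elementary
    integrals are Gaussian by a deterministic time change ([step_integral_normal]), and
    so is their limit ([wiener_integral_of_limit]). *)

(** * Derivatives and comparison of increments *)

Section Calculus.
Context {R : realType}.
Implicit Types (f g : R -> R) (x y z a b c l : R).

(** Derivatives are terms of the form [is_derive t 1 f f'], and the rules below compose such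
    terms, so that a derivative and its existence are obtained together. *)
Lemma derM f g x df dg : is_derive x (1 : R) f df -> is_derive x (1 : R) g dg ->
  is_derive x (1 : R) (fun t => f t * g t) (df * g x + f x * dg).
Proof. by move=> h1 h2; apply: is_derive_eq; rewrite !/GRing.scale/= addrC mulrC. Qed.

Lemma derD f g x df dg : is_derive x (1 : R) f df -> is_derive x (1 : R) g dg ->
  is_derive x (1 : R) (fun t => f t + g t) (df + dg).
Proof. by move=> h1 h2; apply: is_derive_eq. Qed.

Lemma derB f g x df dg : is_derive x (1 : R) f df -> is_derive x (1 : R) g dg ->
  is_derive x (1 : R) (fun t => f t - g t) (df - dg).
Proof. by move=> h1 h2; apply: is_derive_eq. Qed.

Lemma derN f x df : is_derive x (1 : R) f df ->
  is_derive x (1 : R) (fun t => - f t) (- df).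
Proof. by move=> h1; apply: is_derive_eq. Qed.

Lemma derC x c : is_derive x (1 : R) (fun=> c) 0.
Proof. exact: is_derive_cst. Qed.

Lemma derId x : is_derive x (1 : R) (fun t : R => t) 1.
Proof. exact: is_derive_id. Qed.

Lemma derZ c f x df : is_derive x (1 : R) f df ->
  is_derive x (1 : R) (fun t => c * f t) (c * df).
Proof. by move=> h; apply: (is_derive_eq (derM (derC x c) h)); rewrite mul0r add0r. Qed.

Lemma der_comp f g x df dg : is_derive x (1 : R) f df ->
  is_derive (f x) (1 : R) g dg -> is_derive x (1 : R) (fun t => g (f t)) (dg * df).
Proof.
move=> [hf <-] [hg <-].
have dgf : derivable (g \o f) x 1.
  by apply/derivable1_diffP/differentiable_comp; apply/derivable1_diffP.
by split => //; rewrite -derive1E (derive1_comp hf hg) !derive1E.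
Qed.

Lemma derV f x df : f x != 0 -> is_derive x (1 : R) f df ->
  is_derive x (1 : R) (fun t => (f t)^-1) (- df / f x ^+ 2).
Proof.
move=> fx0 [hf <-]; split; first exact: derivableV.
by rewrite (deriveV fx0 hf) /GRing.scale/= mulrC mulrN mulNr.
Qed.

Lemma der_expR f x df : is_derive x (1 : R) f df ->
  is_derive x (1 : R) (fun t => expR (f t)) (expR (f x) * df).
Proof. by move=> h; apply: (der_comp h (is_derive_expR (f x))). Qed.

Lemma der_powR f p x df : 0 < f x -> is_derive x (1 : R) f df ->
  is_derive x (1 : R) (fun t => f t `^ p) (p * f x `^ (p - 1) * df).
Proof. by move=> fx h; apply: (der_comp h (is_derive1_powR p fx)). Qed.

Lemma der_cont f x df : is_derive x (1 : R) f df -> {for x, continuous f}.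
Proof. by move=> [h _]; apply/differentiable_continuous/derivable1_diffP. Qed.

Lemma der_near f g x df : {near x, f =1 g} -> is_derive x (1 : R) f df ->
  is_derive x (1 : R) g df.
Proof.
move=> fg [h1 h2]; split; first exact: near_eq_derivable h1.
by rewrite -(near_eq_derive _ fg).
Qed.

Lemma der_derive1 f x df : is_derive x (1 : R) f df -> derive1 f x = df.
Proof. by move=> [_ <-]; rewrite derive1E. Qed.

Lemma le_increment f g f' g' a b : a <= b ->
  {within `[a, b], continuous f} -> {within `[a, b], continuous g} ->
  (forall x, a < x < b -> is_derive x (1 : R) f (f' x)) ->
  (forall x, a < x < b -> is_derive x (1 : R) g (g' x)) ->
  (forall x, a < x < b -> f' x <= g' x) ->
  f b - f a <= g b - g a.
Proof.
rewrite le_eqVlt => /predU1P[->|ab] cf cg df dg le; first by rewrite !subrr.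
have dgf x : x \in `]a, b[ -> is_derive x (1 : R) (fun t => g t - f t) (g' x - f' x).
  by rewrite in_itv/= => xab; apply: derB; [exact: dg|exact: df].
have cgf : {within `[a, b], continuous (fun t => g t - f t)}.
  by move=> x; apply: cvgB; [exact: cg|exact: cf].
have [c + e] := MVT ab dgf cgf; rewrite in_itv/= => cab; rewrite -subr_ge0.
have -> : g b - g a - (f b - f a) = g b - f b - (g a - f a) by ring.
by rewrite e mulr_ge0 ?subr_ge0 ?le // ltW.
Qed.

(** This replaces the estimation of integrals along a path: to bound the integral of f' one
    exhibits a function g with |f'| <= g' instead of integrating. *)
Lemma le_norm_increment f g f' g' a b : a <= b ->
  {within `[a, b], continuous f} -> {within `[a, b], continuous g} ->
  (forall x, a < x < b -> is_derive x (1 : R) f (f' x)) ->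
  (forall x, a < x < b -> is_derive x (1 : R) g (g' x)) ->
  (forall x, a < x < b -> `|f' x| <= g' x) ->
  `|f b - f a| <= g b - g a.
Proof.
move=> ab cf cg df dg le; rewrite ler_norml; apply/andP; split; last first.
  by apply: (le_increment ab cf cg df dg) => x /le; rewrite ler_norml => /andP[].
have := @le_increment (fun t => - f t) g (fun t => - f' t) g' a b ab _ cg _ dg.
rewrite opprK addrC => h; rewrite lerNl opprB; apply: h => //.
- by move=> x; apply: cvgN; exact: cf.
- by move=> x xab; apply: derN; exact: df.
- by move=> x /le; rewrite ler_norml lerNl => /andP[].
Qed.

Lemma der_within f f' a b : (forall x, a <= x <= b -> is_derive x (1 : R) f (f' x)) ->
  {within `[a, b], continuous f}.
Proof.
move=> df; apply: continuous_in_subspaceT => x.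
by rewrite inE/= in_itv/= => /df/der_cont.
Qed.

Lemma constant_of_der0 f a b : a <= b -> {within `[a, b], continuous f} ->
  (forall x, a < x < b -> is_derive x (1 : R) f 0) -> f b = f a.
Proof.
move=> ab cf df; apply/eqP; rewrite -subr_eq0 -normr_le0.
rewrite -(subrr (0 : R)).
apply: (@le_norm_increment f (fun=> 0) (fun=> 0) (fun=> 0)) => //.
- by move=> x; apply: cvg_cst.
- by move=> x xab; rewrite normr0.
Qed.

Lemma le_of_der_ge0 f f' a b : a <= b -> {within `[a, b], continuous f} ->
  (forall x, a < x < b -> is_derive x (1 : R) f (f' x)) ->
  (forall x, a < x < b -> 0 <= f' x) -> f a <= f b.
Proof.
move=> ab cf df f0; rewrite -subr_ge0 -[leLHS](subrr (0 : R)).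
apply: (@le_increment (fun=> 0) f (fun=> 0) f' a b ab _ cf _ df f0).
by move=> x; apply: cvg_cst.
Qed.

End Calculus.

(** * Laplace transforms of s^p (1+s)^(-r) *)

Section Laplace.
Context {R : realType}.
Implicit Types (f g : R -> R) (x y z s c l p r : R).
Notation mu := (@lebesgue_measure R).

(** Reduces improper integrals to the fundamental theorem of calculus on [0, n]. *)
Lemma Rintegral_itv_cvg f : mu.-integrable `[0, +oo[ (EFin \o f) ->
  \int[mu]_(x in `[0, n%:R]) f x @[n --> \oo] --> \int[mu]_(x in `[0, +oo[) f x.
Proof.
move=> fi; apply: fine_cvg; rewrite fineK; last exact: integrable_fin_num.
have sub (n : nat) : `[0, n%:R] `<=` (`[0, +oo[ : set R).
  by apply: subset_itvl; rewrite bnd_simp.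
have eqn (n : nat) : (\int[mu]_(x in `[0%R, n%:R]) (f x)%:E =
    \int[mu]_(x in `[0%R, +oo[) ((EFin \o f) \_ `[0%R, n%:R]) x)%E.
  by rewrite -integral_mkcondr; congr integral; rewrite setIC; apply/esym/setIidPl/sub.
under eq_fun do rewrite eqn.
apply: (@dominated_cvg _ _ _ mu _ _ _ _ (fun x => `|f x|%:E)) => //.
- move=> n; apply/measurable_restrict => //.
  have /integrableP[mf _] := fi; apply: measurable_funS mf => //; exact: subIsetl.
- move=> x; rewrite /= in_itv/= andbT => x0.
  apply: cvg_near_cst; near=> n; rewrite /= patchE mem_set//= in_itv/= x0/=.
  by near: n; exact: nbhs_infty_ger.
- by apply: integrable_norm.
- move=> n x _; rewrite patchE; case: ifP => _; rewrite /= ?normr0 ?lee_fin//.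
Unshelve. all: by end_near. Qed.

Lemma continuous_expRN z : continuous (fun s => expR (- (z * s))).
Proof. by move=> s; apply: (@der_cont R _ s _ (der_expR (derN (derZ z (derId s))))). Qed.

Lemma cvg_expRN z : 0 < z -> expR (- (z * s)) @[s --> +oo] --> (0 : R).
Proof.
move=> z0; apply: (cvg_comp (fun s => z * s) (fun x => expR (- x))); last exact: cvgr_expR.
by apply: gt0_cvgMry => //; exact: cvg_id.
Qed.

Lemma integrable_expR z : 0 < z -> mu.-integrable `[0, +oo[ (fun s => (expR (- (z * s)))%:E).
Proof.
move=> z0; have ce := @continuous_expRN z.
have dF s : is_derive s (1 : R) (fun s => - (expR (- (z * s)) / z)) (expR (- (z * s))).
  apply: (is_derive_eq (derN (derM (der_expR (derN (derZ z (derId s)))) (derC s z^-1)))).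
  by field; rewrite gt_eqF.
apply/integrableP; split.
  by apply/measurable_EFinP; apply: measurable_funTS; exact: continuous_measurable_fun ce.
under eq_integral do rewrite /= ger0_norm ?expR_ge0//.
rewrite (@ge0_continuous_FTC2y _ _ (fun s => - (expR (- (z * s)) / z)) 0 0).
- by rewrite ltry.
- by move=> s _; exact: expR_ge0.
- exact: continuous_subspaceT.
- by rewrite -oppr0; apply: cvgN; rewrite -(mul0r z^-1); apply: cvgMr_tmp; exact: cvg_expRN.
- by move=> s _; have [] := dF s.
- by apply: cvg_at_right_filter; exact: der_cont (dF 0).
- by move=> s _; exact: der_derive1 (dF s).
Qed.

(** Growth slower than every exponential, which is stable under multiplication by s and lets
    the Laplace transform be differentiated under the integral sign. *)
Definition tempered f := {within `[0, +oo[, continuous f} /\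
  forall y, 0 < y -> exists c, forall s, 0 <= s -> `|f s| <= c * expR (y * s).

Definition laplace f z := \int[mu]_(s in `[0, +oo[) (expR (- (z * s)) * f s).

Lemma measurable_within_cy f : {within `[0, +oo[, continuous f} ->
  measurable_fun (`[0, +oo[ : set R) f.
Proof. by move=> cf; exact: subspace_continuous_measurable_fun. Qed.

Lemma tempered_integrable f z : tempered f -> 0 < z ->
  mu.-integrable `[0, +oo[ (fun s => (expR (- (z * s)) * f s)%:E).
Proof.
move=> [cf /(_ (z / 2)) tf] z0; have [|c hc] := tf; first by rewrite divr_gt0.
have z20 : 0 < z / 2 by rewrite divr_gt0.
have := integrableZl _ c (integrable_expR z20) => /(_ (measurable_itv _)) ic.
apply: (le_integrable _ _ _ ic) => //.
  apply/measurable_EFinP/measurable_funM; last exact: measurable_within_cy.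
  by apply: measurable_funTS; exact: continuous_measurable_fun (@continuous_expRN z).
move=> s; rewrite /= in_itv/= andbT => s0; rewrite lee_fin normrM ger0_norm ?expR_ge0//.
apply: le_trans (ler_norm _).
apply: (@le_trans _ _ (expR (- (z * s)) * (c * expR (z / 2 * s)))).
  by rewrite ler_wpM2l ?expR_ge0 ?hc.
by rewrite mulrCA -expRD le_eqVlt; apply/orP; left; apply/eqP; congr (_ * expR _); field.
Qed.

Lemma tempered_id f : tempered f -> tempered (fun s => s * f s).
Proof.
move=> [cf tf]; split.
  by move=> s; apply: cvgM; [apply: continuous_subspaceT s => s; exact: cvg_id|exact: cf].
move=> y y0; have y20 : 0 < y / 2 by rewrite divr_gt0.
have [c hc] := tf _ y20; exists (2 / y * c) => s s0; rewrite normrM ger0_norm//.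
have hs : s <= 2 / y * expR (y / 2 * s).
  rewrite -ler_pdivrMl ?divr_gt0// invf_div; apply: le_trans (expR_ge1Dx _).
  by rewrite lerDr.
apply: le_trans (ler_pM s0 (normr_ge0 _) hs (hc s s0)) _.
rewrite mulrACA -expRD le_eqVlt; apply/orP; left; apply/eqP; congr (_ * _ * expR _); by field.
Qed.

(** Differentiation under the integral sign: near z, the derivative of the integrand is
    dominated by its absolute value at z / 2. *)
Lemma laplace_der f z : tempered f -> 0 < z ->
  is_derive z (1 : R) (laplace f) (- laplace (fun s => s * f s) z).
Proof.
move=> tf z0.
have zI : `]z / 2, (z * 2)[%classic z by rewrite /= in_itv/=; apply/andP; split; lra.
have d1 (x s : R) : is_derive x (1 : R) (fun x => expR (- (x * s)) * f s)
    (- (expR (- (x * s)) * (s * f s))).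
  apply: (is_derive_eq (derM (der_expR (derN (derM (derId x) (derC x s)))) (derC x (f s)))).
  by ring.
have intf (x : R) : `]z / 2, (z * 2)[%classic x ->
    mu.-integrable `[0, +oo[ (EFin \o (fun s => expR (- (x * s)) * f s)).
  by rewrite /= in_itv/= => /andP[h _]; apply: tempered_integrable => //; lra.
have intG : mu.-integrable `[0, +oo[ (EFin \o (fun s => `|expR (- (z / 2 * s)) * (s * f s)|)).
  apply: integrable_norm.
  by apply: tempered_integrable; [exact: tempered_id|rewrite divr_gt0].
have P1 (x s : R) : partial1of2 (fun x s => expR (- (x * s)) * f s) x s =
    - (expR (- (x * s)) * (s * f s)).
  by rewrite partial1of2E; have [_ <-] := d1 x s.
have Gub (x s : R) : `]z / 2, (z * 2)[%classic x -> `[0, +oo[%classic s ->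
    `|partial1of2 (fun x s => expR (- (x * s)) * f s) x s| <=
    `|expR (- (z / 2 * s)) * (s * f s)|.
  rewrite /= !in_itv/= andbT => /andP[h _] s0; rewrite P1 normrN !normrM.
  rewrite ler_wpM2r ?mulr_ge0// !ger0_norm ?expR_ge0// ler_expR lerN2 ler_wpM2r//.
  exact: ltW.
have D := @derivable_under_integral _ _ _ mu (fun x s => expR (- (x * s)) * f s)
  `[0, +oo[ (measurable_itv _) z (z / 2) (z * 2) zI intf
  (fun x s _ _ => let: DeriveDef h _ := d1 x s in h)
  (fun s => `|expR (- (z / 2 * s)) * (s * f s)|) (fun s => normr_ge0 _) intG Gub.
have E := @differentiation_under_integral _ _ _ mu (fun x s => expR (- (x * s)) * f s)
  `[0, +oo[ (measurable_itv _) z (z / 2) (z * 2) zI intf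
  (fun x s _ _ => let: DeriveDef h _ := d1 x s in h)
  (fun s => `|expR (- (z / 2 * s)) * (s * f s)|) (fun s => normr_ge0 _) intG Gub.
split; first exact: D.
rewrite -derive1E [LHS]E /laplace.
under eq_Rintegral do rewrite P1 -mulN1r.
rewrite RintegralZl ?mulN1r//.
by apply: tempered_integrable => //; exact: tempered_id.
Qed.

(** The boundary term vanishes at 0 because f does, and at infinity because f is tempered. *)
Lemma laplace_by_parts f f' z : tempered f -> tempered f' -> f 0 = 0 -> 0 < z ->
  (forall s, 0 < s -> is_derive s (1 : R) f (f' s)) -> z * laplace f z = laplace f' z.
Proof.
move=> tf tf' f0 z0 df; apply/esym/eqP; rewrite -subr_eq0; apply/eqP.
have i1 := tempered_integrable tf z0; have i2 := tempered_integrable tf' z0.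
have i3 : mu.-integrable `[0, +oo[ (EFin \o (fun s => z * (expR (- (z * s)) * f s))).
  exact: (integrableZl _ z i1).
have i4 : mu.-integrable `[0, +oo[
    (EFin \o (fun s => expR (- (z * s)) * f' s - z * (expR (- (z * s)) * f s))).
  by apply: (integrableB _ i2 i3).
rewrite /laplace -RintegralZl// -RintegralB//.
have cF : {within `[0, +oo[, continuous (fun s => expR (- (z * s)) * f s)}.
  move=> s; apply: cvgM; last exact: tf.1.
  by apply: continuous_subspaceT s; exact: continuous_expRN.
have cF' : {within `[0, +oo[, continuous
    (fun s => expR (- (z * s)) * f' s - z * (expR (- (z * s)) * f s))}.
  move=> s; apply: cvgB; last by apply: cvgM; [exact: cvg_cst|exact: cF].
  apply: cvgM; last exact: tf'.1.
  by apply: continuous_subspaceT s; exact: continuous_expRN.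
have L : (fun n : nat => \int[mu]_(s in `[0, n%:R])
      (expR (- (z * s)) * f' s - z * (expR (- (z * s)) * f s))) =
    (fun n : nat => expR (- (z * n%:R)) * f n%:R).
  apply/funext => n; have [->|n0] := eqVneq n 0%N.
    by rewrite set_itv1 Rintegral_set1 f0 mulr0.
  have n0' : (0 : R) < n%:R by rewrite ltr0n lt0n.
  have sub : `[0, n%:R] `<=` (`[0, +oo[ : set R).
    by apply: subset_itvl; rewrite bnd_simp.
  have dF s : 0 < s -> is_derive s (1 : R) (fun s => expR (- (z * s)) * f s)
      (expR (- (z * s)) * f' s - z * (expR (- (z * s)) * f s)).
    move=> s0; apply: (is_derive_eq (derM (der_expR (derN (derZ z (derId s)))) (df s s0))).
    by ring.
  rewrite /Rintegral (@continuous_FTC2 _ _ (fun s => expR (- (z * s)) * f s) 0 n%:R) //.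
  - by rewrite f0 mulr0 sube0.
  - exact: continuous_subspaceW sub cF'.
  - have /(continuous_within_itvP _ n0')[_ c0 cn] := continuous_subspaceW sub cF.
    by split => // s; rewrite in_itv/= => /andP[s0 _]; have [] := dF s s0.
  - by move=> s; rewrite in_itv/= => /andP[s0 _]; exact: der_derive1 (dF s s0).
have U := Rintegral_itv_cvg i4; rewrite L in U.
apply: (cvg_unique _ U) => //.
have z20 : 0 < z / 2 by rewrite divr_gt0.
have [c hc] := tf.2 (z / 2) z20.
apply: norm_cvg0.
apply: (@squeeze_cvgr _ _ _ _ (fun=> 0) (fun n : nat => c * expR (- (z / 2 * n%:R)))).
- apply: nearW => n; rewrite normr_ge0/= normrM ger0_norm ?expR_ge0//.
  apply: le_trans (ler_wpM2l (expR_ge0 _) (hc n%:R _)) _ => //.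
  rewrite mulrCA -expRD le_eqVlt; apply/orP; left; apply/eqP; congr (_ * expR _).
  by field.
- exact: cvg_cst.
- rewrite -(mulr0 c); apply: cvgMl_tmp.
  exact: (cvg_comp (fun n : nat => n%:R) (fun s => expR (- (z / 2 * s))) (@cvgr_idn R) (cvg_expRN z20)).
Qed.

(** The weight in the representation of Gamma(alpha) U(alpha, beta, z) as the integral of
    e^(-z s) s^(alpha-1) (1+s)^(beta-alpha-1): here p = alpha - 1 and r = p + 2 - beta. *)
Definition weight p r s := s `^ p * (1 + s) `^ (- r).

Lemma weight_ge0 p r s : 0 <= weight p r s.
Proof. by rewrite mulr_ge0 ?powR_ge0. Qed.

Lemma weight0 p r : p != 0 -> weight p r 0 = 0.
Proof. by move=> p0; rewrite /weight powR0// mul0r. Qed.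

Lemma weight_id p r s : 0 < p -> 0 <= s -> s * weight p r s = weight (p + 1) r s.
Proof.
move=> p0 s0; rewrite /weight mulrA; congr (_ * _).
rewrite powRD; last by rewrite gt_eqF//; apply: addr_gt0.
by rewrite powRr1// mulrC.
Qed.

Lemma weight_split p r s : 0 < p -> 0 <= s ->
  weight p r s = weight p (r + 1) s + weight (p + 1) (r + 1) s.
Proof.
move=> p0 s0; rewrite -weight_id// /weight.
have s1 : 0 < 1 + s by rewrite ltr_pwDl.
have -> : (1 + s) `^ (- r) = (1 + s) * (1 + s) `^ (- (r + 1)).
  rewrite -[X in X * _](powRr1 (ltW s1)) -powRD; last by rewrite (gt_eqF s1) implybT.
  by congr (_ `^ _); ring.
by ring.
Qed.

Lemma weight_der p r s : 0 < s -> is_derive s (1 : R) (weight p r)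
  (p * weight (p - 1) r s - r * weight p (r + 1) s).
Proof.
move=> s0; have s1 : 0 < 1 + s by rewrite addr_gt0.
apply: (is_derive_eq (derM (der_powR p s0 (derId s))
  (der_powR (f := fun s => 1 + s) (- r) s1 (derD (derC s 1) (derId s))))).
rewrite /weight (_ : - (r + 1) = - r - 1) ?opprD//; ring.
Qed.

Lemma continuous_powR_0y p : 0 < p -> {within `[0, +oo[, continuous (fun s : R => s `^ p)}.
Proof.
move=> p0; apply/continuous_within_itvcyP; split.
  by move=> s; rewrite in_itv/= andbT => s0; exact: der_cont (der_powR p s0 (derId s)).
by rewrite powR0 ?gt_eqF//; exact: powR_cvg0.
Qed.

(** The inequality y s / p <= exp (y s / p), raised to the power p. *)
Lemma powR_le_expR p y s : 0 < p -> 0 < y -> 0 <= s ->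
  s `^ p <= (p / y) `^ p * expR (y * s).
Proof.
move=> p0 y0 s0.
have h : s <= p / y * expR (y * s / p).
  rewrite -ler_pdivrMl ?divr_gt0// invf_div; apply: le_trans (expR_ge1Dx _).
  by rewrite mulrAC lerDr.
apply: le_trans (ge0_ler_powR (ltW p0) _ _ h) _; rewrite ?nnegrE//.
  by rewrite mulr_ge0 ?expR_ge0// divr_ge0// ltW.
have h0 : 0 <= p / y by rewrite ltW// divr_gt0.
rewrite powRM ?expR_ge0// ler_wpM2l ?powR_ge0//.
by rewrite /powR gt_eqF ?expR_gt0// expRK mulrC divfK ?gt_eqF.
Qed.

Lemma tempered_weight p r : 0 < p -> 0 <= r -> tempered (weight p r).
Proof.
move=> p0 r0; split.
  move=> s; apply: cvgM; first exact: continuous_powR_0y.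
  move: s; apply: continuous_in_subspaceT => s; rewrite inE/= in_itv/= andbT => s0.
  have s1 : 0 < 1 + s by rewrite ltr_pwDl.
  exact: der_cont (der_powR (f := fun s => 1 + s) (- r) s1 (derD (derC s 1) (derId s))).
move=> y y0; exists ((p / y) `^ p) => s s0; rewrite ger0_norm ?weight_ge0//.
apply: le_trans (powR_le_expR p0 y0 s0); rewrite ler_piMr ?powR_ge0//.
by rewrite -[leRHS](powRr0 (1 + s)) ler_powR ?lerDl// oppr_le0.
Qed.

Definition Phi p r := laplace (weight p r).

Lemma Phi_der p r z : 0 < p -> 0 <= r -> 0 < z ->
  is_derive z (1 : R) (Phi p r) (- Phi (p + 1) r z).
Proof.
move=> p0 r0 z0; apply: (is_derive_eq (laplace_der (tempered_weight p0 r0) z0)).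
congr (- _); apply: eq_Rintegral => s; rewrite inE/= in_itv/= andbT => s0.
by rewrite weight_id.
Qed.

(** Integration by parts against [weight_der]. The restriction to p > 1 makes the derivative
    of the weight a combination of weights that vanish at 0. *)
Lemma Phi_by_parts p r z : 1 < p -> 0 <= r -> 0 < z ->
  z * Phi p r z = p * Phi (p - 1) r z - r * Phi p (r + 1) z.
Proof.
move=> p1 r0 z0; have p0 : 0 < p by apply: lt_trans p1.
have pm : 0 < p - 1 by rewrite subr_gt0.
have r1 : 0 <= r + 1 by apply: addr_ge0.
have t1 := tempered_weight pm r0; have t2 := tempered_weight p0 r1.
have i1 := tempered_integrable t1 z0; have i2 := tempered_integrable t2 z0.
have tg : tempered (fun s => p * weight (p - 1) r s - r * weight p (r + 1) s).
  split.
    by move=> s; apply: cvgB; (apply: cvgM; [exact: cvg_cst|]); [exact: t1.1|exact: t2.1].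
  move=> y y0; have [c1 h1] := t1.2 y y0; have [c2 h2] := t2.2 y y0.
  exists (p * c1 + r * c2) => s s0; apply: le_trans (ler_normB _ _) _.
  rewrite mulrDl -!mulrA (normrM p) (normrM r) (gtr0_norm p0) (ger0_norm r0).
  apply: lerD; first by apply: ler_wpM2l; [exact: ltW|exact: h1].
  by apply: ler_wpM2l => //; exact: h2.
rewrite /Phi (laplace_by_parts (tempered_weight p0 r0) tg _ z0 (@weight_der p r)).
  rewrite /laplace -!RintegralZl// -RintegralB//.
  - by apply: eq_Rintegral => s _; ring.
  - exact: (integrableZl _ p i1).
  - exact: (integrableZl _ r i2).
by rewrite weight0// gt_eqF.
Qed.

(** From (1+s)^(-r) = (1+s)^(-r-1) + s (1+s)^(-r-1). *)
Lemma Phi_split p r z : 0 < p -> 0 <= r -> 0 < z ->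
  Phi p r z = Phi p (r + 1) z + Phi (p + 1) (r + 1) z.
Proof.
move=> p0 r0 z0; have r1 : 0 <= r + 1 by apply: addr_ge0.
have p1 : 0 < p + 1 by apply: addr_gt0.
have i1 := tempered_integrable (tempered_weight p0 r1) z0.
have i2 := tempered_integrable (tempered_weight p1 r1) z0.
rewrite /Phi /laplace -RintegralD//.
apply: eq_Rintegral => s; rewrite inE/= in_itv/= andbT => s0.
by rewrite weight_split//; ring.
Qed.

Lemma le_laplace f g z : tempered f -> tempered g -> 0 < z ->
  (forall s, 0 <= s -> f s <= g s) -> laplace f z <= laplace g z.
Proof.
move=> tf tg z0 fg; apply: le_Rintegral => //; [exact: tempered_integrable..|].
by move=> s; rewrite /= in_itv/= andbT => s0; rewrite ler_wpM2l ?expR_ge0 ?fg.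
Qed.

(** On [1, 2] the integrand is at least a positive constant. *)
Lemma Phi_gt0 p r z : 0 < p -> 0 <= r -> 0 < z -> 0 < Phi p r z.
Proof.
move=> p0 r0 z0.
have i1 := tempered_integrable (tempered_weight p0 r0) z0.
pose c := expR (- (z * 2)) * (1 * 3 `^ (- r)).
have c0 : 0 < c by rewrite mulr_gt0 ?expR_gt0// mul1r powR_gt0.
apply: (lt_le_trans c0); rewrite -lee_fin /Phi /laplace /Rintegral fineK; last first.
  exact: (integrable_fin_num _ i1).
apply: (@le_trans _ _ (\int[mu]_(s in `[1%R, 2%R]) (cst c%:E) s)%E).
  rewrite integral_cst//= lebesgue_measure_itv/= lte_fin ltr1n -EFinB.
  by rewrite -EFinM lee_fin ler_peMr ?(ltW c0)//; lra.
have sub : `[1, 2] `<=` (`[0, +oo[ : set R).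
  by move=> s /=; rewrite !in_itv/= andbT => /andP[h _]; apply: le_trans h.
have pos s : (0 <= (expR (- (z * s)) * weight p r s)%:E)%E.
  by rewrite lee_fin mulr_ge0 ?expR_ge0 ?weight_ge0.
apply: (@le_trans _ _ (\int[mu]_(s in `[1%R, 2%R]) (expR (- (z * s)) * weight p r s)%:E)%E).
  apply: ge0_le_integral => //.
  - by move=> s _; rewrite lee_fin ltW.
  - by apply: (measurable_funS _ sub); [exact: measurable_itv|exact: (measurable_int mu i1)].
  - move=> s; rewrite /= in_itv/= => /andP[s1 s2]; rewrite lee_fin.
    have s0 : 0 < 1 + s by apply: addr_gt0 => //; apply: lt_le_trans s1.
    apply: ler_pM => //; rewrite ?mulr_ge0 ?expR_ge0 ?powR_ge0//.
      by rewrite ler_expR lerN2 ler_wpM2l// ltW.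
    apply: ler_pM => //; rewrite ?powR_ge0//.
      by rewrite -(powRr0 s) ler_powR// ltW.
    rewrite !powRN lef_pV2 ?posrE ?powR_gt0//.
    by apply: ge0_ler_powR => //; rewrite ?nnegrE ?(ltW s0)//; lra.
apply: ge0_subset_integral => //.
exact: (measurable_int mu i1).
Qed.

Lemma constant_on_gt0 (h : R -> R) : (forall x, 0 < x -> is_derive x (1 : R) h 0) ->
  forall x y, 0 < x -> 0 < y -> h x = h y.
Proof.
move=> dh; suff H x y : 0 < x -> x <= y -> h x = h y.
  by move=> x y x0 y0; have [/H->//|/ltW/H->] := leP x y.
move=> x0 xy; apply/esym/constant_of_der0 => //.
- by apply: (@der_within _ _ (fun=> 0)) => t /andP[xt _]; apply: dh; apply: lt_le_trans xt.
- by move=> t /andP[xt _]; apply: dh; apply: lt_trans xt.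
Qed.

(** Gamma (p + 1). *)
Definition GammaP p := Phi p 0 1.

Lemma GammaP_gt0 p : 0 < p -> 0 < GammaP p.
Proof. by move=> p0; exact: Phi_gt0. Qed.

Lemma GammaPS p : 0 < p -> GammaP (p + 1) = (p + 1) * GammaP p.
Proof.
move=> p0; have := @Phi_by_parts (p + 1) 0 1.
by rewrite ltrDr mul1r mul0r subr0 addrK; apply.
Qed.

(** The change of variables s -> s / z, proved through the differential equation: by the
    contiguous relation with r = 0, Phi p 0 z * z^(p+1) has derivative zero. *)
Lemma Phi0E p z : 0 < p -> 0 < z -> Phi p 0 z = GammaP p * z `^ (- (p + 1)).
Proof.
move=> p0 z0; pose h z := Phi p 0 z * z `^ (p + 1).
have dh x : 0 < x -> is_derive x (1 : R) h 0.
  move=> x0; apply: (is_derive_eq (derM (Phi_der p0 (lexx 0) x0) (der_powR (p + 1) x0 (derId x)))).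
  have e : x * Phi (p + 1) 0 x = (p + 1) * Phi p 0 x.
    by rewrite Phi_by_parts ?ltrDr// mul0r subr0 addrK.
  rewrite mulr1 addrK -(@mulr_powRB1 _ x (p + 1) (ltW x0) (addr_gt0 p0 ltr01)) addrK.
  by rewrite mulrA mulNr (mulrC _ x) e; ring.
have := constant_on_gt0 dh z0 ltr01; rewrite /h powR1 mulr1 /GammaP => <-.
by rewrite -mulrA -powRD ?subrr ?powRr0 ?mulr1// (gt_eqF z0) implybT.
Qed.

Lemma bernoulli_powR r s : 0 <= r -> 0 <= s -> 1 - r * s <= (1 + s) `^ (- r).
Proof.
move=> r0 s0; have s1 : 0 < 1 + s by rewrite ltr_pwDl.
rewrite /powR gt_eqF//.
have : ln (1 + s) <= s.
  by have := @le_ln1Dx R s; apply; apply: lt_le_trans s0; rewrite ltrN10.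
move=> h; apply: le_trans (expR_ge1Dx _).
by rewrite lerD2l mulNr lerN2 ler_wpM2l.
Qed.

Lemma Phi_le p r z : 0 < p -> 0 <= r -> 0 < z -> Phi p r z <= GammaP p * z `^ (- (p + 1)).
Proof.
move=> p0 r0 z0; rewrite -Phi0E//; apply: le_laplace => //; [exact: tempered_weight..|].
move=> s s0; rewrite ler_wpM2l ?powR_ge0//.
by rewrite oppr0 ler_powR ?lerDl// oppr_le0.
Qed.

(** From 1 - r s <= (1+s)^(-r). *)
Lemma Phi_ge p r z : 0 < p -> 0 <= r -> 0 < z ->
  GammaP p * z `^ (- (p + 1)) - r * (GammaP (p + 1) * z `^ (- (p + 1 + 1))) <= Phi p r z.
Proof.
move=> p0 r0 z0; have p1 : 0 < p + 1 by apply: addr_gt0.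
rewrite -!Phi0E//.
have t1 := tempered_weight p0 (lexx 0); have t2 := tempered_weight p1 (lexx 0).
have i1 := tempered_integrable t1 z0; have i2 := tempered_integrable t2 z0.
have i3 := tempered_integrable (tempered_weight p0 r0) z0.
have i4 : mu.-integrable `[0, +oo[ (EFin \o (fun s => r * (expR (- (z * s)) * weight (p + 1) 0 s))).
  exact: (integrableZl _ r i2).
rewrite /Phi /laplace -RintegralZl// -RintegralB//.
apply: le_Rintegral => //; first exact: (integrableB _ i1 i4).
move=> s; rewrite /= in_itv/= andbT => s0.
rewrite [r * _]mulrCA -mulrBr ler_wpM2l ?expR_ge0// -weight_id//.
rewrite /weight oppr0 powRr0 !mulr1 mulrA -{1}(mul1r (s `^ p)) -mulrBl mulrC.
by rewrite ler_wpM2l ?powR_ge0// bernoulli_powR.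
Qed.

(** Watson's lemma to first order, by squeezing between [Phi_ge] and [Phi_le]. *)
Lemma Phi_asymptotics p r : 0 < p -> 0 <= r ->
  z `^ (p + 1) * Phi p r z @[z --> +oo] --> GammaP p.
Proof.
move=> p0 r0.
have h (z : R) : 0 < z -> z `^ (p + 1) * z `^ (- (p + 1)) = 1.
  by move=> z0; rewrite -powRD ?subrr ?powRr0// (gt_eqF z0) implybT.
have h' (z : R) : 0 < z -> z `^ (p + 1) * z `^ (- (p + 1 + 1)) = z^-1.
  move=> z0; rewrite -powRD ?(gt_eqF z0) ?implybT//.
  by rewrite (_ : _ - _ = -1) ?powR_inv1 ?ltW//; ring.
apply: (@squeeze_cvgr _ _ _ _ (fun z => GammaP p - r * GammaP (p + 1) * z^-1)
  (fun=> GammaP p)).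
- near=> z; have z0 : 0 < z by near: z; exact: nbhs_pinfty_gt.
  apply/andP; split.
    apply: le_trans (ler_wpM2l (powR_ge0 _ _) (Phi_ge p0 r0 z0)).
    rewrite mulrBr [X in _ <= X - _]mulrCA h// mulr1 lerD2l lerN2.
    by rewrite [leLHS]mulrCA [X in r * X <= _]mulrCA h'// mulrA.
  apply: le_trans (ler_wpM2l (powR_ge0 _ _) (Phi_le p0 r0 z0)) _.
  by rewrite mulrCA h// mulr1.
- rewrite -[X in _ --> X]subr0 -(mulr0 (r * GammaP (p + 1))).
  apply: cvgB; first exact: cvg_cst.
  apply: cvgMl_tmp; apply/gtr0_cvgV0.
    by near=> z; near: z; exact: nbhs_pinfty_gt.
  exact: cvg_id.
- exact: cvg_cst.
Unshelve. all: by end_near. Qed.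

End Laplace.

(** * The Tricomi function is a Laplace transform *)

Section Tricomi.
Context {R : realType}.
Implicit Types (w U : R -> R) (al be p r z : R).

Lemma der_of_derivable (f : R -> R) x : derivable f x 1 -> is_derive x (1 : R) f (derive1 f x).
Proof. by move=> h; apply: DeriveDef => //; rewrite derive1E. Qed.

(** Kummer's equation reduced to contiguous relations: A, B, C stand for Phi at (p+2, r),
    (p+1, r), (p, r), and D, E for Phi at (p+1, r+1), (p+2, r+1). *)
Lemma kummer_alg (p r z G A B C D E : R) : D = B - E ->
  z * A = (p + 1 + 1) * B - r * E -> z * B = (p + 1) * C - r * D ->
  z * (A * G) + (p + 2 - r - z) * (- B * G) - (p + 1) * (C * G) = 0.
Proof.
move=> DE eA eB; rewrite mulrA eA.
have -> : (p + 2 - r - z) * (- B * G) = (z * B) * G - (p + 2 - r) * B * G by ring.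
by rewrite eB DE; ring.
Qed.

(** Abel's identity: the product of the Wronskian of two solutions of Kummer's equation
    with e^(-z) z^be has derivative zero. Here E = e^(-z) and Z = z^(be-1). *)
Lemma wronskian_alg (z be al u u1 u2 w w1 w2 E Z : R) :
  z * u2 + (be - z) * u1 - al * u = 0 -> z * w2 + (be - z) * w1 - al * w = 0 ->
  (u1 * w1 + u * w2 - (u2 * w + u1 * w1)) * (E * (z * Z)) +
  (u * w1 - u1 * w) * (E * (- 1) * (z * Z) + E * (be * Z * 1)) = 0.
Proof.
move=> e1 e2; transitivity (E * Z * (u * (z * w2 + (be - z) * w1 - al * w) -
  w * (z * u2 + (be - z) * u1 - al * u))); first by ring.
by rewrite e1 e2 !mulr0 subr0 mulr0.
Qed.

Lemma tricomi_Phi p r : 0 < p -> 0 <= r ->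
  is_tricomiU (p + 1) (p + 2 - r) (fun z => Phi p r z / GammaP p).
Proof.
move=> p0 r0; have p1 : 0 < p + 1 by apply: addr_gt0.
have p2 : 0 < p + 1 + 1 by apply: addr_gt0.
set G := (GammaP p)^-1.
have d1 z : 0 < z -> is_derive z (1 : R) (fun z => Phi p r z * G) (- Phi (p + 1) r z * G).
  move=> z0; apply: (is_derive_eq (derM (Phi_der p0 r0 z0) (derC z G))).
  by rewrite mulr0 addr0.
have d2 z : 0 < z -> is_derive z (1 : R) (derive1 (fun z => Phi p r z * G))
    (Phi (p + 1 + 1) r z * G).
  move=> z0; apply: (@der_near R (fun z => - Phi (p + 1) r z * G)).
    by near=> y; apply/esym/der_derive1/d1; near: y; exact: lt_nbhsr.
  apply: (is_derive_eq (derM (derN (Phi_der p1 r0 z0)) (derC z G))).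
  by rewrite mulr0 addr0 opprK.
split=> [z z0|].
  split; first by have [] := d1 z z0.
    by have [] := d2 z z0.
  rewrite (der_derive1 (d1 z z0)) (der_derive1 (d2 z z0)).
  have p11 : 1 < p + 1 by rewrite ltrDr.
  have p21 : 1 < p + 1 + 1 by rewrite ltrDr.
  have := Phi_by_parts p21 r0 z0; rewrite addrK => e1.
  have := Phi_by_parts p11 r0 z0; rewrite addrK => e2.
  have e3 := Phi_split p1 r0 z0.
  have e3' : Phi (p + 1) (r + 1) z = Phi (p + 1) r z - Phi (p + 1 + 1) (r + 1) z.
    by rewrite e3 addrK.
  by apply: (@kummer_alg p r z G _ _ _ _ _ e3'); [exact: e1|exact: e2].
have L : z `^ (p + 1) * Phi p r z * G @[z --> +oo] --> GammaP p * G.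
  by apply: cvgMr_tmp; exact: Phi_asymptotics.
rewrite mulfV ?lt0r_neq0 ?GammaP_gt0// in L.
by under eq_fun do rewrite mulrA.
Unshelve. all: by end_near. Qed.

(** The Wronskian of U and w is c e^z z^(-be), hence (w / U)' = c e^z z^(-be) / U^2. As U is
    eventually at most 2 z^(-al), this is at least |c| e^z z^(2 al - be) / 4 in absolute
    value, which is incompatible with w / U -> 1 unless c = 0; then w / U is constant. *)
Lemma tricomi_unique al be U w : 0 < al -> be <= 2 * al ->
  is_tricomiU al be U -> is_tricomiU al be w -> (forall z, 0 < z -> 0 < U z) ->
  forall z, 0 < z -> w z = U z.
Proof.
move=> al0 bel [kU lU] [kw lw] U0.
have dU z : 0 < z -> is_derive z (1 : R) U (derive1 U z).
  by move=> /kU[h _ _]; exact: der_of_derivable.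
have dU' z : 0 < z -> is_derive z (1 : R) (derive1 U) (derive1 (derive1 U) z).
  by move=> /kU[_ h _]; exact: der_of_derivable.
have dw z : 0 < z -> is_derive z (1 : R) w (derive1 w z).
  by move=> /kw[h _ _]; exact: der_of_derivable.
have dw' z : 0 < z -> is_derive z (1 : R) (derive1 w) (derive1 (derive1 w) z).
  by move=> /kw[_ h _]; exact: der_of_derivable.
pose W z := U z * derive1 w z - derive1 U z * w z.
pose D z := W z * (expR (- z) * z `^ be).
have dD z : 0 < z -> is_derive z (1 : R) D 0.
  move=> z0; apply: (is_derive_eq (derM
    (derB (derM (dU z z0) (dw' z z0)) (derM (dU' z z0) (dw z z0)))
    (derM (der_expR (derN (derId z))) (der_powR be z0 (derId z))))).
  have [_ _ e1] := kU z z0; have [_ _ e2] := kw z z0.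
  have zb : z `^ be = z * z `^ (be - 1).
    by rewrite -{2}(powRr1 (ltW z0)) -powRD ?(gt_eqF z0) ?implybT// addrC subrK.
  by rewrite zb; exact: (@wronskian_alg z be al (U z) _ _ (w z) _ _ (expR (- z)) (z `^ (be - 1)) e1 e2).
pose q z := w z / U z.
pose c := D 1.
have dq z : 0 < z -> is_derive z (1 : R) q (c * (expR z * z `^ (- be) / U z ^+ 2)).
  move=> z0; have Uz := lt0r_neq0 (U0 z z0).
  apply: (is_derive_eq (derM (dw z z0) (derV Uz (dU z z0)))).
  rewrite /c -(constant_on_gt0 dD z0 ltr01) /D -mulrA.
  have -> : expR (- z) * z `^ be * (expR z * z `^ (- be) / U z ^+ 2) =
     (expR (- z) * expR z) * (z `^ be * z `^ (- be)) / U z ^+ 2 by ring.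
  rewrite -expRD addNr expR0 -powRD ?(gt_eqF z0) ?implybT// subrr powRr0 !mul1r.
  by rewrite /W; move: (derive1 w z) (derive1 U z) Uz; move: (w z) (U z) => ? ? ? ? ?; field.
have ql : q z @[z --> +oo] --> (1 : R).
  rewrite -(divr1 1).
  have : (z `^ al * w z) / (z `^ al * U z) @[z --> +oo] --> (1 / 1 : R).
    by apply: cvgM => //; apply: cvgV => //; exact: oner_neq0.
  apply: cvg_trans; apply: near_eq_cvg; near=> z.
  have z0 : 0 < z by near: z; exact: nbhs_pinfty_gt.
  have Uz := lt0r_neq0 (U0 z z0); have az := lt0r_neq0 (powR_gt0 al z0).
  rewrite /q; move: (z `^ al) (w z) (U z) az Uz => ? ? ? az Uz; field; exact/andP.
(* If c were not 0, the mean value theorem on [z, z + 1] would contradict w / U -> 1. *)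
have c0 : c = 0.
  apply/eqP/negP => /negP c0.
  have cp : 0 < `|c| / 2 by rewrite divr_gt0 ?normr_gt0.
  have /cvgrPdist_lt/(_ _ cp)[M1 [_ H1]] := ql.
  have /cvgrPdist_lt/(_ _ (ltr01 : (0:R) < 1))[M2 [_ H2]] := lU.
  pose z := Num.max (Num.max M1 M2) 4 + 1.
  have [zM1 zM2 z4] : [/\ M1 < z, M2 < z & 4 < z].
    by split; rewrite /z ltr_pwDr// !le_max lexx ?orbT.
  have zz1 : z < z + 1 by rewrite ltrDl.
  have z0 : 0 < z by lra.
  have dqz x : x \in `]z, z + 1[ ->
      is_derive x (1 : R) q (c * (expR x * x `^ (- be) / U x ^+ 2)).
    by rewrite in_itv/= => /andP[h _]; apply: dq; apply: lt_trans h.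
  have cq : {within `[z, z + 1], continuous q}.
    by apply: der_within => x /andP[h _]; apply: dq; apply: lt_le_trans h.
  have [x + e] := MVT zz1 dqz cq; rewrite in_itv/= => /andP[x1 x2].
  have x0 : 0 < x by apply: lt_trans x1.
  have n1 := H1 _ zM1; have n2 := H1 _ (lt_trans zM1 zz1).
  have n3 := H2 x (lt_trans zM2 x1).
  have : `|q (z + 1) - q z| < `|c|.
    have -> : q (z + 1) - q z = (1 - q z) - (1 - q (z + 1)) by ring.
    apply: le_lt_trans (ler_normB _ _) _.
    by rewrite [ltRHS]splitr ltrD.
  rewrite e addrAC subrr add0r mulr1 normrM gtr_pMr ?normr_gt0// => /(le_lt_trans (ler_norm _)).
  apply/negP; rewrite -leNgt ler_pdivlMr ?exprn_gt0 ?U0// mul1r.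
  have aU : x `^ al * U x < 2 by move: n3; rewrite ltr_norml; lra.
  have Ux : U x <= 2 * x `^ (- al).
    by rewrite powRN ler_pdivlMr ?powR_gt0// mulrC ltW.
  have : U x ^+ 2 <= 4 * x `^ (- (2 * al)).
    rewrite (_ : 4 * _ = (2 * x `^ (- al)) ^+ 2).
      by rewrite ler_sqr ?nnegrE ?mulr_ge0 ?powR_ge0// ltW// U0.
    rewrite expr2 mulrACA -powRD ?(gt_eqF x0) ?implybT//.
    by congr (_ * _ `^ _); ring.
  move/le_trans; apply; apply: ler_pM => //; rewrite ?powR_ge0//.
    by apply: le_trans (expR_ge1Dx _); lra.
  by rewrite ler_powR; lra.
have q1 z : 0 < z -> q z = q 1.
  move=> z0; apply: (constant_on_gt0 _ z0 ltr01) => x x0.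
  by apply: (is_derive_eq (dq x x0)); rewrite c0 mul0r.
have q11 : q 1 = 1.
  apply: (cvg_unique _ _ ql) => //; apply: cvg_near_cst; near=> z; apply: q1.
  by near: z; exact: nbhs_pinfty_gt.
move=> z z0; have := q1 z z0; rewrite q11 /q => /(congr1 ( *%R^~ (U z))).
by rewrite divfK ?mul1r// gt_eqF// U0.
Unshelve. all: by end_near. Qed.

(** The Laplace transform satisfies the conditions that define [tricomiU], so the choice is
    made in a nonempty set, whose members agree on ]0, +oo[ by [tricomi_unique]. *)
Lemma tricomiUE p r z : 0 < p -> 0 <= r -> 0 < z ->
  tricomiU (p + 1) (p + 2 - r) z = Phi p r z / GammaP p.
Proof.
move=> p0 r0; have H := tricomi_Phi p0 r0.
have K : is_tricomiU (p + 1) (p + 2 - r) (tricomiU (p + 1) (p + 2 - r)).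
  exact: (@xgetPex _ (cst 0) [set w | is_tricomiU (p + 1) (p + 2 - r) w] (ex_intro _ _ H)).
move: z; apply: (tricomi_unique _ _ H K).
- by apply: addr_gt0.
- by rewrite mulrDr; lra.
- by move=> z z0; rewrite divr_gt0 ?Phi_gt0 ?GammaP_gt0.
Qed.

End Tricomi.

(** * The adjoint pair *)

Opaque Phi GammaP.

Section Adjoint.
Context {R : realType}.
Implicit Types (u v dv : R -> R) (al ka K k t : R).

(** The functions u and v, with dv = - v', solve the system adjoint to
    X' = - al X + ka al / (1+t) Y, Y' = X, so that v X + u Y is constant along its solutions.
    The pathwise analysis uses only this and the decay recorded here. *)
Record adjoint_pair al ka K k u v dv : Prop := {
  adj_K0 : 0 < K ;
  adj_k0 : 0 < k ;
  adj_der_v : forall t, 0 <= t -> is_derive t (1 : R) v (- dv t) ;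
  adj_der_u : forall t, 0 <= t -> is_derive t (1 : R) u (- (ka * al / (1 + t) * v t)) ;
  adj_dvE : forall t, 0 <= t -> dv t = u t - al * v t ;
  adj_u_gt0 : forall t, 0 <= t -> 0 < u t ;
  adj_v_gt0 : forall t, 0 <= t -> 0 < v t ;
  adj_dv_ge0 : forall t, 0 <= t -> 0 <= dv t ;
  adj_v_le : forall t, 0 <= t -> v t <= K * (1 + t) `^ (- ka) ;
  adj_dv_le : forall t, 0 <= t -> dv t <= K * (1 + t) `^ (- (ka + 1)) ;
  adj_u_ge : forall t, 0 <= t -> k * (1 + t) `^ (- ka) <= u t ;
  adj_u_lim : u t * (1 + t) `^ ka @[t --> +oo] --> al `^ (- ka) }.

Lemma powR_eqD (x p q s : R) : 0 < x -> p + q = s -> x `^ p * x `^ q = x `^ s.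
Proof. by move=> x0 <-; rewrite powRD// (gt_eqF x0) implybT. Qed.

(** By [tricomiUE], U(ka, 1, al (1 + t)). *)
Definition adju al ka t := Phi (ka - 1) ka (al * (1 + t)) / GammaP (ka - 1).
(** By [tricomiUE], (1 + t) U(1 + ka, 2, al (1 + t)). *)
Definition adjv al ka t := (1 + t) * (Phi ka ka (al * (1 + t)) / GammaP ka).
Definition adjdv al ka t := ka * Phi ka (ka + 1) (al * (1 + t)) / GammaP ka.

Lemma adjoint_alg_v (t al ka z A B C D G : R) : z = al * (1 + t) -> G != 0 ->
  z * B = (ka + 1) * A - ka * D -> A = C + D ->
  1 * (A / G) + (1 + t) * (- B * al * G^-1 + A * 0) = - (ka * C / G).
Proof.
move=> zE G0 e1 e2; have -> : (1 + t) * (- B * al * G^-1 + A * 0) = - (z * B) / G.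
  by rewrite zE; ring.
by rewrite e1 e2; field.
Qed.

Lemma adjoint_alg_dv (t al ka z A C E G G0 : R) : z = al * (1 + t) -> G0 != 0 -> ka != 0 ->
  G = ka * G0 -> z * A = ka * E - ka * C ->
  ka * C / G = E / G0 - al * ((1 + t) * (A / G)).
Proof.
move=> zE G0n kan GE e1; have -> : al * ((1 + t) * (A / G)) = z * A / G.
  by rewrite zE !mulrA.
by rewrite e1 GE; field; rewrite ?kan ?G0n.
Qed.

Lemma adjoint_alg_u (t al ka A G G0 : R) : 1 + t != 0 -> G0 != 0 -> ka != 0 -> G = ka * G0 ->
  - A * al * G0^-1 = - (ka * al / (1 + t) * ((1 + t) * (A / G))).
Proof. by move=> t0 G0n kan ->; field; rewrite ?t0 ?G0n ?kan. Qed.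

Lemma cvg_comp_affine (f : R -> R) (al l : R) : 0 < al ->
  f z @[z --> +oo] --> l -> f (al * (1 + t)) @[t --> +oo] --> l.
Proof.
move=> al0; apply: (cvg_comp (fun t => al * (1 + t)) f).
apply: gt0_cvgMry => //.
exact: cvg_addrl.
Qed.

(** The derivatives are contiguous relations for Phi and the upper bounds are [Phi_le]. For
    the lower bound on u, the asymptotics handle large t, and monotonicity the rest. *)
Lemma adjoint_exists al ka : 0 < al -> 1 < ka ->
  exists K k, adjoint_pair al ka K k (adju al ka) (adjv al ka) (adjdv al ka).
Proof.
move=> al0 ka1; have ka0 : 0 < ka by apply: lt_trans ka1.
have ka0' := ltW ka0.
have km : 0 < ka - 1 by rewrite subr_gt0.
have kp : 0 < ka + 1 by apply: addr_gt0.
have kp' := ltW kp.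
have k11 : 1 < ka + 1 by rewrite ltrDr.
have G0 := GammaP_gt0 km; have G1 := GammaP_gt0 ka0.
have GE : GammaP ka = ka * GammaP (ka - 1) :> R by have := GammaPS km; rewrite subrK.
have t1 t : 0 <= t -> 0 < 1 + t by move=> ?; rewrite ltr_pwDl.
have z0 t : 0 <= t -> 0 < al * (1 + t) by move=> /t1; exact: mulr_gt0.
have dz t : is_derive t (1 : R) (fun t => al * (1 + t)) al.
  by apply: (is_derive_eq (derZ al (derD (derC t 1) (derId t)))); rewrite add0r mulr1.
have du t : 0 <= t -> is_derive t (1 : R) (adju al ka) (- (ka * al / (1 + t) * adjv al ka t)).
  move=> t0; have := Phi_der km ka0' (z0 t t0); rewrite subrK => dP.
  apply: (is_derive_eq (derM (der_comp (dz t) dP) (derC t _))).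
  rewrite mulr0 addr0; apply: adjoint_alg_u => //; exact/lt0r_neq0 || exact/lt0r_neq0/t1.
have dv t : 0 <= t -> is_derive t (1 : R) (adjv al ka) (- adjdv al ka t).
  move=> t0; have dP := Phi_der ka0 ka0' (z0 t t0).
  apply: (is_derive_eq (derM (derD (derC t 1) (derId t)) (derM (der_comp (dz t) dP) (derC t _)))).
  rewrite add0r; have e1 := Phi_by_parts k11 ka0' (z0 t t0); rewrite addrK in e1.
  by apply: (adjoint_alg_v (erefl _) _ e1 (Phi_split ka0 ka0' (z0 t t0))); exact: lt0r_neq0.
have vu t : 0 <= t -> adjdv al ka t = adju al ka t - al * adjv al ka t.
  move=> t0; apply: (adjoint_alg_dv (erefl _) _ _ GE (Phi_by_parts ka1 ka0' (z0 t t0)));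
    exact: lt0r_neq0.
have P0 t : 0 <= t -> 0 < Phi ka ka (al * (1 + t)) by move=> t0; apply: Phi_gt0 (z0 t t0).
have u0 t : 0 <= t -> 0 < adju al ka t.
  by move=> t0; apply: divr_gt0 G0; apply: Phi_gt0 (z0 t t0).
have v0 t : 0 <= t -> 0 < adjv al ka t.
  by move=> t0; apply: (mulr_gt0 (t1 t t0)); apply: divr_gt0 (P0 t t0) G1.
have limu : adju al ka t * (1 + t) `^ ka @[t --> +oo] --> al `^ (- ka).
  have L : (al * (1 + t)) `^ (ka - 1 + 1) * Phi (ka - 1) ka (al * (1 + t)) *
      (al `^ (- ka) / GammaP (ka - 1)) @[t --> +oo] -->
      GammaP (ka - 1) * (al `^ (- ka) / GammaP (ka - 1)).
    apply: cvgMr_tmp.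
    exact: (cvg_comp_affine (f := fun z => z `^ (ka - 1 + 1) * Phi (ka - 1) ka z) al0
      (Phi_asymptotics km ka0')).
  rewrite mulrCA divff ?lt0r_neq0// mulr1 in L.
  apply: cvg_trans L; apply: near_eq_cvg; near=> t.
  have t0 : 0 <= t by near: t; exact: nbhs_pinfty_ge.
  rewrite subrK powRM ?(ltW (t1 t t0)) ?(ltW al0)// /adju.
  have e := @powR_eqD al ka (- ka) 0 al0 (subrr ka); rewrite powRr0 in e.
  transitivity ((al `^ ka * al `^ (- ka)) * ((1 + t) `^ ka * (Phi (ka - 1) ka (al * (1 + t)) / GammaP (ka - 1)))).
    by ring.
  by rewrite e mul1r mulrC.
have [k [k0 hk]] : exists k, 0 < k /\ forall t, 0 <= t -> k * (1 + t) `^ (- ka) <= adju al ka t.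
  have a0 : 0 < al `^ (- ka) by apply: powR_gt0.
  have /cvgrPdist_lt/(_ (al `^ (- ka) / 2)) := limu.
  rewrite divr_gt0// => /(_ isT)[M [_ hM]].
  (* On [0, T] the decreasing function u is at least u T; beyond T it is close to its limit. *)
  pose T := Num.max 0 M + 1.
  have T0 : 0 <= T by rewrite /T addr_ge0// le_max lexx.
  have MT : M < T by rewrite /T ltr_pwDr// le_max lexx orbT.
  pose k := Num.min (al `^ (- ka) / 2) (adju al ka T).
  have kle t : 0 <= t -> k * (1 + t) `^ (- ka) <= k.
    move=> t0; rewrite ger_pMr; last by rewrite /k lt_min divr_gt0//= u0.
    by rewrite -[leRHS](powRr0 (1 + t)) ler_powR ?lerDl// oppr_le0.
  exists k; split; first by rewrite /k lt_min divr_gt0//= u0.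
  move=> t t0; have [tT|Tt] := leP t T.
    apply: le_trans (kle t t0) _; apply: (@le_trans _ _ (adju al ka T)).
      by rewrite /k ge_min lexx orbT.
    rewrite -subr_ge0 -(subrr (0 : R)).
    have := @le_increment R (adju al ka) (fun=> 0) (fun t => - (ka * al / (1 + t) * adjv al ka t))
      (fun=> 0) t T tT.
    rewrite subrr subr_le0 subr_ge0; apply.
    + by apply: der_within => x /andP[tx _]; apply: du; apply: le_trans tx.
    + by move=> x; apply: cvg_cst.
    + by move=> x /andP[tx _]; apply: du; apply: le_trans t0 (ltW tx).
    + move=> x /andP[tx _]; have x0 := le_trans t0 (ltW tx).
      by rewrite oppr_le0 mulr_ge0 ?(ltW (v0 x x0))// divr_ge0 ?mulr_ge0 ?(ltW (t1 x x0))// ltW.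
  rewrite powRN ler_pdivrMr ?powR_gt0 ?t1//.
  have := hM t (lt_trans MT Tt); rewrite ltr_norml => /andP[_ h].
  apply: (@le_trans _ _ (al `^ (- ka) / 2)); first by rewrite /k ge_min lexx.
  rewrite /= in h; move: h; set y := adju _ _ _ * _; lra.
have Kp : 0 < (1 + ka) * al `^ (- (ka + 1)) by rewrite mulr_gt0 ?powR_gt0// addr_gt0.
have PK t : 0 <= t -> forall r, 0 <= r ->
    Phi ka r (al * (1 + t)) / GammaP ka <= al `^ (- (ka + 1)) * (1 + t) `^ (- (ka + 1)).
  move=> t0 r r0; rewrite -powRM ?(ltW al0) ?(ltW (t1 t t0))//.
  rewrite ler_pdivrMr ?G1// [leRHS]mulrC; exact: Phi_le (z0 t t0).
exists ((1 + ka) * al `^ (- (ka + 1))), k; split => //.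
- move=> t t0; apply: divr_ge0 (ltW G1); apply: (mulr_ge0 ka0'); apply: ltW.
  exact: Phi_gt0 (z0 t t0).
- move=> t t0; apply: le_trans (ler_wpM2l (ltW (t1 t t0)) (PK t t0 ka ka0')) _.
  have e : (1 + t) * (1 + t) `^ (- (ka + 1)) = (1 + t) `^ (- ka).
    rewrite -[X in X * _](powRr1 (ltW (t1 t t0))).
    by apply: powR_eqD; [exact: t1|ring].
  by rewrite mulrCA e -mulrA ler_peMl ?mulr_ge0 ?powR_ge0// lerDl.
- move=> t t0; rewrite /adjdv -mulrA.
  apply: le_trans (ler_wpM2l ka0' (PK t t0 _ kp')) _.
  by rewrite mulrA ler_wpM2r ?powR_ge0// ler_wpM2r ?powR_ge0// lerDr.
Unshelve. all: by end_near. Qed.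

End Adjoint.

(** * Asymptotics of one path *)

Section PathAnalysis.
Context {R : realType} (al ka eps sg K k : R) (u v dv : R -> R).
Context (al0 : 0 < al) (eps0 : 0 < eps) (kaE : ka = 1 + 2 * eps) (sg0 : 0 < sg).
Context (adj : adjoint_pair al ka K k u v dv).

(** The equation for Z = X - sg B and Y = int X, in which the path B is not differentiated.
    The last condition is the only regularity of B that matters. Its exponent eps is half
    the exponent 2 eps = ka - 1 of the growth of X, so that the contributions of B that
    are not captured by the limit of v Z + u Y are of lower order. *)
Record driven_path (Z Y B : R -> R) (L : R) : Prop := {
  path_cZ : {within `[0, +oo[, continuous Z} ;
  path_cY : {within `[0, +oo[, continuous Y} ;
  path_dZ : forall t : R, 0 < t ->
    is_derive t (1 : R) Z (- al * (Z t + sg * B t) + ka * al / (1 + t) * Y t) ;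
  path_dY : forall t : R, 0 < t -> is_derive t (1 : R) Y (Z t + sg * B t) ;
  path_L : 0 <= L ;
  path_B0 : B 0 = 0 ;
  path_B : forall s t : R, 0 <= s -> s <= t ->
    `|B t - B s| <= L * (1 + t) `^ eps * (1 + (t - s)) }.

Lemma within_sub (f : R -> R) (a b : R) : 0 <= a -> {within `[0, +oo[, continuous f} ->
  {within `[a, b], continuous f}.
Proof.
move=> a0; apply: continuous_subspaceW => x /=; rewrite !in_itv/= andbT.
by move=> /andP[ax _]; apply: le_trans ax.
Qed.

Lemma within_mul (f g : R -> R) (A : set R) : {within A, continuous f} ->
  {within A, continuous g} -> {within A, continuous (fun x => f x * g x)}.
Proof. by move=> cf cg x; apply: cvgM; [exact: cf|exact: cg]. Qed.

Lemma within_add (f g : R -> R) (A : set R) : {within A, continuous f} ->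
  {within A, continuous g} -> {within A, continuous (fun x => f x + g x)}.
Proof. by move=> cf cg x; apply: cvgD; [exact: cf|exact: cg]. Qed.

Lemma within_cst (c : R) (A : set R) : {within A, continuous (fun=> c : R)}.
Proof. by move=> x; exact: cvg_cst. Qed.

Lemma der_within_cy (f f' : R -> R) : (forall x : R, 0 <= x -> is_derive x (1 : R) f (f' x)) ->
  {within `[0, +oo[, continuous f}.
Proof.
move=> df; apply: continuous_in_subspaceT => x.
by rewrite inE/= in_itv/= andbT => /df/der_cont.
Qed.

Lemma path_B_le Z Y B L (t : R) : driven_path Z Y B L -> 0 <= t ->
  `|B t| <= L * (1 + t) `^ (1 + eps).
Proof.
move=> P t0; have := path_B P (lexx 0) t0; rewrite (path_B0 P) !subr0 => /le_trans; apply.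
rewrite -mulrA ler_wpM2l ?(path_L P)// mulrC -[X in X * _](@powRr1 _ (1 + t)) ?addr_ge0//.
by rewrite (@powR_eqD R _ _ _ (1 + eps)) ?ltr_pwDl.
Qed.

(** The primitive of (1+t)^(-(1+eps)), which is bounded because eps > 0. *)
Definition potential (t : R) := - (1 + t) `^ (- eps) / eps.

Lemma der_onepluspowR (p t : R) : 0 <= t ->
  is_derive t (1 : R) (fun t => (1 + t) `^ p) (p * (1 + t) `^ (p - 1)).
Proof.
move=> t0; apply: (is_derive_eq (der_powR (f := fun t => 1 + t) p _ (derD (derC t 1) (derId t)))).
  by rewrite ltr_pwDl.
by rewrite add0r mulr1.
Qed.

Lemma potential_der (t : R) : 0 <= t -> is_derive t (1 : R) potential ((1 + t) `^ (- (1 + eps))).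
Proof.
move=> t0; apply: (is_derive_eq (derM (derN (der_onepluspowR (- eps) t0)) (derC t eps^-1))).
rewrite mulr0 addr0 (_ : - eps - 1 = - (1 + eps)); last by ring.
by field; rewrite gt_eqF.
Qed.

Lemma potential_incr_le (s t : R) : 0 <= s ->
  potential t - potential s <= (1 + s) `^ (- eps) / eps.
Proof.
move=> s0; rewrite /potential !mulNr opprK.
by rewrite gerDr oppr_le0 divr_ge0 ?powR_ge0// ltW.
Qed.

Lemma powRN_cvg0 (p : R) : 0 < p -> (1 + t) `^ (- p) @[t --> +oo] --> (0 : R).
Proof.
move=> p0; apply/cvgrPdist_lt => d d0; near=> t.
have t1 : d `^ (- p^-1) < 1 + t.
  by rewrite -ltrBlDl; near: t; exact: nbhs_pinfty_gt.
have t0 : 0 < 1 + t by apply: lt_trans t1; exact: powR_gt0.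
rewrite sub0r normrN ger0_norm ?powR_ge0// powRN invf_plt ?posrE ?powR_gt0//.
have := @gt0_ltr_powR R p p0 (d `^ (- p^-1)) (1 + t).
rewrite !nnegrE powR_ge0 (ltW t0) -powRrM mulNr mulVf ?gt_eqF// => /(_ isT isT t1).
by rewrite powR_inv1// ltW.
Unshelve. all: by end_near. Qed.

Lemma ka_gt0 : 0 < ka.
Proof. by rewrite kaE addr_gt0// mulr_gt0. Qed.

(** The integrating factor. Eliminating Y from the equation through v X + u Y = M gives
    X' = - (al + gain * v) X + gain * M, and al + gain * v is the logarithmic derivative
    of [Hinv]. *)
Definition Hinv (t : R) := expR (al * t) / u t.
Definition gain (t : R) := ka * al / ((1 + t) * u t).
Definition dHinv (t : R) := Hinv t * (al + gain t * v t).

Lemma Hinv_gt0 (t : R) : 0 <= t -> 0 < Hinv t.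
Proof. by move=> t0; apply: divr_gt0 (expR_gt0 _) (adj_u_gt0 adj t0). Qed.

Lemma gain_gt0 (t : R) : 0 <= t -> 0 < gain t.
Proof.
move=> t0; apply: divr_gt0; first by apply: mulr_gt0 ka_gt0 al0.
by apply: mulr_gt0 (adj_u_gt0 adj t0); rewrite ltr_pwDl.
Qed.

Lemma Hinv_der (t : R) : 0 <= t -> is_derive t (1 : R) Hinv (dHinv t).
Proof.
move=> t0; have un := lt0r_neq0 (adj_u_gt0 adj t0).
have t1 : 1 + t != 0 by rewrite lt0r_neq0// ltr_pwDl.
apply: (is_derive_eq (derM (der_expR (derZ al (derId t))) (derV un (adj_der_u adj t0)))).
rewrite /dHinv /Hinv /gain; move: (expR _) (u t) (v t) un => E u' v' un.
by field; rewrite t1 un.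
Qed.

Lemma dHinv_ge (t : R) : 0 <= t -> al * Hinv t <= dHinv t.
Proof.
move=> t0; rewrite /dHinv mulrC; apply: ler_wpM2l; first exact: ltW (Hinv_gt0 t0).
by rewrite lerDl; apply: mulr_ge0; apply: ltW; [exact: gain_gt0|exact: (adj_v_gt0 adj t0)].
Qed.

Lemma Hinv_cont : {within `[0, +oo[, continuous Hinv}.
Proof. exact: der_within_cy Hinv_der. Qed.

Lemma Hinv_le (s t : R) : 0 <= s -> s <= t -> Hinv s <= Hinv t.
Proof.
move=> s0 st; apply: (@le_of_der_ge0 R Hinv dHinv s t st).
- exact: within_sub s0 Hinv_cont.
- by move=> x /andP[sx _]; apply: Hinv_der; apply: le_trans s0 (ltW sx).
- move=> x /andP[sx _]; have x0 := le_trans s0 (ltW sx).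
  by apply: le_trans (dHinv_ge x0); apply: mulr_ge0 (ltW al0) (ltW (Hinv_gt0 x0)).
Qed.

Lemma primitive_integrable (f : R -> R) (c d : R) : {within `[c, +oo[, continuous f} ->
  lebesgue_measure.-integrable `[c, d] (EFin \o f).
Proof.
move=> cf; apply: continuous_compact_integrable; first exact: segment_compact.
by apply: continuous_subspaceW cf; apply: subset_itvl; rewrite bnd_simp.
Qed.

Lemma primitive_der (f : R -> R) (c : R) : {within `[c, +oo[, continuous f} ->
  forall t : R, c < t ->
  is_derive t (1 : R) (fun t => \int[lebesgue_measure]_(s in `[c, t]) f s) (f t).
Proof.
move=> cf t ct; have tt1 : t < t + 1 by rewrite ltrDl.
have ft : {for t, continuous f}.
  by move/continuous_within_itvcyP : cf => [h _]; apply: h; rewrite in_itv/= ct.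
have [D E] := continuous_FTC1_closed tt1 (primitive_integrable (t + 1) cf) ct ft.
by apply: DeriveDef; [exact: D|rewrite -E derive1E].
Qed.

Lemma primitive_cont (f : R -> R) (c : R) : {within `[c, +oo[, continuous f} ->
  {within `[c, +oo[, continuous (fun t => \int[lebesgue_measure]_(s in `[c, t]) f s)}.
Proof.
move=> cf; apply/continuous_within_itvcyP; split.
  by move=> t; rewrite in_itv/= andbT => ct; exact: der_cont (primitive_der cf ct).
have c1 : c < c + 1 by rewrite ltrDl.
have := parameterized_integral_continuous (ltW c1) (primitive_integrable (c + 1) cf).
by move=> /(continuous_within_itvP _ c1)[_ h _].
Qed.

(** Beyond some T the function |(f - l g)'| is at most (d/2) g', so f - l g changes by
    at most (d/2) g; the initial values disappear because g diverges. *)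
Lemma lhopital_pinfty (f g f' g' : R -> R) (l : R) :
  (forall t : R, 0 < t -> is_derive t (1 : R) f (f' t)) ->
  (forall t : R, 0 < t -> is_derive t (1 : R) g (g' t)) ->
  (forall t : R, 0 < t -> 0 < g' t) ->
  g t @[t --> +oo] --> +oo -> f' t / g' t @[t --> +oo] --> l ->
  f t / g t @[t --> +oo] --> l.
Proof.
move=> df dg g'0 goo L; apply/cvgrPdist_lt => d d0.
have d20 : 0 < d / 2 by rewrite divr_gt0.
have /cvgrPdist_lt/(_ _ d20)[M [_ hM]] := L.
pose T := Num.max 0 M + 1.
have T0 : 0 < T by rewrite /T ltr_wpDl// le_max lexx.
have MT : M < T by rewrite /T ltr_pwDr// le_max lexx orbT.
have key (t : R) : T <= t -> `|f t - l * g t - (f T - l * g T)| <= d / 2 * g t - d / 2 * g T.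
  move=> Tt; apply: (@le_norm_increment R (fun s => f s - l * g s) (fun s => d / 2 * g s)
     (fun s => f' s - l * g' s) (fun s => d / 2 * g' s) T t Tt).
  - apply: (@der_within _ _ (fun s => f' s - l * g' s)) => x /andP[Tx _].
    by apply: derB; [apply: df|apply: derZ; apply: dg]; exact: lt_le_trans Tx.
  - apply: (@der_within _ _ (fun s => d / 2 * g' s)) => x /andP[Tx _].
    by apply: derZ; apply: dg; exact: lt_le_trans Tx.
  - move=> x /andP[Tx _].
    by apply: derB; [apply: df|apply: derZ; apply: dg]; exact: lt_trans Tx.
  - by move=> x /andP[Tx _]; apply: derZ; apply: dg; exact: lt_trans Tx.
  - move=> x /andP[Tx _]; have gx := g'0 x (lt_trans T0 Tx).
    have := hM x (lt_trans MT Tx) => /ltW.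
    have -> : l - f' x / g' x = - ((f' x - l * g' x) / g' x) by field; rewrite gt_eqF.
    by rewrite normrN normrM [X in _ * X]gtr0_norm ?invr_gt0// ler_pdivrMr.
near=> t.
have Tt : T <= t by near: t; apply: nbhs_pinfty_ge; exact: num_real.
have gt0 : 0 < g t by near: t; exact: (cvgry_gt goo).
have gC : (`|f T - l * g T| + d / 2 * `|g T|) / (d / 2) < g t by near: t; exact: (cvgry_gt goo).
have -> : l - f t / g t = - ((f t - l * g t) / g t) by field; rewrite gt_eqF.
rewrite normrN normrM [X in _ * X]gtr0_norm ?invr_gt0// ltr_pdivrMr//.
move: gC; rewrite ltr_pdivrMr// => gC.
have -> : f t - l * g t = (f t - l * g t - (f T - l * g T)) + (f T - l * g T) by rewrite subrK.
apply: le_lt_trans (ler_normD _ _) _.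
apply: le_lt_trans (lerD (key t Tt) (lexx _)) _.
have h : - (d / 2 * g T) <= d / 2 * `|g T|.
  by rewrite -mulrN ler_pM2l// -normrN ler_norm.
by lra.
Unshelve. all: by end_near. Qed.

(** [growth t / Hinv t] is the solution of X' = - (al + gain * v) X + gain that starts
    at 0, that is, the response of X to the value M = 1 of the conserved pairing. *)
Definition growth (t : R) := \int[lebesgue_measure]_(s in `[0, t]) (gain s * Hinv s).

Lemma gain_cont : {within `[0, +oo[, continuous gain}.
Proof.
have dg (t : R) : 0 <= t -> {for t, continuous gain}.
  move=> t0; have n0 : (1 + t) * u t != 0.
    by rewrite lt0r_neq0//; apply: mulr_gt0 (adj_u_gt0 adj t0); rewrite ltr_pwDl.
  apply: der_cont; apply: (derM (derC t (ka * al)) (@derV R (fun t => (1 + t) * u t) t _ n0 _)).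
  exact: derM (derD (derC t 1) (derId t)) (adj_der_u adj t0).
by apply: continuous_in_subspaceT => t; rewrite inE/= in_itv/= andbT; exact: dg.
Qed.

Lemma growth_cont : {within `[0, +oo[, continuous growth}.
Proof. by apply: primitive_cont; apply: within_mul; [exact: gain_cont|exact: Hinv_cont]. Qed.

Lemma growth_der (t : R) : 0 < t -> is_derive t (1 : R) growth (gain t * Hinv t).
Proof. by apply: primitive_der; apply: within_mul; [exact: gain_cont|exact: Hinv_cont]. Qed.

Lemma growth0 : growth 0 = 0.
Proof. by rewrite /growth set_itv1 Rintegral_set1. Qed.

Definition rho := ka * al `^ ka.

Lemma gain_v_cvg0 : gain t * v t @[t --> +oo] --> (0 : R).
Proof.
have b (t : R) : 0 <= t -> 0 <= gain t * v t <= ka * al * K / k * (1 + t) `^ (- 1).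
  move=> t0; have t1 : 0 < 1 + t by rewrite ltr_pwDl.
  apply/andP; split.
    by apply: mulr_ge0; apply: ltW; [exact: gain_gt0|exact: (adj_v_gt0 adj t0)].
  rewrite /gain mulrAC ler_pdivrMr; last by apply: mulr_gt0 t1 (adj_u_gt0 adj t0).
  rewrite powR_inv1 ?(ltW t1)//.
  have -> : ka * al * K / k / (1 + t) * ((1 + t) * u t) = ka * al * (K / k * u t).
    by field; rewrite (lt0r_neq0 t1) lt0r_neq0// (adj_k0 adj).
  rewrite ler_pM2l; last exact: mulr_gt0 ka_gt0 al0.
  apply: le_trans (adj_v_le adj t0) _.
  rewrite -mulrA ler_pM2l ?(adj_K0 adj)// ler_pdivlMl ?(adj_k0 adj)//.
  exact: adj_u_ge adj _ t0.
apply: (@squeeze_cvgr _ _ _ _ (fun=> 0) (fun t => ka * al * K / k * (1 + t) `^ (- 1))).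
- by near=> t; apply: b; near: t; exact: nbhs_pinfty_ge.
- exact: cvg_cst.
- by rewrite -(mulr0 (ka * al * K / k)); apply: cvgMl_tmp; exact: powRN_cvg0.
Unshelve. all: by end_near. Qed.

(** L'Hopital's rule with (1+t)^(2 eps) Hinv as denominator: the quotient of the derivatives is
    ka al / (u (1+t)^ka) / (al + o(1)), and u (1+t)^ka tends to al^(-ka). *)
Lemma growth_ratio_cvg :
  growth t / ((1 + t) `^ (2 * eps) * Hinv t) @[t --> +oo] --> rho.
Proof.
pose D' t := 2 * eps * (1 + t) `^ (2 * eps - 1) * Hinv t + (1 + t) `^ (2 * eps) * dHinv t.
have D'E (t : R) : 0 < t ->
    D' t = (1 + t) `^ (2 * eps) * Hinv t * (2 * eps * (1 + t) `^ (- 1) + (al + gain t * v t)).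
  move=> t0; have t1 : 0 < 1 + t by rewrite addr_gt0.
  by rewrite /D' /dHinv -(powR_eqD t1 (erefl (2 * eps - 1))); ring.
have q0 (t : R) : 0 < t -> 0 < 2 * eps * (1 + t) `^ (- 1) + (al + gain t * v t).
  move=> t0; have t0' := ltW t0; apply: addr_gt0.
    by apply: mulr_gt0; [exact: mulr_gt0|rewrite powR_gt0// addr_gt0].
  by apply: addr_gt0 => //; apply: mulr_gt0; [exact: gain_gt0|exact: (adj_v_gt0 adj t0')].
apply: (@lhopital_pinfty growth (fun t => (1 + t) `^ (2 * eps) * Hinv t)
  (fun t => gain t * Hinv t) D').
- by move=> t t0; exact: growth_der.
- by move=> t t0; exact: derM (der_onepluspowR _ (ltW t0)) (Hinv_der (ltW t0)).
- move=> t t0; rewrite D'E//; apply: mulr_gt0 (q0 t t0); apply: mulr_gt0.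
    by rewrite powR_gt0// addr_gt0.
  exact: Hinv_gt0 (ltW t0).
- apply: (@ger_cvgy _ _ _ _ (fun t => (1 + al * t) / u 0)); last first.
    apply: gt0_cvgMly; first by rewrite invr_gt0 (adj_u_gt0 adj).
    apply: (cvg_comp (fun t => al * t) (fun x => 1 + x)); last exact: cvg_addrl.
    by apply: gt0_cvgMry => //; exact: cvg_id.
  near=> t; have t0 : 0 <= t by near: t; exact: nbhs_pinfty_ge.
  have H0 := Hinv_gt0 t0.
  apply: (@le_trans _ _ (Hinv t)); last first.
    have w1 : 1 <= (1 + t) `^ (2 * eps).
      by rewrite -[leLHS](powRr0 (1 + t)) ler_powR ?lerDl// mulr_ge0// ltW.
    exact: ler_peMl (ltW H0) w1.
  have ul : u t <= u 0.
    rewrite -lerN2.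
    apply: (@le_of_der_ge0 R (fun t => - u t) (fun t => - - (ka * al / (1 + t) * v t)) 0 t t0).
    + apply: within_sub (lexx 0) _; apply: der_within_cy => x x0.
      by apply: derN; exact: adj_der_u adj _ x0.
    + by move=> x /andP[x0 _]; apply: derN; exact: adj_der_u adj _ (ltW x0).
    + move=> x /andP[x0 _]; rewrite opprK; apply: mulr_ge0 (ltW (adj_v_gt0 adj (ltW x0))).
      apply: divr_ge0; first by apply: mulr_ge0; apply: ltW; [exact: ka_gt0|].
      by rewrite addr_ge0// ltW.
  apply: ler_pM.
  + by rewrite addr_ge0// mulr_ge0// ltW.
  + by rewrite invr_ge0; apply: ltW; exact: (adj_u_gt0 adj (lexx 0)).
  + exact: expR_ge1Dx.
  + by rewrite lef_pV2 ?posrE; [exact: ul|exact: (adj_u_gt0 adj (lexx 0))|exact: (adj_u_gt0 adj t0)].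
- have L : ka * al / (u t * (1 + t) `^ ka) /
      (2 * eps * (1 + t) `^ (- 1) + (al + gain t * v t)) @[t --> +oo] -->
      ka * al / (al `^ (- ka)) / (2 * eps * 0 + (al + 0)).
    have a0 : al `^ (- ka) != 0 by rewrite gt_eqF// powR_gt0.
    apply: cvgM; first by apply: cvgMl_tmp; apply: cvgV => //; exact: adj_u_lim adj.
    apply: cvgV; first by rewrite mulr0 add0r addr0 gt_eqF.
    apply: cvgD; first by apply: cvgMl_tmp; exact: powRN_cvg0.
    by apply: cvgD; [exact: cvg_cst|exact: gain_v_cvg0].
  rewrite powRN invrK mulr0 add0r addr0 in L.
  have -> : rho = ka * al * al `^ ka / al by rewrite /rho; field; rewrite gt_eqF.
  apply: cvg_trans L; apply: near_eq_cvg; near=> t.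
  have t0 : 0 < t by near: t; exact: nbhs_pinfty_gt.
  have t1 : 0 < 1 + t by rewrite addr_gt0.
  have H0 := lt0r_neq0 (Hinv_gt0 (ltW t0)); have u0 := lt0r_neq0 (adj_u_gt0 adj (ltW t0)).
  have e : (1 + t) `^ ka = (1 + t) * (1 + t) `^ (2 * eps).
    by rewrite -[X in X * _](powRr1 (ltW t1)) (powR_eqD t1 (esym kaE)).
  have p0 := lt0r_neq0 (powR_gt0 (2 * eps) t1).
  rewrite D'E// e; move: (q0 t t0) => /lt0r_neq0; set q := _ + (al + _) => q1.
  rewrite /gain; move: q (u t) (Hinv t) (_ `^ (2 * eps)) u0 H0 p0 q1 => q u' h p u0 h0 p0 q1.
  by field; rewrite ?u0 ?h0 ?p0 ?q1 (lt0r_neq0 t1).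
Unshelve. all: by end_near. Qed.

Lemma onepluspowR_ratio_cvg (p : R) : ((1 + t) / t) `^ p @[t --> +oo] --> (1 : R).
Proof.
have L : (1 + t) / t @[t --> +oo] --> (1 : R).
  have : 1 + t^-1 @[t --> +oo] --> (1 + 0 : R).
    apply: cvgD; first exact: cvg_cst.
    apply/gtr0_cvgV0; first by near=> t; near: t; exact: nbhs_pinfty_gt.
    exact: cvg_id.
  rewrite addr0; apply: cvg_trans; apply: near_eq_cvg; near=> t.
  have t0 : 0 < t by near: t; exact: nbhs_pinfty_gt.
  by field; rewrite gt_eqF.
have C : x `^ p @[x --> (1 : R)] --> (1 : R).
  rewrite -[X in _ --> X](_ : 1 `^ p = 1); last by rewrite powR1.
  exact: der_cont (is_derive1_powR p ltr01).
exact: (cvg_comp (fun t => (1 + t) / t) (fun x => x `^ p) L C).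
Unshelve. all: by end_near. Qed.

Lemma growth_cvg : growth t / Hinv t / t `^ (2 * eps) @[t --> +oo] --> rho.
Proof.
have L : growth t / ((1 + t) `^ (2 * eps) * Hinv t) * ((1 + t) / t) `^ (2 * eps)
    @[t --> +oo] --> rho * 1.
  by apply: cvgM; [exact: growth_ratio_cvg|exact: onepluspowR_ratio_cvg].
rewrite mulr1 in L; apply: cvg_trans L; apply: near_eq_cvg; near=> t.
have t0 : 0 < t by near: t; exact: nbhs_pinfty_gt.
have t1 : 0 < 1 + t by rewrite addr_gt0.
have H0 := lt0r_neq0 (Hinv_gt0 (ltW t0)).
have p0 := lt0r_neq0 (powR_gt0 (2 * eps) t1); have p1 := lt0r_neq0 (powR_gt0 (2 * eps) t0).
have -> : ((1 + t) / t) `^ (2 * eps) = (1 + t) `^ (2 * eps) / t `^ (2 * eps).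
  by rewrite powRM ?invr_ge0 ?ltW// -powR_inv1 ?ltW// -powRrM mulN1r powRN.
move: (growth t) (Hinv t) (_ `^ (2 * eps)) ((1 + t) `^ _) H0 p0 p1 => g h p q h0 p0 q0.
by field; rewrite ?h0 ?p0 ?q0.
Unshelve. all: by end_near. Qed.

(** The derivative of Z Hinv - M growth + sg Hinv B(t), for a fixed final time t: bt stands
    for B(t), and b for the value of B at the current time. *)
Lemma path_alg (al' ka' H u' v' z y b bt M w sg' : R) : w != 0 -> u' != 0 ->
  (- al' * (z + sg' * b) + ka' * al' / w * y) * H +
  z * (H * (al' + ka' * al' / (w * u') * v')) - M * (ka' * al' / (w * u') * H) +
  sg' * (H * (al' + ka' * al' / (w * u') * v')) * bt =
  sg' * (H * (al' + ka' * al' / (w * u') * v')) * (bt - b) +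
  H * (ka' * al' / (w * u')) * (v' * (z + sg' * b) + u' * y - M).
Proof. by move=> w0 u0; field; rewrite w0 u0. Qed.

Lemma gain_le (s : R) : 0 <= s -> gain s * (1 + s) `^ (- eps) <= ka * al / k * (1 + s) `^ eps.
Proof.
move=> s0; have s1 : 0 < 1 + s by rewrite ltr_pwDl.
have e : (1 + s) * (1 + s) `^ (- ka) = (1 + s) `^ (- (2 * eps)).
  rewrite -[X in X * _](powRr1 (ltW s1)); apply: powR_eqD => //.
  by rewrite kaE; ring.
have h : gain s <= ka * al / k * (1 + s) `^ (2 * eps).
  rewrite /gain ler_pdivrMr; last by apply: mulr_gt0 s1 (adj_u_gt0 adj s0).
  apply: (@le_trans _ _ (ka * al / k * (1 + s) `^ (2 * eps) * ((1 + s) * (k * (1 + s) `^ (- ka))))).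
    have -> : ka * al / k * (1 + s) `^ (2 * eps) * ((1 + s) * (k * (1 + s) `^ (- ka))) =
      ka * al * ((1 + s) `^ (2 * eps) * ((1 + s) * (1 + s) `^ (- ka))).
      by field; rewrite lt0r_neq0// (adj_k0 adj).
    by rewrite e (@powR_eqD R _ _ _ 0) ?subrr// powRr0 mulr1.
  apply: ler_wpM2l.
    apply: mulr_ge0 (powR_ge0 _ _); apply: divr_ge0 (ltW (adj_k0 adj)).
    by apply: ltW; apply: mulr_gt0 ka_gt0 al0.
  by rewrite ler_pM2l//; exact: adj_u_ge adj _ s0.
apply: le_trans (ler_wpM2r (powR_ge0 _ _) h) _.
have e2 : 2 * eps + - eps = eps by ring.
by rewrite -(mulrA _ ((1 + s) `^ (2 * eps))) (powR_eqD s1 e2).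
Qed.

Section OnePath.
Context (Z Y B : R -> R) (L : R) (P : driven_path Z Y B L).

(** Constant in the absence of noise. *)
Definition dual_pairing (t : R) := v t * Z t + u t * Y t.

Lemma adj_cv : {within `[0, +oo[, continuous v}.
Proof. exact: der_within_cy (adj_der_v adj). Qed.

Lemma adj_cu : {within `[0, +oo[, continuous u}.
Proof. exact: der_within_cy (adj_der_u adj). Qed.

Lemma dual_pairing_cont : {within `[0, +oo[, continuous dual_pairing}.
Proof.
apply: within_add; apply: within_mul; [exact: adj_cv|exact: path_cZ P|exact: adj_cu|exact: path_cY P].
Qed.

Lemma dual_pairing_der (t : R) : 0 < t -> is_derive t (1 : R) dual_pairing (sg * dv t * B t).
Proof.
move=> t0; have t0' := ltW t0.
apply: (is_derive_eq (derD (derM (adj_der_v adj t0') (path_dZ P t0))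
                           (derM (adj_der_u adj t0') (path_dY P t0)))).
have := adj_dvE adj t0'; move: (u t) (v t) (dv t) (Z t) (Y t) (B t) => u' v' d z y b' ->.
by ring.
Qed.

Lemma dv_powR_le (t p : R) : 0 <= t -> p - (ka + 1) <= - (1 + eps) ->
  dv t * (1 + t) `^ p <= K * (1 + t) `^ (- (1 + eps)).
Proof.
move=> t0 le; apply: (@le_trans _ _ (K * (1 + t) `^ (- (ka + 1)) * (1 + t) `^ p)).
  by rewrite ler_wpM2r ?powR_ge0// (adj_dv_le adj).
rewrite -mulrA ler_wpM2l ?(ltW (adj_K0 adj))//.
have e : - (ka + 1) + p = p - (ka + 1) by ring.
by rewrite (powR_eqD _ e) ?ltr_pwDl// ler_powR// lerDl.
Qed.

(** The derivative sg * dv * B is O((1+t)^(-(1+eps))), with [potential] as primitive. *)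
Lemma dual_pairing_incr (s t : R) : 0 <= s -> s <= t ->
  `|dual_pairing t - dual_pairing s| <= sg * K * L / eps * (1 + s) `^ (- eps).
Proof.
move=> s0 st.
apply: (@le_trans _ _ (sg * K * L * potential t - sg * K * L * potential s)); last first.
  rewrite -mulrBr -[leRHS]mulrA; apply: ler_wpM2l.
    by apply: mulr_ge0 (path_L P); apply: mulr_ge0; apply: ltW; [exact: sg0|exact: (adj_K0 adj)].
  by rewrite mulrC potential_incr_le.
apply: (@le_norm_increment R dual_pairing (fun x => sg * K * L * potential x)
  (fun x => sg * dv x * B x) (fun x => sg * K * L * (1 + x) `^ (- (1 + eps))) s t st).
- by apply: within_sub s0 _; exact: dual_pairing_cont.
- apply: within_sub s0 _; apply: (@der_within_cy _ (fun x => sg * K * L * (1 + x) `^ (- (1 + eps)))).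
  by move=> x x0; apply: derZ; exact: potential_der.
- by move=> x /andP[sx _]; apply: dual_pairing_der; apply: le_lt_trans sx.
- move=> x /andP[sx _]; apply: derZ; apply: potential_der; apply: le_trans (ltW sx).
  exact: s0.
- move=> x /andP[sx _]; have x0 : 0 <= x by apply: le_trans (ltW sx).
  rewrite !normrM (gtr0_norm sg0) (ger0_norm (adj_dv_ge0 adj x0)) -!mulrA.
  rewrite ler_wpM2l ?(ltW sg0)//.
  apply: le_trans (ler_wpM2l (adj_dv_ge0 adj x0) (path_B_le P x0)) _.
  rewrite mulrCA [leRHS]mulrCA ler_wpM2l ?(path_L P)//.
  by apply: dv_powR_le => //; rewrite kaE; lra.
Qed.

Definition dual_limit := lim (dual_pairing t @[t --> +oo]).

Lemma dual_pairing_cvg : dual_pairing t @[t --> +oo] --> dual_limit.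
Proof.
apply/cauchy_cvgP; apply: cauchy_exP => d d0.
have c0 : 0 <= sg * K * L / eps.
  apply: divr_ge0 (ltW eps0); apply: mulr_ge0 (path_L P).
  by apply: mulr_ge0; apply: ltW; [exact: sg0|exact: (adj_K0 adj)].
have : sg * K * L / eps * (1 + t) `^ (- eps) @[t --> +oo] --> sg * K * L / eps * 0.
  by apply: cvgMl_tmp; exact: powRN_cvg0.
rewrite mulr0 => /cvgrPdist_lt/(_ _ d0)[M [_ hM]].
pose s := Num.max 0 M + 1.
have s0 : 0 <= s by rewrite /s addr_ge0// le_max lexx.
have Ms : M < s by rewrite /s ltr_pwDr// le_max lexx orbT.
exists (dual_pairing s); exists s; split; first exact: num_real.
move=> t st; rewrite /= /ball/= distrC.
apply: le_lt_trans (dual_pairing_incr s0 (ltW st)) _.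
by have := hM _ Ms; rewrite sub0r normrN ger0_norm// mulr_ge0 ?powR_ge0.
Qed.

Lemma dual_limit_dist (t : R) : 0 <= t ->
  `|dual_limit - dual_pairing t| <= sg * K * L / eps * (1 + t) `^ (- eps).
Proof.
move=> t0; have C : `|dual_pairing s - dual_pairing t| @[s --> +oo] --> `|dual_limit - dual_pairing t|.
  by apply: cvg_norm; apply: cvgB; [exact: dual_pairing_cvg|exact: cvg_cst].
rewrite -(cvg_lim _ C)//; apply: limr_le; first by apply/cvg_ex; eexists; exact: C.
by near=> s; apply: dual_pairing_incr => //; near: s; exact: nbhs_pinfty_ge.
Unshelve. all: by end_near. Qed.

(** Passing from Z to X costs sg v B, which is also O((1+t)^(-eps)). *)
Lemma dual_limit_dist_X (t : R) : 0 <= t ->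
  `|v t * (Z t + sg * B t) + u t * Y t - dual_limit| <= sg * K * (1 + eps^-1) * L * (1 + t) `^ (- eps).
Proof.
move=> t0.
have -> : v t * (Z t + sg * B t) + u t * Y t - dual_limit =
   sg * (v t * B t) + (dual_pairing t - dual_limit) by rewrite /dual_pairing; ring.
have -> : sg * K * (1 + eps^-1) * L * (1 + t) `^ (- eps) =
   sg * (K * L * (1 + t) `^ (- eps)) + sg * K * L / eps * (1 + t) `^ (- eps) by ring.
apply: le_trans (ler_normD _ _) _; apply: lerD; last by rewrite distrC dual_limit_dist.
rewrite normrM (gtr0_norm sg0) ler_wpM2l ?(ltW sg0)// normrM.
rewrite (gtr0_norm (adj_v_gt0 adj t0)).
apply: le_trans (ler_pM (ltW (adj_v_gt0 adj t0)) (normr_ge0 _) (adj_v_le adj t0) (path_B_le P t0)) _.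
rewrite mulrACA ler_wpM2l ?mulr_ge0 ?(ltW (adj_K0 adj)) ?(path_L P)//.
have e : - ka + (1 + eps) = - eps by rewrite kaE; ring.
by rewrite (powR_eqD _ e) ?ltr_pwDl.
Qed.

Definition path_const := 2 * sg * (1 + al^-1) + sg * K * (1 + eps^-1) * ka / k.

(** Freezing B at its final value makes the derivative of S a sum of two small terms:
    Hinv' times an increment of B, and Hinv * gain times the distance of v X + u Y
    to its limit. The function N is an explicit primitive of a bound on both; the part N1
    absorbs the factor 1 + (t - s) of the modulus of B because Hinv' >= al Hinv. *)
Lemma path_dist (t : R) : 0 <= t ->
  `|Z t + sg * B t - dual_limit * (growth t / Hinv t)| <= (1 + t) `^ eps * (`|Z 0| + path_const * L).
Proof.
move=> t0; set w := (1 + t) `^ eps; set c := sg * K * (1 + eps^-1).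
have w1 : 1 <= w by rewrite -(powRr0 (1 + t)) ler_powR ?lerDl// ltW.
have w0 : 0 <= w by rewrite powR_ge0.
have L0 := path_L P.
have c0 : 0 <= c.
  apply: mulr_ge0; first by apply: mulr_ge0; apply: ltW; [exact: sg0|exact: adj_K0 adj].
  by apply: addr_ge0 => //; rewrite invr_ge0 ltW.
pose S s := Z s * Hinv s - dual_limit * growth s + sg * Hinv s * B t.
(* The term al^-1 compensates the derivative -1 of t - s. *)
pose N1 s := Hinv s * (1 + (t - s) + al^-1).
pose N s := sg * L * w * N1 s + c * L * (ka / k) * w * Hinv s.
have dN1 (x : R) : 0 <= x -> is_derive x (1 : R) N1 (dHinv x * (1 + (t - x) + al^-1) - Hinv x).
  move=> x0; apply: (is_derive_eq (derM (Hinv_der x0)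
    (derD (derD (derC x 1) (derB (derC x t) (derId x))) (derC x al^-1)))).
  by ring.
have N1ge (x : R) : 0 <= x -> dHinv x * (1 + (t - x)) <= dHinv x * (1 + (t - x) + al^-1) - Hinv x.
  move=> x0; rewrite [in leRHS]mulrDr -addrA lerDl subr_ge0 ler_pdivlMr// mulrC.
  exact: dHinv_ge.
have cN1 : {within `[0, +oo[, continuous N1} by exact: der_within_cy dN1.
have dH0 (x : R) : 0 <= x -> 0 <= dHinv x.
  by move=> x0; apply: le_trans (dHinv_ge x0); apply: mulr_ge0 (ltW al0) (ltW (Hinv_gt0 x0)).
have N10 : N1 0 <= N1 t.
  apply: (@le_of_der_ge0 R N1 (fun x => dHinv x * (1 + (t - x) + al^-1) - Hinv x) 0 t t0).
  - exact: within_sub (lexx 0) cN1.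
  - by move=> x /andP[x0 _]; apply: dN1; exact: ltW.
  - move=> x /andP[x0 xt]; apply: le_trans (N1ge x (ltW x0)).
    by apply: mulr_ge0; [exact: dH0 (ltW x0)|rewrite addr_ge0// subr_ge0 ltW].
have key : `|S t - S 0| <= N t - N 0.
  apply: (@le_norm_increment R S N
    (fun s => sg * dHinv s * (B t - B s) +
       Hinv s * gain s * (v s * (Z s + sg * B s) + u s * Y s - dual_limit))
    (fun s => sg * L * w * (dHinv s * (1 + (t - s) + al^-1) - Hinv s) +
       c * L * (ka / k) * w * dHinv s) 0 t t0).
  - apply: within_sub (lexx 0) _; apply: within_add.
      apply: within_add; first by apply: within_mul (path_cZ P) Hinv_cont.
      move=> x; apply: cvgN; move: x; apply: within_mul growth_cont; exact: within_cst.
    apply: within_mul; last exact: within_cst.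
    by apply: within_mul Hinv_cont; exact: within_cst.
  - apply: within_sub (lexx 0) _; apply: within_add; apply: within_mul.
    + exact: within_cst.
    + exact: cN1.
    + exact: within_cst.
    + exact: Hinv_cont.
  - move=> x /andP[x0 _]; have x0' := ltW x0.
    apply: (is_derive_eq (derD (derB (derM (path_dZ P x0) (Hinv_der x0')) (derZ dual_limit (growth_der x0)))
      (derM (derZ sg (Hinv_der x0')) (derC x (B t))))).
    rewrite mulr0 addr0; apply: path_alg; last exact: lt0r_neq0 (adj_u_gt0 adj x0').
    by rewrite lt0r_neq0// addr_gt0.
  - move=> x /andP[x0 _]; apply: derD; apply: derZ; [exact: dN1 (ltW x0)|exact: Hinv_der (ltW x0)].
  - move=> x /andP[x0 xt]; have x0' := ltW x0; have xt' := ltW xt.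
    apply: le_trans (ler_normD _ _) _; apply: lerD.
      rewrite normrM ger0_norm; last by apply: mulr_ge0 (ltW sg0) (dH0 x x0').
      apply: (@le_trans _ _ (sg * L * w * (dHinv x * (1 + (t - x))))).
        have -> : sg * L * w * (dHinv x * (1 + (t - x))) =
                  sg * dHinv x * (L * w * (1 + (t - x))) by ring.
        apply: ler_wpM2l; first by apply: mulr_ge0 (ltW sg0) (dH0 x x0').
        exact: (path_B P x0' xt').
      apply: ler_wpM2l (N1ge x x0'); apply: mulr_ge0 w0; exact: mulr_ge0 (ltW sg0) L0.
    rewrite normrM ger0_norm; last by apply: mulr_ge0; apply: ltW; [exact: Hinv_gt0|exact: gain_gt0].
    have h1 := dual_limit_dist_X x0'; rewrite -/c in h1.
    apply: (@le_trans _ _ (Hinv x * gain x * (c * L * (1 + x) `^ (- eps)))).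
      apply: ler_wpM2l h1; apply: mulr_ge0; apply: ltW; [exact: Hinv_gt0|exact: gain_gt0].
    have -> : Hinv x * gain x * (c * L * (1 + x) `^ (- eps)) =
      c * L * Hinv x * (gain x * (1 + x) `^ (- eps)) by ring.
    have cLH : 0 <= c * L * Hinv x.
      by apply: mulr_ge0 (ltW (Hinv_gt0 x0')); exact: mulr_ge0.
    apply: le_trans (ler_wpM2l cLH (gain_le x0')) _.
    have xw : (1 + x) `^ eps <= w.
      apply: ge0_ler_powR; rewrite ?nnegrE ?lerD2l//; [exact: ltW|exact: addr_ge0|exact: addr_ge0].
    apply: (@le_trans _ _ (c * L * (ka / k) * w * (al * Hinv x))).
      have -> : c * L * Hinv x * (ka * al / k * (1 + x) `^ eps) =
         c * L * (ka / k) * (1 + x) `^ eps * (al * Hinv x) by ring.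
      apply: ler_wpM2r; first exact: mulr_ge0 (ltW al0) (ltW (Hinv_gt0 x0')).
      apply: ler_wpM2l xw; apply: mulr_ge0; first exact: mulr_ge0.
      by apply: divr_ge0; apply: ltW; [exact: ka_gt0|exact: adj_k0 adj].
    apply: ler_wpM2l (dHinv_ge x0'); apply: mulr_ge0 w0; apply: mulr_ge0; first exact: mulr_ge0.
    by apply: divr_ge0; apply: ltW; [exact: ka_gt0|exact: adj_k0 adj].
have Ht := Hinv_gt0 t0; have H0 := Hinv_gt0 (lexx 0).
have N0 : 0 <= N 0.
  apply: addr_ge0; apply: mulr_ge0; last 1 first.
  - exact: ltW.
  - by apply: mulr_ge0 w0; exact: mulr_ge0 (ltW sg0) L0.
  - apply: mulr_ge0 (ltW H0) _; apply: addr_ge0; last by rewrite invr_ge0 ltW.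
    by rewrite subr0 addr_ge0.
  - apply: mulr_ge0 w0; apply: mulr_ge0; first exact: mulr_ge0.
    by apply: divr_ge0; apply: ltW; [exact: ka_gt0|exact: adj_k0 adj].
have NtE : N t = Hinv t * (w * (L * (sg * (1 + al^-1) + c * ka / k))).
  by rewrite /N /N1 subrr addr0; ring.
have St : S t - S 0 = Hinv t * (Z t + sg * B t - dual_limit * (growth t / Hinv t)) -
   (Z 0 * Hinv 0 + sg * Hinv 0 * B t).
  rewrite /S growth0; field; exact: lt0r_neq0.
rewrite -(ler_pM2l Ht) -{1}(gtr0_norm Ht) -normrM.
have -> : Hinv t * (Z t + sg * B t - dual_limit * (growth t / Hinv t)) =
  (S t - S 0) + (Z 0 * Hinv 0 + sg * Hinv 0 * B t) by rewrite St subrK.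
apply: le_trans (ler_normD _ _) _.
have b1 : `|S t - S 0| <= Hinv t * (w * (L * (sg * (1 + al^-1) + c * ka / k))).
  by apply: le_trans key _; rewrite NtE gerBl.
have b2 : `|Z 0 * Hinv 0| <= Hinv t * (w * `|Z 0|).
  rewrite normrM (gtr0_norm H0) mulrC; apply: ler_pM => //; first exact: ltW.
    exact: Hinv_le.
  by rewrite ler_peMl.
have b3 : `|sg * Hinv 0 * B t| <= Hinv t * (w * (L * (sg * (1 + al^-1)))).
  have -> : Hinv t * (w * (L * (sg * (1 + al^-1)))) = sg * L * w * N1 t.
    by rewrite /N1 subrr addr0; ring.
  apply: le_trans (ler_wpM2l _ N10); last by apply: mulr_ge0 w0; exact: mulr_ge0 (ltW sg0) L0.
  rewrite normrM gtr0_norm; last by apply: mulr_gt0 sg0 H0.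
  have := path_B P (lexx 0) t0; rewrite (path_B0 P) !subr0 => hB.
  apply: (@le_trans _ _ (sg * Hinv 0 * (L * w * (1 + t)))).
    by apply: ler_wpM2l hB; apply: mulr_ge0; apply: ltW.
  have -> : sg * Hinv 0 * (L * w * (1 + t)) = sg * L * w * (Hinv 0 * (1 + t)) by ring.
  apply: ler_wpM2l; first by apply: mulr_ge0 w0; exact: mulr_ge0 (ltW sg0) L0.
  by rewrite /N1 subr0 ler_pM2l// lerDl invr_ge0 ltW.
apply: le_trans (lerD b1 (le_trans (ler_normD _ _) (lerD b2 b3))) _.
by rewrite le_eqVlt; apply/orP; left; apply/eqP; rewrite /path_const -/c; ring.
Qed.

Lemma dual_limit_le : `|dual_limit| <= (`|v 0 * Z 0 + u 0 * Y 0| + sg * K / eps) * (1 + L).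
Proof.
have L0 := path_L P.
have c0 : 0 <= sg * K / eps.
  by apply: divr_ge0 (ltW eps0); apply: mulr_ge0; apply: ltW; [exact: sg0|exact: adj_K0 adj].
have := dual_limit_dist (lexx 0); rewrite addr0 powR1 mulr1 {1}/dual_pairing => h.
have -> : dual_limit = (dual_limit - (v 0 * Z 0 + u 0 * Y 0)) + (v 0 * Z 0 + u 0 * Y 0) by rewrite subrK.
apply: le_trans (ler_normD _ _) _.
apply: le_trans (lerD h (lexx _)) _.
have -> : sg * K * L / eps = sg * K / eps * L by ring.
move: (sg * K / eps) `|v 0 * Z 0 + u 0 * Y 0| c0 (normr_ge0 (v 0 * Z 0 + u 0 * Y 0)).
by move=> c n c0 n0; rewrite mulrDl !mulrDr !mulr1; have := mulr_ge0 n0 L0; lra.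
Qed.

(** Divide [path_dist] by t^(2 eps); the rest is the distance of growth / Hinv to
    rho t^(2 eps). *)
Lemma path_limit (t : R) : 0 < t ->
  `|(Z t + sg * B t) / t `^ (2 * eps) - rho * dual_limit| <= (1 + L) *
    ((`|v 0 * Z 0 + u 0 * Y 0| + sg * K / eps) *
       `|growth t / Hinv t / t `^ (2 * eps) - rho| +
     (`|Z 0| + path_const) * ((1 + t) `^ eps / t `^ (2 * eps))).
Proof.
move=> t0; have L0 := path_L P; have p0 : 0 < t `^ (2 * eps) by exact: powR_gt0.
have D := path_dist (ltW t0).
have path_const0 : 0 <= path_const.
  have Ki : 0 <= sg * K by apply: mulr_ge0; apply: ltW; [exact: sg0|exact: adj_K0 adj].
  apply: addr_ge0; apply: mulr_ge0.
  - by apply: mulr_ge0 => //; exact: ltW.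
  - by apply: addr_ge0 => //; rewrite invr_ge0 ltW.
  - apply: mulr_ge0 (ltW ka_gt0); apply: mulr_ge0 Ki _.
    by apply: addr_ge0 => //; rewrite invr_ge0 ltW.
  - by rewrite invr_ge0; apply: ltW; exact: adj_k0 adj.
set A := growth t / Hinv t; rewrite -/A in D.
have -> : (Z t + sg * B t) / t `^ (2 * eps) - rho * dual_limit =
  (Z t + sg * B t - dual_limit * A) / t `^ (2 * eps) + dual_limit * (A / t `^ (2 * eps) - rho).
  by rewrite mulrBl mulrBr; ring.
apply: le_trans (ler_normD _ _) _; rewrite [leLHS]addrC [leRHS]mulrDr; apply: lerD.
  by rewrite normrM mulrA ler_wpM2r// [leRHS]mulrC; exact: dual_limit_le.
rewrite normrM [X in _ * X]gtr0_norm ?invr_gt0//.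
have -> : (1 + L) * ((`|Z 0| + path_const) * ((1 + t) `^ eps / t `^ (2 * eps))) =
  (1 + t) `^ eps * ((`|Z 0| + path_const) * (1 + L)) / t `^ (2 * eps) by ring.
rewrite ler_pM2r ?invr_gt0//; apply: le_trans D _; apply: ler_wpM2l; first exact: powR_ge0.
have := mulr_ge0 (normr_ge0 (Z 0)) L0.
by move: (path_const) path_const0 => c c0 zL; rewrite mulrDl !mulrDr !mulr1; lra.
Qed.

(** On each cell, v(tau_(i+1)) (B(tau_(i+1)) - B(tau_i)) differs from the increment of
    dual_pairing / sg + v B by the integral of dv (B - B(tau_i)), which is summable. *)
Lemma step_sum_dist (tau : nat -> R) (q : R) (n : nat) : tau 0%N = 0 ->
  (forall i, tau i <= tau i.+1) -> 0 <= q ->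
  (forall i (s : R), tau i <= s -> s <= tau i.+1 -> `|B s - B (tau i)| <= L * q * (1 + s) `^ eps) ->
  `|\sum_(i < n) v (tau i.+1) * (B (tau i.+1) - B (tau i)) -
    (dual_limit - (v 0 * Z 0 + u 0 * Y 0)) / sg| <=
    L * (K * (1 + eps^-1) * (q + (1 + tau n) `^ (- eps))).
Proof.
move=> tau0 tauS q0 hB; have L0 := path_L P; have K0 := ltW (adj_K0 adj).
have tge0 i : 0 <= tau i.
  by elim: i => [|i ih]; [rewrite tau0|apply: le_trans ih (tauS i)].
have cell i : `|v (tau i.+1) * (B (tau i.+1) - B (tau i)) -
    ((dual_pairing (tau i.+1) / sg + v (tau i.+1) * B (tau i.+1)) -
     (dual_pairing (tau i) / sg + v (tau i) * B (tau i)))| <=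
    K * L * q * potential (tau i.+1) - K * L * q * potential (tau i).
  have -> : v (tau i.+1) * (B (tau i.+1) - B (tau i)) -
    ((dual_pairing (tau i.+1) / sg + v (tau i.+1) * B (tau i.+1)) -
     (dual_pairing (tau i) / sg + v (tau i) * B (tau i))) =
    - ((dual_pairing (tau i.+1) / sg + v (tau i.+1) * B (tau i)) -
      (dual_pairing (tau i) / sg + v (tau i) * B (tau i))) by ring.
  rewrite normrN.
  apply: (@le_norm_increment R (fun s => dual_pairing s / sg + v s * B (tau i))
    (fun s => K * L * q * potential s) (fun s => dv s * (B s - B (tau i)))
    (fun s => K * L * q * (1 + s) `^ (- (1 + eps))) _ _ (tauS i)).
  - apply: within_sub (tge0 i) _; apply: within_add; apply: within_mul.
    + exact: dual_pairing_cont.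
    + exact: within_cst.
    + exact: adj_cv.
    + exact: within_cst.
  - apply: within_sub (tge0 i) _.
    apply: (@der_within_cy _ (fun s => K * L * q * (1 + s) `^ (- (1 + eps)))).
    by move=> x x0; apply: derZ; exact: potential_der.
  - move=> x /andP[tx _]; have x0 : 0 < x by apply: le_lt_trans tx.
    apply: (is_derive_eq (derD (derM (dual_pairing_der x0) (derC x sg^-1))
       (derM (adj_der_v adj (ltW x0)) (derC x (B (tau i)))))).
    by field; rewrite gt_eqF.
  - by move=> x /andP[tx _]; apply: derZ; apply: potential_der; apply: le_trans (ltW tx).
  - move=> x /andP[tx xt]; have x0 : 0 <= x by apply: le_trans (ltW tx).
    rewrite normrM (ger0_norm (adj_dv_ge0 adj x0)).
    apply: le_trans (ler_wpM2l (adj_dv_ge0 adj x0) (hB i x (ltW tx) (ltW xt))) _.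
    rewrite mulrCA; have -> : K * L * q * (1 + x) `^ (- (1 + eps)) =
      L * q * (K * (1 + x) `^ (- (1 + eps))) by ring.
    apply: ler_wpM2l; first exact: mulr_ge0.
    by apply: dv_powR_le => //; rewrite kaE; lra.
have sums : `|\sum_(i < n) v (tau i.+1) * (B (tau i.+1) - B (tau i)) -
    ((dual_pairing (tau n) / sg + v (tau n) * B (tau n)) - (dual_pairing 0 / sg + v 0 * B 0))| <=
    K * L * q * potential (tau n) - K * L * q * potential 0.
  elim: n => [|n ih]; first by rewrite big_ord0 tau0 !subrr normr0.
  rewrite big_ord_recr/=.
  have reorder (S c d e f : R) : S + c - (f - d) = (S - (e - d)) + (c - (f - e)) by ring.
  rewrite (reorder _ _ _ (dual_pairing (tau n) / sg + v (tau n) * B (tau n))).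
  apply: le_trans (ler_normD _ _) _; apply: le_trans (lerD ih (cell n)) _.
  by rewrite addrC subrKA.
have tail := dual_limit_dist_X (tge0 n).
rewrite (path_B0 P) mulr0 addr0 in sums.
set S := \sum_(i < n) _ in sums *.
have -> : S - (dual_limit - (v 0 * Z 0 + u 0 * Y 0)) / sg =
  (S - (dual_pairing (tau n) / sg + v (tau n) * B (tau n) - dual_pairing 0 / sg)) +
  (v (tau n) * (Z (tau n) + sg * B (tau n)) + u (tau n) * Y (tau n) - dual_limit) / sg.
  by rewrite /dual_pairing; field; rewrite gt_eqF.
apply: le_trans (ler_normD _ _) _.
have sgi : 0 < sg^-1 by rewrite invr_gt0.
rewrite [X in _ + X]normrM (gtr0_norm sgi).
have t1 : sg * K * (1 + eps^-1) * L * (1 + tau n) `^ (- eps) / sg =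
    L * (K * (1 + eps^-1) * (1 + tau n) `^ (- eps)) by field; rewrite !gt_eqF.
apply: le_trans (lerD sums (ler_wpM2r _ tail)) _; first by rewrite invr_ge0 ltW.
rewrite t1 !mulrDr lerD2r -mulrBr.
have KLq : 0 <= K * L * q by apply: mulr_ge0 q0; exact: mulr_ge0.
apply: le_trans (ler_wpM2l KLq (potential_incr_le (tau n) (lexx 0))) _.
rewrite addr0 powR1 mulr1 div1r mulrDl !mulrDr.
have -> : K * L * q / eps = L * (K / eps * q) by ring.
by rewrite lerDr; apply: mulr_ge0 => //; exact: mulr_ge0.
Qed.

End OnePath.

Lemma path_rate_cvg0 (c1 c2 : R) :
  c1 * `|growth t / Hinv t / t `^ (2 * eps) - rho| + c2 * ((1 + t) `^ eps / t `^ (2 * eps))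
    @[t --> +oo] --> (0 : R).
Proof.
have L1 : c1 * `|growth t / Hinv t / t `^ (2 * eps) - rho| @[t --> +oo] --> c1 * `|rho - rho|.
  apply: cvgMl_tmp; apply: cvg_norm; apply: cvgB; [exact: growth_cvg|exact: cvg_cst].
suff L2 : c2 * ((1 + t) `^ eps / t `^ (2 * eps)) @[t --> +oo] --> c2 * 0.
  by have := cvgD L1 L2; rewrite subrr normr0 !mulr0 addr0; exact.
apply: cvgMl_tmp.
have L : ((1 + t) / t) `^ (2 * eps) * (1 + t) `^ (- eps) @[t --> +oo] --> 1 * (0 : R).
  by apply: cvgM; [exact: onepluspowR_ratio_cvg|exact: powRN_cvg0].
rewrite mulr0 in L; apply: cvg_trans L; apply: near_eq_cvg; near=> t.
have t0 : 0 < t by near: t; exact: nbhs_pinfty_gt.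
have t1 : 0 < 1 + t by rewrite addr_gt0.
have -> : ((1 + t) / t) `^ (2 * eps) = (1 + t) `^ (2 * eps) / t `^ (2 * eps).
  by rewrite powRM ?invr_ge0 ?ltW// -powR_inv1 ?ltW// -powRrM mulN1r powRN.
have e : 2 * eps + - eps = eps by ring.
by rewrite mulrAC (powR_eqD t1 e).
Unshelve. all: by end_near. Qed.

End PathAnalysis.

(** * Chaining over dyadic points *)

Section Chaining.
Context {R : realType} (eps L : R) (f : R -> R).
Context (eps0 : 0 < eps) (L0 : 0 <= L) (cf : {within `[0, +oo[, continuous f}).

Definition dyadic (k i : nat) : R := i%:R / 2 ^+ k.

(** The ratio 3/4 lies between 2^(-1/2), the size of Brownian increments on a grid of mesh
    2^(-k), and 1, which makes the chaining series converge. *)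
Definition dyadic_bound := forall k i : nat,
  `|f (dyadic k i.+1) - f (dyadic k i)| <= L * (1 + dyadic k i) `^ eps * (3 / 4) ^+ k.

Context (hf : dyadic_bound).

Lemma dyadic_ge0 k i : 0 <= dyadic k i.
Proof. by rewrite divr_ge0// exprn_ge0. Qed.

Lemma dyadicS k i : dyadic k i.+1 = dyadic k i + (2 ^+ k)^-1.
Proof. by rewrite /dyadic -natr1 mulrDl mul1r. Qed.

Lemma dyadic_double k i : dyadic k.+1 i.*2 = dyadic k i.
Proof.
rewrite /dyadic -muln2 natrM exprS invfM; field.
by rewrite expf_neq0.
Qed.

Lemma dyadic_powR_le (s x : R) : 0 <= x -> x <= s -> (1 + x) `^ eps <= (1 + s) `^ eps.
Proof.
move=> x0 xs; have s0 := le_trans x0 xs.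
by apply: ge0_ler_powR; rewrite ?nnegrE ?lerD2l ?addr_ge0// ltW.
Qed.

Lemma dyadic_refine k i (s : R) : dyadic k i <= s < dyadic k i.+1 ->
  exists2 j, dyadic k.+1 j <= s < dyadic k.+1 j.+1 &
    `|f (dyadic k.+1 j) - f (dyadic k i)| <= L * (1 + s) `^ eps * (3 / 4) ^+ k.+1.
Proof.
move=> /andP[is_ si].
have e2 : dyadic k.+1 i.*2.+2 = dyadic k i.+1 by rewrite -doubleS dyadic_double.
have b0 : 0 <= L * (1 + s) `^ eps * (3 / 4) ^+ k.+1.
  by rewrite !mulr_ge0 ?powR_ge0 ?exprn_ge0// divr_ge0.
have [h|h] := ltP s (dyadic k.+1 i.*2.+1).
  exists i.*2; first by rewrite h dyadic_double is_.
  by rewrite dyadic_double subrr normr0.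
exists i.*2.+1; first by rewrite h e2 si.
have := hf k.+1 i.*2; rewrite dyadic_double => /le_trans; apply.
rewrite ler_wpM2r ?exprn_ge0 ?divr_ge0// ler_wpM2l//.
by apply: dyadic_powR_le => //; exact: dyadic_ge0.
Qed.

Lemma dyadic_chain k i (s : R) n : dyadic k i <= s < dyadic k i.+1 ->
  exists2 j, dyadic (k + n) j <= s < dyadic (k + n) j.+1 &
    `|f (dyadic (k + n) j) - f (dyadic k i)| <=
      L * (1 + s) `^ eps * (3 * ((3 / 4) ^+ k - (3 / 4) ^+ (k + n))).
Proof.
move=> si; elim: n => [|n [j hj ih]].
  by rewrite addn0; exists i => //; rewrite !subrr normr0 !mulr0.
have [j' hj' h] := dyadic_refine hj; rewrite addnS; exists j' => //.
have -> : f (dyadic (k + n).+1 j') - f (dyadic k i) =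
  (f (dyadic (k + n).+1 j') - f (dyadic (k + n) j)) + (f (dyadic (k + n) j) - f (dyadic k i)).
  by rewrite addrA subrK.
apply: le_trans (ler_normD _ _) _; apply: le_trans (lerD h ih) _.
by rewrite le_eqVlt; apply/orP; left; apply/eqP; rewrite exprS; field.
Qed.

(** Along the dyadic cells that contain s, the values of f at the left end points move by a
    geometric series of sum 3 (3/4)^k, and they converge to f s by continuity. *)
Lemma dyadic_cell k i (s : R) : dyadic k i <= s -> s <= dyadic k i.+1 ->
  `|f s - f (dyadic k i)| <= 4 * L * (3 / 4) ^+ k * (1 + s) `^ eps.
Proof.
move=> is_ si; have s0 : 0 <= s by apply: le_trans is_; exact: dyadic_ge0.
have b0 : 0 <= L * (1 + s) `^ eps * (3 / 4) ^+ k.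
  by rewrite !mulr_ge0 ?powR_ge0 ?exprn_ge0// divr_ge0.
have -> : 4 * L * (3 / 4) ^+ k * (1 + s) `^ eps = 4 * (L * (1 + s) `^ eps * (3 / 4) ^+ k) by ring.
move: si; rewrite le_eqVlt => /predU1P[->|si].
  apply: le_trans (hf k i) _.
  apply: (@le_trans _ _ (L * (1 + dyadic k i.+1) `^ eps * (3 / 4) ^+ k)).
    rewrite ler_wpM2r ?exprn_ge0 ?divr_ge0// ler_wpM2l//.
    apply: dyadic_powR_le; first exact: dyadic_ge0.
    by rewrite dyadicS lerDl invr_ge0 exprn_ge0.
  by rewrite ler_peMl// ?mulr_ge0 ?powR_ge0 ?exprn_ge0 ?divr_ge0// ler1n.
apply/ler_addgt0Pr => d d0.
have /subspace_continuousP/(_ s) := cf; rewrite /= in_itv/= s0 => /(_ isT)/cvgrPdist_lt/(_ _ d0).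
rewrite /within/= => -[r r0 hr].
have [n hn] : exists n : nat, (2 ^+ (k + n))^-1 < r.
  have : (2^-1 : R) ^+ n @[n --> \oo] --> (0 : R).
    by apply: cvg_expr; rewrite ger0_norm ?invr_ge0// invf_lt1// ltr1n.
  move/cvgrPdist_lt => /(_ _ r0)[N _ hN]; exists N.
  have := hN (k + N)%N (leq_addl _ _); by rewrite /= sub0r normrN exprVn ger0_norm// invr_ge0 exprn_ge0.
have [j /andP[j1 j2] hj] := @dyadic_chain k i s n (introT andP (conj is_ si)).
have close : `|f s - f (dyadic (k + n) j)| < d.
  apply: hr; last by rewrite /= in_itv/= dyadic_ge0.
  rewrite /ball/= ger0_norm ?subr_ge0//; apply: le_lt_trans hn.
  by rewrite lerBlDl; move: j2; rewrite dyadicS => /ltW.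
have -> : f s - f (dyadic k i) =
  (f s - f (dyadic (k + n) j)) + (f (dyadic (k + n) j) - f (dyadic k i)).
  by rewrite addrA subrK.
apply: le_trans (ler_normD _ _) _; rewrite addrC; apply: lerD (ltW close).
apply: le_trans hj _.
have -> : 4 * (L * (1 + s) `^ eps * (3 / 4) ^+ k) = L * (1 + s) `^ eps * (4 * (3 / 4) ^+ k) by ring.
rewrite ler_wpM2l ?mulr_ge0 ?powR_ge0//.
have a0 : 0 <= (3 / 4 : R) ^+ (k + n) by rewrite exprn_ge0// divr_ge0.
have a1 : 0 <= (3 / 4 : R) ^+ k by rewrite exprn_ge0// divr_ge0.
by lra.
Qed.

Lemma dyadic_unit (m n : nat) (t : R) : (m <= n)%N -> n%:R <= t ->
  `|f n%:R - f m%:R| <= (n - m)%:R * (L * (1 + t) `^ eps).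
Proof.
move=> mn; rewrite -(subnKC mn) addKn; elim: (n - m)%N => [|j ih] nt.
  by rewrite addn0 subrr normr0 mul0r.
have jt : (m + j)%:R <= t by apply: le_trans nt; rewrite ler_nat addnS.
have -> : f (m + j.+1)%:R - f m%:R =
  (f (m + j.+1)%:R - f (m + j)%:R) + (f (m + j)%:R - f m%:R) by rewrite addrA subrK.
apply: le_trans (ler_normD _ _) _; rewrite -natr1 mulrDl mul1r addrC; apply: lerD (ih jt) _.
have := hf 0 (m + j); rewrite /dyadic expr0 !divr1 mulr1 addnS => /le_trans; apply.
by rewrite ler_wpM2l// dyadic_powR_le.
Qed.

(** Compare s and t with their integer parts: each comparison costs 4, and the unit steps
    between the integer parts cost at most 1 + (t - s). *)
Lemma dyadic_modulus (s t : R) : 0 <= s -> s <= t ->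
  `|f t - f s| <= 9 * L * (1 + t) `^ eps * (1 + (t - s)).
Proof.
move=> s0 st; have t0 := le_trans s0 st.
have /andP[m1 m2] := truncn_itv s0; have /andP[n1 n2] := truncn_itv t0.
set m := Num.truncn s in m1 m2; set n := Num.truncn t in n1 n2.
have mn : (m <= n)%N by rewrite -ltnS -(ltr_nat R); apply: le_lt_trans n2; apply: le_trans st.
have hs : `|f s - f m%:R| <= 4 * (L * (1 + t) `^ eps).
  have := @dyadic_cell 0 m s; rewrite /dyadic !expr0 !divr1 mulr1 => /(_ m1 (ltW m2)).
  by move=> /le_trans; apply; rewrite -mulrA !ler_wpM2l// dyadic_powR_le.
have ht : `|f t - f n%:R| <= 4 * (L * (1 + t) `^ eps).
  have := @dyadic_cell 0 n t; rewrite /dyadic !expr0 !divr1 mulr1 => /(_ n1 (ltW n2)).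
  by rewrite -mulrA.
have hu := dyadic_unit mn n1.
have -> : f t - f s = (f t - f n%:R) + (f n%:R - f m%:R) - (f s - f m%:R) by ring.
apply: le_trans (ler_normB _ _) _; apply: le_trans (lerD (ler_normD _ _) hs) _.
apply: le_trans (lerD (lerD ht hu) (lexx _)) _.
have w0 : 0 <= L * (1 + t) `^ eps by rewrite mulr_ge0 ?powR_ge0.
have nm : (n - m)%:R <= t - s + 1 by rewrite natrB//; move: m2; rewrite -natr1; lra.
have nmw := ler_wpM2r w0 nm.
move: nmw; set w := L * _; rewrite -/w in w0 *.
have -> : 9 * L * (1 + t) `^ eps * (1 + (t - s)) = 9 * w + 9 * (w * (t - s)) by rewrite /w; ring.
have := mulr_ge0 w0 (_ : 0 <= t - s); rewrite subr_ge0 => /(_ st).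
move=> p1 p2; move: (n - m)%:R (w) w0 p1 p2 => N w' w0 p1.
have -> : (t - s + 1) * w' = w' * (t - s) + w' by ring.
by lra.
Qed.

End Chaining.

(** * Moments of centred normal variables *)

Section NormalMoments.
Context {R : realType}.
Implicit Types (m s x : R).
Notation mu := (@lebesgue_measure R).

Lemma ge0_integral_normal_prob m s (f : R -> \bar R) : s != 0 ->
  measurable_fun setT f -> (forall x, (0 <= f x)%E) ->
  (\int[normal_prob m s]_x f x = \int[mu]_x (f x * (normal_pdf m s x)%:E))%E.
Proof.
move=> s0 mf f0; have dom := normal_prob_dominates m s.
rewrite -(Radon_Nikodym_SigmaFinite.change_of_variables dom f0 measurableT mf).
apply: ae_eq_integral => //.
- apply: emeasurable_funM => //; apply: (measurable_int mu).
  exact: Radon_Nikodym_SigmaFinite.f_integrable.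
- by apply: emeasurable_funM => //; apply/measurable_EFinP; exact: measurable_normal_pdf.
- apply: ae_eqe_mul2l; apply: integral_ae_eq => //.
  + exact: Radon_Nikodym_SigmaFinite.f_integrable.
  + by apply/measurable_EFinP; exact: measurable_normal_pdf.
  + by move=> A _ mA; rewrite -Radon_Nikodym_SigmaFinite.f_integral.
Qed.

Lemma normal_pdf0E s x : s != 0 ->
  normal_pdf 0 s x = normal_peak s * expR (- (x ^+ 2 / (s ^+ 2 *+ 2))).
Proof. by move=> s0; rewrite normal_pdfE// /normal_fun subr0 mulNr. Qed.

Lemma normal_pdf_der s x : s != 0 ->
  is_derive x (1 : R) (normal_pdf 0 s) (- (x / s ^+ 2) * normal_pdf 0 s x).
Proof.
move=> s0; have -> : normal_pdf 0 s = fun x => normal_peak s * expR (- (x * x / (s ^+ 2 *+ 2))).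
  by apply/funext => y; rewrite normal_pdf0E// expr2.
apply: (is_derive_eq (derZ _ (der_expR (derN (derM (derM (derId x) (derId x))
  (derC x (s ^+ 2 *+ 2)^-1)))))).
by move: (expR _) => E; field.
Qed.

Lemma normal_peak_scale s : 0 < s -> normal_peak s = Num.sqrt 2 * normal_peak (Num.sqrt 2 * s).
Proof.
move=> s0; have -> : normal_peak (Num.sqrt 2 * s) = (Num.sqrt (2 * (s ^+ 2 * pi *+ 2)))^-1.
  by rewrite /normal_peak exprMn sqr_sqrtr//; congr (Num.sqrt _)^-1; ring.
rewrite sqrtrM// invfM mulrA divff ?mul1r// gt_eqF// sqrtr_gt0.
Qed.

Definition moment_cst (p : nat) : R := (4 * p%:R) ^+ p * Num.sqrt 2.

(** From y^p <= p^p e^y with y = x^2 / (4 s^2): half of the Gaussian decay pays for the power,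
    and the other half is the density of variance 2 s^2. *)
Lemma normal_pdf_moment_le (p : nat) s x : (0 < p)%N -> 0 < s ->
  x ^+ (2 * p) * normal_pdf 0 s x <=
  moment_cst p * s ^+ (2 * p) * normal_pdf 0 (Num.sqrt 2 * s) x.
Proof.
move=> p0 s0; have sn := lt0r_neq0 s0.
have q0 : 0 < Num.sqrt 2 * s by rewrite mulr_gt0// sqrtr_gt0.
rewrite !normal_pdf0E ?(lt0r_neq0 q0)// (normal_peak_scale s0).
set y := x ^+ 2 / (4 * s ^+ 2).
have y0 : 0 <= y by rewrite divr_ge0 ?sqr_ge0// mulr_ge0// sqr_ge0.
have p0' : (0 : R) < p%:R by rewrite ltr0n.
have := powR_le_expR p0' (ltr01 : (0 : R) < 1) y0.
rewrite divr1 mul1r !powR_mulrn// => h.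
have e1 : x ^+ (2 * p) = y ^+ p * (4 ^+ p * s ^+ (2 * p)).
  by rewrite exprM (exprM s) -!exprMn /y; congr (_ ^+ p); field.
have e2 : expR (- (x ^+ 2 / (s ^+ 2 *+ 2))) = expR (- y) * expR (- y).
  by rewrite -expRD /y; congr expR; field.
have e3 : expR (- (x ^+ 2 / ((Num.sqrt 2 * s) ^+ 2 *+ 2))) = expR (- y).
  by rewrite exprMn sqr_sqrtr// /y; congr expR; field.
rewrite e1 e2 e3 /moment_cst (exprMn p 4 p%:R).
set q := Num.sqrt 2; set k := normal_peak _.
have k0 : 0 <= q * k * (4 ^+ p * s ^+ (2 * p)) * expR (- y).
  by rewrite !mulr_ge0 ?sqrtr_ge0 ?normal_peak_ge0 ?expR_ge0 ?exprn_ge0// ltW.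
have -> : y ^+ p * (4 ^+ p * s ^+ (2 * p)) * (q * k * (expR (- y) * expR (- y))) =
  (q * k * (4 ^+ p * s ^+ (2 * p)) * expR (- y)) * (y ^+ p * expR (- y)) by ring.
have -> : 4 ^+ p * p%:R ^+ p * q * s ^+ (2 * p) * (k * expR (- y)) =
  (q * k * (4 ^+ p * s ^+ (2 * p)) * expR (- y)) * p%:R ^+ p by ring.
rewrite ler_wpM2l//; apply: le_trans (ler_wpM2r (expR_ge0 _) h) _.
by rewrite -mulrA -expRD subrr expR0 mulr1.
Qed.

Lemma normal_moment_le (p : nat) s : (0 < p)%N -> 0 < s ->
  (\int[normal_prob 0 s]_x (x ^+ (2 * p))%:E <= (moment_cst p * s ^+ (2 * p))%:E)%E.
Proof.
move=> p0 s0; have q0 : 0 < Num.sqrt 2 * s by rewrite mulr_gt0// sqrtr_gt0.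
have ev (x : R) : 0 <= x ^+ (2 * p) by rewrite exprM exprn_ge0// sqr_ge0.
have mx : measurable_fun [set: R] (fun x : R => (x ^+ (2 * p))%:E).
  by apply/measurable_EFinP; exact: measurable_funX.
have c0 : 0 <= moment_cst p * s ^+ (2 * p).
  by rewrite !mulr_ge0 ?sqrtr_ge0 ?exprn_ge0 ?mulr_ge0// ltW.
rewrite ge0_integral_normal_prob ?gt_eqF//.
apply: (@le_trans _ _ (\int[mu]_x ((moment_cst p * s ^+ (2 * p))%:E *
   (normal_pdf 0 (Num.sqrt 2 * s) x)%:E))%E).
  apply: ge0_le_integral => //.
  - by move=> x _; rewrite -EFinM lee_fin mulr_ge0// normal_pdf_ge0.
  - by apply: emeasurable_funM => //; apply/measurable_EFinP; exact: measurable_normal_pdf.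
  - by apply: emeasurable_funM => //; apply/measurable_EFinP; exact: measurable_normal_pdf.
  - by move=> x _; rewrite -!EFinM lee_fin normal_pdf_moment_le.
rewrite ge0_integralZl//.
- by rewrite integral_normal_pdf mule1.
- by apply/measurable_EFinP; exact: measurable_normal_pdf.
- by move=> x _; rewrite lee_fin normal_pdf_ge0.
Qed.

Lemma FTC_0y (f F : R -> R) (l : R) :
  {within `[0, +oo[, continuous f} -> mu.-integrable `[0, +oo[ (EFin \o f) ->
  (forall x : R, 0 <= x -> is_derive x (1 : R) F (f x)) ->
  F x @[x --> +oo] --> l -> \int[mu]_(x in `[0, +oo[) f x = l - F 0.
Proof.
move=> cf fi dF Fl; apply: (cvg_unique _ (Rintegral_itv_cvg fi)) => //.
have L : (fun n : nat => \int[mu]_(s in `[0, n%:R]) f s) = (fun n : nat => F n%:R - F 0).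
  apply/funext => n; have [->|n0] := eqVneq n 0%N.
    by rewrite set_itv1 Rintegral_set1 subrr.
  have n0' : (0 : R) < n%:R by rewrite ltr0n lt0n.
  rewrite /Rintegral (@continuous_FTC2 _ _ F 0 n%:R)//.
  - exact: within_sub (lexx 0) cf.
  - have /(continuous_within_itvP _ n0')[_ c0 cn] : {within `[0, n%:R], continuous F}.
      by apply: (@der_within _ _ f) => x /andP[x0 _]; exact: dF.
    by split => // x; rewrite in_itv/= => /andP[x0 _]; have [] := dF x (ltW x0).
  - by move=> x; rewrite in_itv/= => /andP[x0 _]; exact: der_derive1 (dF x (ltW x0)).
rewrite L; apply: cvgB; last exact: cvg_cst.
exact: (cvg_comp (fun n : nat => n%:R) F (@cvgr_idn R) Fl).
Qed.

Lemma integrable_normal_moment (p : nat) s : (0 < p)%N -> 0 < s ->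
  mu.-integrable setT (fun x => (x ^+ (2 * p) * normal_pdf 0 s x)%:E).
Proof.
move=> p0 s0; have mp : measurable_fun setT (fun x : R => x ^+ (2 * p) * normal_pdf 0 s x).
  by apply: measurable_funM; [exact: measurable_funX|exact: measurable_normal_pdf].
have ev (x : R) : 0 <= x ^+ (2 * p) by rewrite exprM exprn_ge0// sqr_ge0.
apply/integrableP; split; first exact/measurable_EFinP.
under eq_integral do rewrite /= ger0_norm ?mulr_ge0 ?normal_pdf_ge0// EFinM.
rewrite -ge0_integral_normal_prob ?gt_eqF//.
- by apply: le_lt_trans (normal_moment_le p0 s0) _; rewrite ltry.
- by apply/measurable_EFinP; exact: measurable_funX.
Qed.

Lemma expRN_sqr_le (c x : R) : 0 < c -> 1 <= x -> expR (- (c * x ^+ 2)) <= expR (- (c * x)).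
Proof. by move=> c0 x1; rewrite ler_expR lerN2 ler_pM2l// ler_peMr// ?expr2; lra. Qed.

Lemma normal_pdf_cvg0 s : 0 < s -> x * normal_pdf 0 s x @[x --> +oo] --> (0 : R).
Proof.
move=> s0; have sn := lt0r_neq0 s0.
pose c := (s ^+ 2 *+ 2)^-1; have c0 : 0 < c by rewrite invr_gt0 pmulrn_lgt0// exprn_gt0.
have c20 : 0 < c / 2 by rewrite divr_gt0.
apply: (@squeeze_cvgr _ _ _ _ (fun=> 0)
  (fun x => normal_peak s * (2 / c) * expR (- (c / 2 * x)))).
- near=> x; have x1 : 1 <= x by near: x; exact: nbhs_pinfty_ge.
  have x0 : 0 <= x by apply: le_trans x1.
  rewrite mulr_ge0 ?normal_pdf_ge0//= normal_pdf0E// mulrCA -mulrA ler_wpM2l ?normal_peak_ge0//.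
  have h : x <= 2 / c * expR (c / 2 * x).
    rewrite -ler_pdivrMl ?divr_gt0// invf_div; apply: le_trans (expR_ge1Dx _).
    by rewrite lerDr.
  rewrite (mulrC (x ^+ 2)) -/c.
  apply: le_trans (ler_pM x0 (expR_ge0 _) h (expRN_sqr_le c0 x1)) _.
  by rewrite -(mulrA (2 / c)) -expRD le_eqVlt; apply/orP; left; apply/eqP; congr (_ * expR _); field.
- exact: cvg_cst.
- by rewrite -(mulr0 (normal_peak s * (2 / c))); apply: cvgMl_tmp; exact: cvg_expRN.
Unshelve. all: by end_near. Qed.

(** The derivative of - s^2 x pdf is x^2 pdf - s^2 pdf, so that x^2 pdf and s^2 pdf have
    the same integral. *)
Lemma normal_second_moment s : 0 < s ->
  (\int[normal_prob 0 s]_x (x ^+ 2)%:E = (s ^+ 2)%:E)%E.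
Proof.
move=> s0; have sn := lt0r_neq0 s0.
have cpdf : continuous (normal_pdf 0 s) by exact: continuous_normal_pdf.
have cx2 : continuous (fun x : R => x ^+ 2 * normal_pdf 0 s x).
  by move=> x; apply: cvgM; [exact: exprn_continuous|exact: cpdf].
have half : [set x : R | 0 <= x] = `[0, +oo[%classic by rewrite set_itvcy.
have i1 : mu.-integrable setT (EFin \o normal_pdf 0 s) by exact: integrable_normal_pdf.
have i2 : mu.-integrable setT (EFin \o (fun x => x ^+ 2 * normal_pdf 0 s x)).
  exact: (@integrable_normal_moment 1).
have i1' : mu.-integrable `[0, +oo[ (EFin \o normal_pdf 0 s) by exact: integrableS i1.
have i2' : mu.-integrable `[0, +oo[ (EFin \o (fun x => x ^+ 2 * normal_pdf 0 s x)).
  exact: integrableS i2.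
have i3' : mu.-integrable `[0, +oo[ (EFin \o (fun x => s ^+ 2 * normal_pdf 0 s x)).
  exact: (integrableZl _ (s ^+ 2) i1').
have E0 : \int[mu]_(x in `[0, +oo[) (x ^+ 2 * normal_pdf 0 s x - s ^+ 2 * normal_pdf 0 s x) = 0.
  transitivity (0 - - (s ^+ 2 * (0 * normal_pdf 0 s 0))); last first.
    by rewrite mul0r mulr0 oppr0 subr0.
  apply: (@FTC_0y _ (fun x => - (s ^+ 2 * (x * normal_pdf 0 s x))) 0).
  - apply: continuous_subspaceT => x; apply: cvgB; first exact: cx2.
    by apply: cvgM; [exact: cvg_cst|exact: cpdf].
  - exact: (integrableB _ i2' i3').
  - move=> x _; apply: (is_derive_eq (derN (derZ (s ^+ 2) (derM (derId x) (normal_pdf_der x sn))))).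
    by move: (normal_pdf 0 s x) => E; field.
  - have L : s ^+ 2 * (x * normal_pdf 0 s x) @[x --> +oo] --> s ^+ 2 * 0.
      by apply: cvgMl_tmp; exact: normal_pdf_cvg0.
    by rewrite mulr0 in L; have := cvgN L; rewrite oppr0; exact.
rewrite RintegralB// RintegralZl// in E0; move/eqP: E0; rewrite subr_eq0 => /eqP E0.
have even x : normal_pdf 0 s x = normal_pdf 0 s (- x).
  by rewrite !normal_pdf0E// sqrrN.
rewrite ge0_integral_normal_prob//; last by move=> x; rewrite lee_fin sqr_ge0.
under eq_integral do rewrite -EFinM.
rewrite ge0_symfun_integralT//; last 2 first.
- by move=> x; rewrite mulr_ge0 ?sqr_ge0 ?normal_pdf_ge0.
- by move=> x /=; rewrite sqrrN -even.
have I1 := @integral_normal_pdf R 0 s.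
rewrite ge0_symfun_integralT// in I1; last by move=> x; exact: normal_pdf_ge0.
rewrite half in I1 *.
have f1 : (\int[mu]_(x in `[0%R, +oo[) (normal_pdf 0 s x)%:E)%E \is a fin_num.
  exact: integrable_fin_num i1'.
have f2 : (\int[mu]_(x in `[0%R, +oo[) (x ^+ 2 * normal_pdf 0 s x)%:E)%E \is a fin_num.
  exact: integrable_fin_num i2'.
rewrite -(fineK f2) -(fineK f1) in I1 *.
rewrite -EFinM in I1; move: I1 => [I1]; rewrite -EFinM; congr EFin.
  by rewrite [X in 2 * X]E0 mulrCA [X in _ * X]I1 mulr1.
by apply/measurable_EFinP; exact: measurable_funX.
Qed.

(** The sum of both integrals is that of |x|, which by symmetry is twice the first one. *)
Lemma normal_pos_part s : 0 < s ->
  (\int[normal_prob 0 s]_x (Num.max x 0)%:E = \int[normal_prob 0 s]_x (Num.max (- x) 0)%:E /\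
   \int[normal_prob 0 s]_x (Num.max x 0)%:E \is a fin_num)%E.
Proof.
move=> s0; have sn := lt0r_neq0 s0.
have mid : measurable_fun setT (fun x : R => x) by exact: measurable_id.
have mp : measurable_fun setT (fun x : R => (Num.max x 0)%:E).
  by apply/measurable_EFinP; apply: measurable_maxr.
have mn : measurable_fun setT (fun x : R => (Num.max (- x) 0)%:E).
  by apply/measurable_EFinP; apply: measurable_maxr => //; exact: measurableT_comp.
have p0 (x : R) : (0 <= (Num.max x 0)%:E)%E by rewrite lee_fin le_max lexx orbT.
set A := (\int[normal_prob 0 s]_x (Num.max x 0)%:E)%E.
set B := (\int[normal_prob 0 s]_x (Num.max (- x) 0)%:E)%E.
have A0 : (0 <= A)%E by apply: integral_ge0.
have Afin : A \is a fin_num.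
  rewrite ge0_fin_numE//.
  apply: (@le_lt_trans _ _ (\int[normal_prob 0 s]_x (1%:E + (x ^+ 2)%:E))%E).
    apply: ge0_le_integral => //.
    - by apply: emeasurable_funD => //; apply/measurable_EFinP; exact: measurable_funX.
    - move=> x _; rewrite -EFinD lee_fin ge_max; apply/andP; split; last first.
        by rewrite addr_ge0// sqr_ge0.
      by have := sqr_ge0 (x - 1); rewrite sqrrB1; have := sqr_ge0 x; lra.
  rewrite ge0_integralD//; last 2 first.
  - by move=> x _; rewrite lee_fin sqr_ge0.
  - by apply/measurable_EFinP; exact: measurable_funX.
  rewrite normal_second_moment// integral_cst//= mul1e.
  by rewrite probability_setT -EFinD ltry.
have AB : (A + B = 2%:E * A)%E.
  rewrite /A /B -ge0_integralD//.
  rewrite (ge0_integral_normal_prob 0 sn mp)//.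
  rewrite ge0_integral_normal_prob//; last 2 first.
  - by apply: emeasurable_funD.
  - by move=> x; rewrite adde_ge0.
  transitivity (\int[mu]_x (`|x| * normal_pdf 0 s x)%:E)%E.
    apply: eq_integral => x _; rewrite -EFinD -EFinM; congr (_ * _)%:E.
    have [x0|x0] := leP 0 x.
      by rewrite ger0_norm// max_r ?addr0// oppr_le0.
    by rewrite ltr0_norm// max_l ?add0r// oppr_ge0 ltW.
  rewrite ge0_symfun_integralT.
  - congr (_ * _)%E; rewrite integral_mkcond.
    apply: eq_integral => x _; rewrite patchE -EFinM; case: ifPn.
      by rewrite inE/= => x0; rewrite max_l// ger0_norm.
    by rewrite notin_setE/= => /negP; rewrite -ltNge => x0; rewrite max_r ?mul0r// ltW.
  - by move=> x; rewrite mulr_ge0 ?normal_pdf_ge0.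
  - move=> x; apply: cvgM; last exact: continuous_normal_pdf.
    exact: norm_continuous.
  - by move=> x /=; rewrite normrN !normal_pdf0E// sqrrN.
split => //; move: AB; rewrite mule_natl mule2n => /eqP.
rewrite addeC; move: Afin; rewrite fin_numElt; clear; move: A B.
by move=> [a| |] [b| |] //= _ /eqP[] /addIr ->.
Qed.

End NormalMoments.

Section NormalVariables.
Context {d : measure_display} {T : measurableType d} {R : realType} (P : probability T R).
Implicit Types (Y : T -> R) (m s : R).

Definition mfun_of Y (mY : measurable_fun setT Y) : {mfun T >-> measurableTypeR R} :=
  HB.pack (Y : T -> measurableTypeR R)
    (isMeasurableFun.Build _ _ T (measurableTypeR R) (Y : T -> measurableTypeR R) mY).

Lemma normal_integral Y m s (g : R -> \bar R) : is_normal P Y m s ->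
  measurable_fun setT g -> (forall x, (0 <= g x)%E) ->
  (\int[P]_w g (Y w) = \int[normal_prob m s]_x g x)%E.
Proof.
move=> [mY s0 law] mg g0.
rewrite -(ge0_integral_distribution (mfun_of mY) mg g0).
by apply: eq_measure_integral => A mA _; exact: law.
Qed.

Lemma normal_expectation0 Y s : is_normal P Y 0 s -> ('E_P[Y] = 0)%E.
Proof.
move=> nY; have [_ s0 _] := nY; have [e f] := normal_pos_part s0.
have mid : measurable_fun setT (fun x : R => x) by exact: measurable_id.
rewrite unlock integralE.
have -> : (\int[P]_w (EFin \o Y)^\+ w = \int[normal_prob 0 s]_x (Num.max x 0)%:E)%E.
  rewrite -(normal_integral (g := fun x => (Num.max x 0)%:E) nY)//.
  - by apply: eq_integral => w _; rewrite funeposE -EFin_max.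
  - by apply/measurable_EFinP; apply: measurable_maxr.
  - by move=> x; rewrite lee_fin le_max lexx orbT.
have -> : (\int[P]_w (EFin \o Y)^\- w = \int[normal_prob 0 s]_x (Num.max (- x) 0)%:E)%E.
  rewrite -(normal_integral (g := fun x => (Num.max (- x) 0)%:E) nY)//.
  - by apply: eq_integral => w _; rewrite funenegE -EFin_max.
  - by apply/measurable_EFinP; apply: measurable_maxr => //; exact: measurableT_comp.
  - by move=> x; rewrite lee_fin le_max lexx orbT.
by rewrite -e subee.
Qed.

Lemma normal_expectation_sqr Y s : is_normal P Y 0 s ->
  (\int[P]_w ((Y w) ^+ 2)%:E = (s ^+ 2)%:E)%E.
Proof.
move=> nY; have [_ s0 _] := nY; rewrite -normal_second_moment//.
apply: (normal_integral (g := fun x => (x ^+ 2)%:E) nY).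
- by apply/measurable_EFinP; exact: measurable_funX.
- by move=> x; rewrite lee_fin sqr_ge0.
Qed.

Lemma normal_expectation_moment Y s p : (0 < p)%N -> is_normal P Y 0 s ->
  (\int[P]_w ((Y w) ^+ (2 * p))%:E <= (moment_cst p * s ^+ (2 * p))%:E)%E.
Proof.
move=> p0 nY; have [_ s0 _] := nY.
rewrite (normal_integral (g := fun x => (x ^+ (2 * p))%:E) nY).
- exact: normal_moment_le.
- by apply/measurable_EFinP; exact: measurable_funX.
- by move=> x; rewrite lee_fin exprM exprn_ge0// sqr_ge0.
Qed.

End NormalVariables.

(** * Laws of sums of independent increments *)

Section NormalLaws.
Context {d : measure_display} {T : measurableType d} {R : realType} (P : probability T R).
Implicit Types (Y Z : T -> R) (m s c x : R).
Notation mu := (@lebesgue_measure R).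

(** Closed rays are stable under intersection and generate the Borel sets. *)
Lemma measure_unique_rays (m1 m2 : probability (measurableTypeR R) R) :
  (forall x : R, m1 `[x, +oo[%classic = m2 `[x, +oo[%classic) ->
  forall A, measurable A -> m1 A = m2 A.
Proof.
move=> h A mA.
apply: (@measure_unique _ R (measurableTypeR R) (@RGenCInfty.G R)
  (fun n : nat => `[- n%:R, +oo[%classic) _ _ _ _ m1 m2) => //.
- exact: RGenCInfty.measurableE.
- move=> _ _ [x ->] [y ->]; exists (Num.max x y); apply/seteqP; split => z /=;
    rewrite !in_itv/= !andbT ge_max; first by move=> [-> ->].
  by move=> /andP[].
- by move=> n; exists (- n%:R).
- apply/seteqP; split => // x _; exists (Num.truncn `|x|).+1 => //=.
  rewrite in_itv/= andbT lerNl; apply: le_trans (ltW (truncnS_gt _)).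
  by rewrite -normrN ler_norm.
- by move=> _ [x ->]; exact: h.
- move=> k; apply: (@le_lt_trans _ _ 1%E); last by rewrite ltry.
  by apply: probability_le1; exact: measurable_itv.
Qed.

Lemma normal_ray_scale c s x : 0 < c -> 0 < s ->
  (normal_prob 0 s `[x, +oo[ = normal_prob 0 (c * s) `[(c * x)%R, +oo[)%E.
Proof.
move=> c0 s0; have cs : c * s != 0 by rewrite mulf_neq0 ?gt_eqF.
have dF (y : R) : is_derive y (1 : R) ( *%R c) c.
  by apply: (is_derive_eq (derZ c (derId y))); rewrite mulr1.
have F'E : derive1 ( *%R c) = cst c by apply/funext => y; exact: der_derive1 (dF y).
rewrite /normal_prob [RHS](@increasing_ge0_integration_by_substitutiony _ ( *%R c)).
- apply: eq_integral => y _; rewrite F'E/=; congr EFin; rewrite !fctE.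
  rewrite (normal_pdf0E _ cs) (normal_pdf0E _ (lt0r_neq0 s0)).
  have -> : normal_peak s = normal_peak (c * s) * c.
    have -> : normal_peak (c * s) = (Num.sqrt (c ^+ 2 * (s ^+ 2 * pi *+ 2)))^-1.
      by rewrite /normal_peak exprMn; congr (Num.sqrt _)^-1; ring.
    rewrite sqrtrM ?sqr_ge0// sqrtr_sqr gtr0_norm// invfM mulrAC mulVf ?mul1r//.
    by rewrite gt_eqF.
  rewrite mulrAC; congr (_ * expR (- _) * _); rewrite !exprMn; field.
  by rewrite !gt_eqF.
- by move=> y z _ _ yz; rewrite ltr_pM2l.
- by rewrite F'E => y _; exact: cvg_cst.
- by rewrite F'E; exact: is_cvg_cst.
- by rewrite F'E; exact: is_cvg_cst.
- split; first by move=> y _; have [] := dF y.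
  by apply: cvg_at_right_filter; exact: der_cont (dF x).
- by apply: gt0_cvgMry => //; exact: cvg_id.
- by apply: continuous_subspaceT; exact: continuous_normal_pdf.
- by move=> y _; exact: normal_pdf_ge0.
Qed.

Lemma is_normalZ Y c s : 0 < c -> is_normal P Y 0 s -> is_normal P (fun w => c * Y w) 0 (c * s).
Proof.
move=> c0 [mY s0 law]; have mcY : measurable_fun setT (fun w => c * Y w).
  by apply: measurable_funM => //; exact: measurable_cst.
split => //; first exact: mulr_gt0.
apply: (@measure_unique_rays (distribution P (mfun_of mcY)) (normal_prob 0 (c * s))) => x.
rewrite /= /distribution /pushforward.
have -> : mfun_of mcY @^-1` `[x, +oo[%classic = Y @^-1` `[x / c, +oo[%classic.
  by apply/seteqP; split => w /=; rewrite !in_itv/= !andbT ler_pdivrMr// mulrC.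
have e : c * (x / c) = x by rewrite mulrCA divff ?mulr1// gt_eqF.
by rewrite law//; have := normal_ray_scale (x / c) c0 s0; rewrite e.
Qed.

Lemma measurable_preimage (X : T -> R) (A : set R) :
  measurable_fun setT X -> measurable A -> measurable (X @^-1` A).
Proof. by move=> mX mA; rewrite -[X in measurable X]setTI; exact: mX. Qed.

(** The first event is, up to a null set, contained in the lower limit of the others. *)
Lemma measure_limit_le (E : set T) (Ek : nat -> set T) (c : \bar R) :
  measurable E -> (forall k, measurable (Ek k)) -> (forall k, (P (Ek k) <= c)%E) ->
  {ae P, forall w, E w -> exists n, forall k, (n <= k)%N -> Ek k w} -> (P E <= c)%E.
Proof.
move=> mE mEk le ae.
pose U n := \bigcap_(k in [set k | (n <= k)%N]) Ek k.
have mU n : measurable (U n) by apply: bigcap_measurable => //; exists n => /=.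
have mUU : measurable (\bigcup_n U n) by exact: bigcup_measurable.
have ndU : nondecreasing_seq U.
  move=> n m nm; apply/subsetPset => w Uw k /= mk; apply: Uw => /=.
  exact: leq_trans nm mk.
have L : (P \o U) x @[x --> \oo] --> P (\bigcup_n U n).
  exact: nondecreasing_cvg_mu.
apply: (@le_trans _ _ (P (\bigcup_n U n))).
  have [N [mN N0 sN]] := ae.
  apply: (@le_trans _ _ (P ((\bigcup_n U n) `|` N))).
    apply: le_measure; rewrite ?inE//; first exact: measurableU.
    move=> w Ew; have [Nw|nNw] := pselect (N w); [by right|left].
    have [n hn] : exists n, forall k, (n <= k)%N -> Ek k w.
      have [//|h] := pselect (exists n, forall k, (n <= k)%N -> Ek k w).
      by exfalso; apply: nNw; apply: sN => /= /(_ Ew).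
    by exists n => // k /= nk; exact: hn.
  by apply: le_trans (measureU2 _ mUU mN) _; rewrite [X in (_ + X)%E]N0 adde0.
rewrite -(cvg_lim _ L)//; apply: lime_le; first by apply/cvg_ex; eexists; exact: L.
apply: nearW => n /=; apply: le_trans (le n); apply: le_measure; rewrite ?inE//.
by move=> w Uw; apply: Uw => /=.
Qed.

(** Almost sure convergence bounds the probabilities of open half-lines from above by those of
    the common law. Since the density is bounded, moving the end point slightly closes
    the gap between open and closed half-lines. *)
Lemma is_normal_limit (Y : T -> R) (Yk : nat -> T -> R) s : 0 < s ->
  measurable_fun setT Y -> (forall k, is_normal P (Yk k) 0 s) ->
  {ae P, forall w, Yk k w @[k --> \oo] --> Y w} -> is_normal P Y 0 s.
Proof.
move=> s0 mY nYk ae; split => //.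
have sn : s != 0 by rewrite gt_eqF.
have mYk k : measurable_fun setT (Yk k) by have [] := nYk k.
have up (x : R) : (P (Y @^-1` `]x, +oo[) <= normal_prob 0 s `[x, +oo[)%E.
  apply: (@measure_limit_le _ (fun k => Yk k @^-1` `[x, +oo[)).
  - by apply: measurable_preimage.
  - by move=> k; apply: measurable_preimage.
  - by move=> k; have [_ _ ->] := nYk k.
  - apply: filterS ae => w L; rewrite /= in_itv/= andbT => xY.
    have /cvgrPdist_lt/(_ (Y w - x)) := L; rewrite subr_gt0 => /(_ xY)[n _ hn].
    exists n => k nk; have := hn k nk; rewrite /= in_itv/= andbT ltr_norml => /andP[_].
    by lra.
have dn (x : R) : (P (Y @^-1` `]-oo, x[) <= normal_prob 0 s `]-oo, x[)%E.
  apply: (@measure_limit_le _ (fun k => Yk k @^-1` `]-oo, x[)).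
  - by apply: measurable_preimage.
  - by move=> k; apply: measurable_preimage.
  - by move=> k; have [_ _ ->] := nYk k.
  - apply: filterS ae => w L; rewrite /= in_itv/= => xY.
    have /cvgrPdist_lt/(_ (x - Y w)) := L; rewrite subr_gt0 => /(_ xY)[n _ hn].
    exists n => k nk; have := hn k nk; rewrite /= in_itv/= ltr_norml => /andP[].
    by lra.
have cmpl (x : R) : `[x, +oo[%classic = ~` (`]-oo, x[%classic : set R) by rewrite setCitvl.
apply: (@measure_unique_rays (distribution P (mfun_of mY)) (normal_prob 0 s)) => x.
suff : (P (Y @^-1` `[x, +oo[) = normal_prob 0 s `[x, +oo[)%E by [].
apply/eqP; rewrite eq_le; apply/andP; split.
  apply/lee_addgt0Pr => e e0.
  have pk := normal_peak_gt0 sn.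
  (* The normal law gives [y, x[ a mass of at most e. *)
  pose y := x - e / normal_peak s.
  have yx : y < x by rewrite /y ltrBlDr ltrDl divr_gt0.
  apply: (@le_trans _ _ (P (Y @^-1` `]y, +oo[))).
    apply: le_measure; rewrite ?inE; [exact: measurable_preimage|exact: measurable_preimage|].
    by move=> w /=; rewrite !in_itv/= !andbT; apply: lt_le_trans.
  apply: le_trans (up y) _.
  have split_ : `[y, +oo[%classic = (`[x, +oo[%classic : set R) `|` `[y, x[%classic.
    apply/seteqP; split => z /=; rewrite !in_itv/= !andbT.
      by move=> yz; have [xz|zx] := leP x z; [left|right; rewrite yz].
    by move=> [|/andP[]//]; apply: le_trans; exact: ltW.
  rewrite split_; apply: le_trans (measureU2 _ _ _) _ => //; rewrite leeD2l//.
  apply: (@le_trans _ _ (\int[mu]_(z in `[y, x[) (cst (normal_peak s)%:E z))%E).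
    apply: ge0_le_integral => //.
    - by move=> z _; rewrite lee_fin normal_pdf_ge0.
    - by apply/measurable_EFinP/measurable_funTS; exact: measurable_normal_pdf.
    - by move=> z _; rewrite lee_fin normal_pdf_ub.
  rewrite integral_cst//= lebesgue_measure_itv/= lte_fin yx -EFinB -EFinM lee_fin.
  by rewrite /y opprB addrC subrK mulrCA divff ?mulr1// gt_eqF.
have -> : Y @^-1` `[x, +oo[ = ~` (Y @^-1` `]-oo, x[) by rewrite cmpl.
rewrite probability_setC; last exact: measurable_preimage.
rewrite cmpl probability_setC//; apply: leeB => //; exact: dn.
Qed.

Lemma pair_law_unique (m1 m2 : {measure set (R * R)%type -> \bar R}) :
  (forall A B : set R, measurable A -> measurable B -> m1 (A `*` B) = m2 (A `*` B)) ->
  (m1 setT < +oo)%E -> forall X, measurable X -> m1 X = m2 X.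
Proof.
move=> h fin X mX.
pose G : set (set (R * R)) := [set C | exists A B, [/\ measurable A, measurable B & C = A `*` B]].
apply: (@measure_unique _ R (R * R)%type G (fun=> setT) _ _ _ _ m1 m2) => //.
- rewrite measurable_prod_measurableType; congr (<<s _ >>).
  apply/seteqP; split => [_ [A mA [B mB <-]]|_ [A [B [mA mB ->]]]].
    by exists A, B.
  by exists A => //; exists B.
- move=> _ _ [A1 [B1 [mA1 mB1 ->]]] [A2 [B2 [mA2 mB2 ->]]].
  by rewrite -setXI; exists (A1 `&` A2), (B1 `&` B2); split => //; exact: measurableI.
- by move=> _; exists setT, setT; split => //; rewrite setXTT.
- by apply/seteqP; split => // x _; exists 0%N.
- by move=> _ [A [B [mA mB ->]]]; exact: h.
Qed.

Definition mfun_pair (Y Z : T -> R) (mY : measurable_fun setT Y) (mZ : measurable_fun setT Z) :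
    {mfun T >-> (R * R)%type} :=
  HB.pack (fun w => (Y w, Z w))
    (isMeasurableFun.Build _ _ T (R * R)%type (fun w => (Y w, Z w)) (measurable_fun_pair mY mZ)).

(** Induction on the number of terms already added: restricted to the event that the
    remaining terms lie in prescribed sets, the law of the pair (partial sum, next term) is
    determined by rectangles, and it determines the law of the next partial sum. *)
Lemma sum_law_eq (n : nat) (D D' : nat -> T -> R) :
  (forall i, measurable_fun setT (D i)) -> (forall i, measurable_fun setT (D' i)) ->
  (forall A : nat -> set R, (forall i, measurable (A i)) ->
    P (\bigcap_(i < n) (D i @^-1` A i)) = P (\bigcap_(i < n) (D' i @^-1` A i))) ->
  forall A : set R, measurable A ->
    P ((fun w => \sum_(i < n) D i w) @^-1` A) = P ((fun w => \sum_(i < n) D' i w) @^-1` A).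
Proof.
move=> mD mD' h.
have mS (E : nat -> T -> R) j : (forall i, measurable_fun setT (E i)) ->
    measurable_fun setT (fun w => \sum_(i < j) E i w).
  by move=> mE; apply: measurable_sum.
pose tl (E : nat -> T -> R) (A : nat -> set R) j :=
  \bigcap_(i in [set i | (j <= i < n)%N]) (E i @^-1` A i).
have mtl E A j : (forall i, measurable_fun setT (E i)) -> (forall i, measurable (A i)) ->
    measurable (tl E A j).
  by move=> mE mA; apply: bigcap_measurableType => i _; exact: measurable_preimage.
(* The terms from rank j on are still kept apart, in the event [tl E A j]. *)
suff H j : (j <= n)%N -> forall (A : nat -> set R) (A0 : set R),
    (forall i, measurable (A i)) -> measurable A0 ->
    P ((fun w => \sum_(i < j) D i w) @^-1` A0 `&` tl D A j) =
    P ((fun w => \sum_(i < j) D' i w) @^-1` A0 `&` tl D' A j).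
  move=> A mA; have := H n (leqnn n) (fun=> setT) A (fun=> measurableT) mA.
  have tT E : tl E (fun=> setT) n = setT by apply/seteqP; split.
  by rewrite !tT !setIT.
elim: j => [|j ih] jn A A0 mA mA0.
  have s0 (E : nat -> T -> R) : (fun w => \sum_(i < 0) E i w) = cst 0.
    by apply/funext => w; rewrite big_ord0.
  have t0 E : tl E A 0 = \bigcap_(i < n) (E i @^-1` A i) by [].
  rewrite !s0 !t0 preimage_cst; case: ifP => _; last by rewrite !set0I.
  by rewrite !setTI; exact: h.
pose law (E : nat -> T -> R) (mE : forall i, measurable_fun setT (E i)) :=
  pushforward (mrestr P (mtl E A j.+1 mE mA)) (mfun_pair (mS E j mE) (mE j)).
have split_tl (E : nat -> T -> R) (C : set R) :
    tl E (fun i => if i == j then C else A i) j = (E j @^-1` C) `&` tl E A j.+1.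
  apply/seteqP; split => [w hw|w [hC hw] i /= /andP[ji i_n]].
    split; first by have := hw j; rewrite /= leqnn jn eqxx; exact.
    move=> i /= /andP[ji i_n]; have := hw i; rewrite /= (ltnW ji) i_n.
    by rewrite gtn_eqF//; exact.
  case: eqP => [->//|/eqP ij]; apply: hw => /=.
  by rewrite ltn_neqAle eq_sym ij ji.
have rect (B C : set R) : measurable B -> measurable C ->
    law D mD (B `*` C) = law D' mD' (B `*` C).
  move=> mB mC.
  have e (E : nat -> T -> R) mE : law E mE (B `*` C) =
      P ((fun w => \sum_(i < j) E i w) @^-1` B `&`
         tl E (fun i => if i == j then C else A i) j).
    by rewrite split_tl setIA.
  by rewrite !e; apply: ih => //; [exact: ltnW|move=> i; case: ifP].
have := @pair_law_unique (law D mD) (law D' mD') rect.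
have fin : (law D mD setT < +oo)%E.
  apply: (@le_lt_trans _ _ 1%E); last by rewrite ltry.
  rewrite /law /pushforward /mrestr preimage_setT setTI.
  by apply: probability_le1; exact: (mtl _ _ _ mD mA).
have madd : measurable [set xy : R * R | A0 (xy.1 + xy.2)].
  rewrite -[X in measurable X]setTI.
  have mp : measurable_fun setT (fun xy : R * R => xy.1 + xy.2).
    by apply: measurable_funD.
  exact: mp.
move=> /(_ (measurable_fun_pair (mS D j mD) (mD j))
  (measurable_fun_pair (mS D' j mD') (mD' j)) fin _ madd) H.
have e (E : nat -> T -> R) mE : law E mE [set xy : R * R | A0 (xy.1 + xy.2)] =
    P ((fun w => \sum_(i < j.+1) E i w) @^-1` A0 `&` tl E A j.+1).
  congr (P (_ `&` _)); apply/seteqP; split => w /=; by rewrite big_ord_recr.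
by rewrite -(e D mD) -(e D' mD'); exact: H.
Qed.

(** A deterministic time change: with tau_i the sum of the first c_j^2 (t_(j+1) - t_j), the
    variables c_i (B(t_(i+1)) - B(t_i)) and the increments of B along tau are both
    independent with the same laws. The latter sum telescopes to B(tau_n) - B(0), so that
    sums of independent normal variables are handled without convolving densities. *)
Lemma step_integral_normal (B : R -> T -> R) (n : nat) (t c : nat -> R) :
  brownian_motion P B -> (0 < n)%N -> 0 <= t 0%N -> {homo t : i j / (i < j)%N >-> i < j} ->
  (forall i, 0 < c i) ->
  is_normal P (step_integral B n t c) 0
    (Num.sqrt (\sum_(i < n) c i ^+ 2 * (t i.+1 - t i))).
Proof.
move=> bm n0 t0 tlt c0.
have tle : {homo t : i j / (i <= j)%N >-> i <= j}.
  by move=> i j; rewrite leq_eqVlt => /predU1P[->//|/tlt/ltW].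
have tge i : 0 <= t i by apply: le_trans t0 (tle _ _ _).
pose tau (i : nat) := \sum_(j < i) c j ^+ 2 * (t j.+1 - t j).
have tauS i : tau i.+1 = tau i + c i ^+ 2 * (t i.+1 - t i) by rewrite /tau big_ord_recr.
have gap i : 0 < c i ^+ 2 * (t i.+1 - t i) by rewrite mulr_gt0 ?exprn_gt0// subr_gt0 tlt.
have tau0 : tau 0%N = 0 by rewrite /tau big_ord0.
have taulti i : tau i < tau i.+1 by rewrite tauS ltrDl.
have taule : {homo tau : i j / (i <= j)%N >-> i <= j}.
  by apply: homo_leq => [//|x y z|i]; [exact: le_trans|exact: ltW].
have tauge i : 0 <= tau i by rewrite -tau0 taule.
have mB s : 0 <= s -> measurable_fun setT (B s) := @bm_measurable _ _ _ _ _ bm s.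
pose D i := fun w => c i * (B (t i.+1) w - B (t i) w).
pose D' i := fun w => B (tau i.+1) w - B (tau i) w.
have nD i : is_normal P (D i) 0 (Num.sqrt (c i ^+ 2 * (t i.+1 - t i))).
  rewrite sqrtrM ?sqr_ge0// sqrtr_sqr gtr0_norm//.
  by apply: is_normalZ => //; apply: (bm_normal bm) => //; exact: tlt.
have nD' i : is_normal P (D' i) 0 (Num.sqrt (c i ^+ 2 * (t i.+1 - t i))).
  have -> : c i ^+ 2 * (t i.+1 - t i) = tau i.+1 - tau i by rewrite tauS [RHS]addrC addKr.
  exact: (bm_normal bm).
have tel w : \sum_(i < n) D' i w = B (tau n) w - B 0 w.
  rewrite -{2}tau0 -(big_mkord xpredT (fun i => D' i w)).
  by rewrite telescope_sumr.
have taun : 0 < tau n by rewrite -tau0; apply: lt_le_trans (taulti 0%N) (taule _ _ n0).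
have [mtot sp law] := bm_normal bm (lexx 0) taun.
rewrite subr0 -/(tau n) in sp law *.
split => //.
  apply: measurable_sum => i; by have [] := nD i.
move=> A mA; rewrite -law//.
have mDs i : measurable_fun setT (D i) by have [] := nD i.
have mD's i : measurable_fun setT (D' i) by have [] := nD' i.
have := sum_law_eq mDs mD's _ mA; rewrite /step_integral => ->.
  by rewrite (_ : (fun w => \sum_(i < n) D' i w) = B (tau n) \- B 0)//; apply/funext => w; rewrite tel.
move=> A' mA'.
rewrite [RHS](bm_independent bm n (t := tau) (A := A'))// ?tau0//.
have mcA i : measurable ((fun x : R => c i * x) @^-1` A' i).
  rewrite -[X in measurable X]setTI.
  by have := mulrl_measurable (c i) measurableT (mA' i).
rewrite -[LHS]/(P (\bigcap_(i < n) ((B (t i.+1) \- B (t i)) @^-1` ((fun x : R => c i * x) @^-1` A' i)))).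
rewrite (bm_independent bm n (t := t) (A := fun i => (fun x : R => c i * x) @^-1` A' i))//.
apply: eq_bigr => i _; have [_ _ h] := nD i; have [_ _ h'] := nD' i.
by rewrite -[LHS]/(P (D i @^-1` A' i)) -[RHS]/(P (D' i @^-1` A' i)) h// h'.
Qed.

End NormalLaws.

(** * A square integrable bound on dyadic increments *)

Section RandomConstant.
Context {d : measure_display} {T : measurableType d} {R : realType} (P : probability T R).
Context (B : R -> T -> R) (eps : R) (bm : brownian_motion P B) (eps0 : 0 < eps).

Lemma le_nneseries_term (f : nat -> \bar R) k :
  (forall i, (0 <= f i)%E) -> (f k <= \sum_(i <oo) f i)%E.
Proof.
move=> f0; apply: le_trans (nneseries_lim_ge (m := 0%N) k.+1 (fun i _ _ => f0 i)).
by rewrite big_nat_recr//= leeDr// sume_ge0.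
Qed.

Lemma nneseries_le (f : nat -> \bar R) (c : \bar R) :
  (forall i, (0 <= f i)%E) -> (forall n, (\sum_(0 <= i < n) f i <= c)%E) ->
  (\sum_(i <oo) f i <= c)%E.
Proof.
move=> f0 h; apply: lime_le; last exact: nearW.
by apply: is_cvg_nneseries => i _ _; exact: f0.
Qed.

Lemma sum_inv_sqr_le n : \sum_(0 <= i < n) ((1 + i%:R : R) ^+ 2)^-1 <= 2.
Proof.
(* The bound 2 (1 - 1 / (1 + n)) telescopes. *)
apply: (@le_trans _ _ (2 * (1 - (1 + n%:R)^-1))); last first.
  by rewrite mulrBr mulr1 gerBl mulr_ge0// invr_ge0 addr_ge0.
elim: n => [|n ih]; first by rewrite big_nil addr0 invr1 subrr mulr0.
rewrite big_nat_recr//= -(natr1 n); apply: le_trans (lerD ih (lexx _)) _.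
have : (0 : R) <= n%:R by [].
move: (n%:R : R) => x x0; rewrite -subr_ge0.
have -> : 2 * (1 - (1 + (x + 1))^-1) - (2 * (1 - (1 + x)^-1) + ((1 + x) ^+ 2)^-1) =
  x / ((1 + x) ^+ 2 * (1 + (x + 1))).
  by field; rewrite !gt_eqF//; lra.
by rewrite divr_ge0// mulr_ge0 ?sqr_ge0//; lra.
Qed.

Lemma sum_half_le n : \sum_(0 <= k < n) (2^-1 : R) ^+ k <= 2.
Proof.
suff -> : \sum_(0 <= k < n) (2^-1 : R) ^+ k = 2 - 2 * 2^-1 ^+ n.
  by rewrite gerBl mulr_ge0// exprn_ge0.
elim: n => [|n ih]; first by rewrite big_nil expr0 mulr1 subrr.
by rewrite big_nat_recr//= ih exprS; field.
Qed.

Let D k i w := B (dyadic k i.+1) w - B (dyadic k i) w.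
Let wt k i : R := (1 + dyadic k i) `^ eps * (3 / 4) ^+ k.

Lemma wt_gt0 k i : 0 < wt k i.
Proof.
by rewrite mulr_gt0 ?powR_gt0 ?exprn_gt0 ?divr_gt0// ltr_pwDl// dyadic_ge0.
Qed.

Lemma dyadic_increment_normal k i : is_normal P (D k i) 0 (Num.sqrt (2 ^+ k)^-1).
Proof.
have -> : (2 ^+ k)^-1 = dyadic k i.+1 - dyadic k i :> R by rewrite dyadicS addrC addKr.
apply: (bm_normal bm); first exact: dyadic_ge0.
by rewrite dyadicS ltrDl invr_gt0 exprn_gt0.
Qed.

(** The ratio of (2^(-1/2))^(2p) to (3/4)^(2p) is (8/9)^p. Its k-th power
    has to beat the factor 4^k lost in [dyadic_moment_le]. *)
Lemma chaining_exponent : exists p : nat,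
  [/\ (0 < p)%N, 1 <= p%:R * eps & (8 / 9 : R) ^+ p <= 8^-1].
Proof.
have : (8 / 9 : R) ^+ n @[n --> \oo] --> (0 : R).
  by apply: cvg_expr; rewrite ger0_norm ?divr_ge0// ltr_pdivrMr// mul1r ltr_nat.
move/cvgrPdist_lt => /(_ 8^-1); rewrite invr_gt0 => /(_ (ltr0Sn _ _))[N _ hN].
exists (N + (Num.truncn eps^-1).+1)%N; split.
- by rewrite addnS.
- rewrite -ler_pdivrMr// div1r; apply: le_trans (ltW (truncnS_gt _)) _.
  by rewrite ler_nat leq_addl.
- have := hN (N + (Num.truncn eps^-1).+1)%N (leq_addr _ _).
  by rewrite /= sub0r normrN ger0_norm ?exprn_ge0 ?divr_ge0// => /ltW.
Qed.

(** Normal moments give the factor ((8/9)^p)^k <= 8^(-k). Since p eps >= 1, the weight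
    contributes at most (1 + i 2^(-k))^(-2) <= 4^k (1+i)^(-2). *)
Lemma dyadic_moment_le p k i : (0 < p)%N -> 1 <= p%:R * eps -> (8 / 9 : R) ^+ p <= 8^-1 ->
  (\int[P]_w ((D k i w / wt k i) ^+ (2 * p))%:E <=
    (moment_cst p * (2^-1 ^+ k * ((1 + i%:R) ^+ 2)^-1) : R)%:E)%E.
Proof.
move=> p0 pe p8; have w0 := wt_gt0 k i; have [mD _ _] := dyadic_increment_normal k i.
have c0 : 0 <= moment_cst p :> R by rewrite mulr_ge0 ?sqrtr_ge0 ?exprn_ge0 ?mulr_ge0.
have W0 : 0 <= (wt k i ^+ (2 * p))^-1 by rewrite invr_ge0 exprn_ge0// ltW.
have -> : (\int[P]_w ((D k i w / wt k i) ^+ (2 * p))%:E =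
    ((wt k i ^+ (2 * p))^-1)%:E * \int[P]_w ((D k i w) ^+ (2 * p))%:E)%E.
  rewrite -ge0_integralZl//.
  - by apply: eq_integral => w _; rewrite -EFinM exprMn exprVn mulrC.
  - by apply/measurable_EFinP; exact: measurable_funX.
  - by move=> w _; rewrite lee_fin exprM exprn_ge0// sqr_ge0.
apply: le_trans (lee_wpmul2l _ (normal_expectation_moment p0 (dyadic_increment_normal k i))) _.
  by rewrite lee_fin.
rewrite -EFinM lee_fin mulrCA ler_wpM2l//.
pose x : R := 1 + dyadic k i; pose y := (x `^ eps) ^+ (2 * p).
have x1 : 1 <= x by rewrite lerDl dyadic_ge0.
have x0 : 0 < x by apply: lt_le_trans x1.
have y2 : x ^+ 2 <= y.
  rewrite /y -(powR_mulrn _ (powR_ge0 _ _)) -powRrM -(powR_mulrn 2 (ltW x0)).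
  by apply: ler_powR => //; rewrite natrM mulrCA ler_peMr// mulrC.
have -> : (wt k i ^+ (2 * p))^-1 * Num.sqrt (2 ^+ k)^-1 ^+ (2 * p) = y^-1 * ((8 / 9) ^+ p) ^+ k.
  rewrite /wt exprMn invfM -mulrA -/x -/y; congr (_ * _).
  rewrite (exprM (Num.sqrt _)) sqr_sqrtr ?invr_ge0 ?exprn_ge0//.
  rewrite -!exprVn (exprM _ 2 p) -exprMn exprAC -exprMn exprAC; congr (_ ^+ _ ^+ _).
  by field.
apply: (@le_trans _ _ ((x ^+ 2)^-1 * 8^-1 ^+ k)).
  apply: ler_pM; rewrite ?invr_ge0 ?exprn_ge0 ?powR_ge0 ?divr_ge0//.
    by rewrite lef_pV2// posrE exprn_gt0// powR_gt0.
  by apply: lerXn2r; rewrite ?nnegrE ?exprn_ge0 ?divr_ge0.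
have x2 : (1 + i%:R) * 2^-1 ^+ k <= x.
  rewrite mulrDl mul1r /x /dyadic exprVn lerD2r.
  by rewrite invf_le1 ?exprn_gt0// exprn_ege1// ler1n.
have i0 : 0 < 1 + i%:R :> R by rewrite ltr_pwDl.
have h0 : 0 < 2^-1 ^+ k :> R by rewrite exprn_gt0.
apply: (@le_trans _ _ ((((1 + i%:R) * 2^-1 ^+ k) ^+ 2)^-1 * 8^-1 ^+ k)).
  rewrite ler_wpM2r ?exprn_ge0// lef_pV2 ?posrE ?exprn_gt0 ?mulr_gt0//.
  by apply: lerXn2r => //; rewrite nnegrE ltW// mulr_gt0.
have -> : 8^-1 ^+ k = (2^-1 ^+ k) ^+ 3 :> R.
  by rewrite exprAC; congr (_ ^+ _); field.
by rewrite le_eqVlt; apply/orP; left; apply/eqP; field; rewrite !gt_eqF.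
Qed.

Definition chaining_series p w : \bar R :=
  (\sum_(k <oo) \sum_(i <oo) ((D k i w / wt k i) ^+ (2 * p))%:E)%E.

(** If one term y^(2p) of the series is at most q, then |y| <= sqrt (1+q), and the square of
    this bound is integrable as soon as the series is. *)
Definition chaining_const p w : R := Num.sqrt (1 + fine (chaining_series p w)).

Lemma chaining_term_ge0 p k i w : (0 <= ((D k i w / wt k i) ^+ (2 * p))%:E)%E.
Proof. by rewrite lee_fin exprM exprn_ge0// sqr_ge0. Qed.

Lemma measurable_chaining_term p k i :
  measurable_fun setT (fun w => ((D k i w / wt k i) ^+ (2 * p))%:E).
Proof.
have [mD _ _] := dyadic_increment_normal k i.
by apply/measurable_EFinP/measurable_funX/measurable_funM.
Qed.

Lemma chaining_row_ge0 p k w : (0 <= \sum_(i <oo) ((D k i w / wt k i) ^+ (2 * p))%:E)%E.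
Proof. by apply: nneseries_ge0 => i _ _; exact: chaining_term_ge0. Qed.

Lemma measurable_chaining_row p k :
  measurable_fun setT (fun w => (\sum_(i <oo) ((D k i w / wt k i) ^+ (2 * p))%:E)%E).
Proof.
apply: (ge0_emeasurable_sum (P := xpredT)) => [i w _ _|i _]; first exact: chaining_term_ge0.
exact: measurable_chaining_term.
Qed.

Lemma measurable_chaining_series p : measurable_fun setT (chaining_series p).
Proof.
apply: (ge0_emeasurable_sum (P := xpredT)) => [i w _ _|i _]; first exact: chaining_row_ge0.
exact: measurable_chaining_row.
Qed.

Lemma chaining_series_ge0 p w : (0 <= chaining_series p w)%E.
Proof. by apply: nneseries_ge0 => k _ _; exact: chaining_row_ge0. Qed.

Lemma chaining_series_integral p :
  (0 < p)%N -> 1 <= p%:R * eps -> (8 / 9 : R) ^+ p <= 8^-1 ->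
  (\int[P]_w chaining_series p w < +oo)%E.
Proof.
move=> p0 pe p8.
have c0 : 0 <= moment_cst p :> R by rewrite mulr_ge0 ?sqrtr_ge0 ?exprn_ge0 ?mulr_ge0.
apply: (@le_lt_trans _ _ (moment_cst p * 2 * 2)%:E); last by rewrite ltry.
rewrite integral_nneseries//; last 2 first.
- by move=> k; exact: measurable_chaining_row.
- by move=> k w _; exact: chaining_row_ge0.
have row k : (\int[P]_w (\sum_(i <oo) ((D k i w / wt k i) ^+ (2 * p))%:E) <=
    (moment_cst p * 2 * 2^-1 ^+ k)%:E)%E.
  rewrite integral_nneseries//; last 2 first.
  - by move=> i; exact: measurable_chaining_term.
  - by move=> i w _; exact: chaining_term_ge0.
  apply: nneseries_le => [i|n].
    by apply: integral_ge0 => w _; exact: chaining_term_ge0.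
  apply: le_trans (lee_sum _ (fun i _ => dyadic_moment_le k i p0 pe p8)) _.
  rewrite sumEFin lee_fin -mulr_sumr -mulrA ler_wpM2l// -mulr_sumr mulrC.
  by rewrite ler_wpM2r ?exprn_ge0// sum_inv_sqr_le.
apply: nneseries_le => [k|n].
  by apply: integral_ge0 => w _; exact: chaining_row_ge0.
apply: le_trans (lee_sum _ (fun k _ => row k)) _.
rewrite sumEFin lee_fin -mulr_sumr ler_wpM2l ?mulr_ge0//.
exact: sum_half_le.
Qed.

Lemma chaining_series_bound p w : (0 < p)%N -> (chaining_series p w < +oo)%E ->
  dyadic_bound eps (chaining_const p w) (B^~ w).
Proof.
move=> p0 fin k i; have w0 := wt_gt0 k i.
rewrite -[leLHS]/(`|D k i w|) -mulrA -/(wt k i) -ler_pdivrMr//.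
have -> : `|D k i w| / wt k i = `|D k i w / wt k i| by rewrite normrM normfV (gtr0_norm w0).
have q0 : 0 <= fine (chaining_series p w) by rewrite fine_ge0// chaining_series_ge0.
have : (D k i w / wt k i) ^+ (2 * p) <= fine (chaining_series p w).
  rewrite -lee_fin fineK ?ge0_fin_numE ?chaining_series_ge0//.
  apply: le_trans (le_nneseries_term k (fun k => chaining_row_ge0 p k w)).
  exact: (le_nneseries_term i (fun i => chaining_term_ge0 p k i w)).
rewrite /chaining_const; move: (fine _) q0 => q q0 h.
rewrite -(ler_pXn2r (n := (2 * p)%N)) ?muln_gt0 ?nnegrE ?sqrtr_ge0//.
rewrite !exprM sqr_sqrtr ?addr_ge0// real_normK ?num_real// -exprM; apply: le_trans h _.
apply: (@le_trans _ _ (1 + q)); first by rewrite lerDr.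
by rewrite ler_eXnr// lerDl.
Qed.

(** Summing moments, rather than applying the Borel-Cantelli lemma, yields a bound that is
    itself square integrable, so that pathwise rates become rates in L^2. *)
Lemma random_dyadic_bound : exists L : T -> R,
  [/\ measurable_fun setT L, forall w, 0 <= L w,
      (\int[P]_w ((L w) ^+ 2)%:E < +oo)%E &
      {ae P, forall w, dyadic_bound eps (L w) (B^~ w)}].
Proof.
have [p [p0 pe p8]] := chaining_exponent.
have mS := measurable_chaining_series p.
have fin := chaining_series_integral p0 pe p8.
have mf : measurable_fun setT (fun w => fine (chaining_series p w)).
  exact: measurableT_comp.
exists (chaining_const p); split.
- have m1 : measurable_fun setT (fun w => 1 + fine (chaining_series p w)).
    by apply: measurable_funD.
  have ms : measurable_fun (setT : set R) (@Num.sqrt R).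
    by apply: continuous_measurable_fun; exact: sqrt_continuous.
  exact: (measurableT_comp ms m1).
- by move=> w; exact: sqrtr_ge0.
- have q0 w : 0 <= fine (chaining_series p w) by rewrite fine_ge0// chaining_series_ge0.
  under eq_integral => w _ do rewrite /chaining_const sqr_sqrtr ?addr_ge0// EFinD.
  rewrite ge0_integralD//; last 2 first.
  + by move=> w _; rewrite lee_fin.
  + exact/measurable_EFinP.
  apply: lte_add_pinfty; first by rewrite integral_cst//= probability_setT mule1 ltry.
  apply: le_lt_trans fin; apply: ge0_le_integral => //.
  + by move=> w _; rewrite lee_fin.
  + exact/measurable_EFinP.
  + move=> w _; have := chaining_series_ge0 p w.
    by case: (chaining_series p w) => [r| |]//= _; rewrite leey.
- have : P.-integrable setT (chaining_series p).
    apply/integrableP; split => //.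
    by under eq_integral => w _ do rewrite (gee0_abs (chaining_series_ge0 p w)).
  move/(integrable_ae measurableT); apply: filterS => w /(_ Logic.I) h.
  by apply: chaining_series_bound => //; rewrite ltey_eq h.
Qed.

End RandomConstant.

(** * Convergence of means and variances *)

Section Moments.
Context {d : measure_display} {T : measurableType d} {R : realType} (P : probability T R).
Implicit Types (Y Z g C L : T -> R) (m s c x : R).

Lemma Lfun2_of_sqr Y : measurable_fun setT Y ->
  (\int[P]_w ((Y w) ^+ 2)%:E < +oo)%E -> Y \in Lfun P 2%:E.
Proof.
move=> mY fin; rewrite inE; apply/andP; split; rewrite inE//= /finite_norm unlock.
apply: poweR_lty; apply: le_lt_trans fin; rewrite le_eqVlt; apply/orP; left; apply/eqP.
by apply: eq_integral => w _; rewrite /= powR_mulrn// real_normK// num_real.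
Qed.

Lemma Lfun2_sqr_fin Y : Y \in Lfun P 2%:E -> (\int[P]_w ((Y w) ^+ 2)%:E < +oo)%E.
Proof.
move/Lfun2_integrable_sqr => /integrableP[_]; congr (_ < _)%E.
by apply: eq_integral => w _; rewrite gee0_abs// lee_fin sqr_ge0.
Qed.

Lemma Lfun2_measurable Y : Y \in Lfun P 2%:E -> measurable_fun setT Y.
Proof. by rewrite inE => /andP[+ _]; rewrite inE. Qed.

Lemma Lfun12 Y : Y \in Lfun P 2%:E -> Y \in Lfun P 1.
Proof. by apply: Lfun_subset12; exact: fin_num_measure. Qed.

Lemma Lfun2_ae_le Y g : measurable_fun setT Y -> g \in Lfun P 2%:E ->
  {ae P, forall w, `|Y w| <= g w} -> Y \in Lfun P 2%:E.
Proof.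
move=> mY g2 le; have mg := Lfun2_measurable g2.
apply: Lfun2_of_sqr => //; apply: le_lt_trans (Lfun2_sqr_fin g2).
apply: ae_ge0_le_integral => //.
- by move=> w _; rewrite lee_fin sqr_ge0.
- by apply/measurable_EFinP; exact: measurable_funX.
- by move=> w _; rewrite lee_fin sqr_ge0.
- by apply/measurable_EFinP; exact: measurable_funX.
- apply: filterS le => w h _; rewrite lee_fin -[leLHS]real_normK ?num_real//.
  have g0 := le_trans (normr_ge0 _) h.
  by apply: lerXn2r h; rewrite nnegrE.
Qed.

Lemma expectation_dist Y Z g c : Y \in Lfun P 1 -> Z \in Lfun P 1 -> g \in Lfun P 1 ->
  0 <= c -> (forall w, 0 <= g w) ->
  {ae P, forall w, `|Y w - Z w| <= c * g w} ->
  `|fine 'E_P[Y] - fine 'E_P[Z]| <= c * fine 'E_P[g].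
Proof.
move=> Y1 Z1 g1 c0 g0 le.
have YZ1 : Y \- Z \in Lfun P 1 by rewrite rpredB.
have cg1 : c \o* g \in Lfun P 1 by apply: Lfun_scale.
have -> : fine 'E_P[Y] - fine 'E_P[Z] = fine 'E_P[Y \- Z].
  by rewrite expectationB// fineB// expectation_fin_num.
have -> : c * fine 'E_P[g] = fine 'E_P[c \o* g].
  by rewrite expectationZl// fineM// expectation_fin_num.
have /Lfun1_integrable iYZ := YZ1; have /Lfun1_integrable icg := cg1.
rewrite -lee_fin -abse_EFin !fineK ?expectation_fin_num// unlock.
apply: le_trans (le_abse_integral _ _ _) _ => //; first by have /integrableP[] := iYZ.
apply: ae_ge0_le_integral => //.
- by apply: measurableT_comp => //; have /integrableP[] := iYZ.
- by move=> w _; rewrite lee_fin mulr_ge0.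
- by have /integrableP[] := icg.
- by apply: filterS le => w h _; rewrite abse_EFin lee_fin mulrC in h *.
Qed.

Lemma varianceE_fine Y : Y \in Lfun P 2%:E ->
  'V_P[Y] = (fine 'E_P[Y \* Y] - fine 'E_P[Y] ^+ 2)%:E.
Proof.
move=> Y2; rewrite varianceE// EFinB EFin_expe !fineK//.
- by apply: expectation_fin_num; exact: Lfun12.
- by apply: expectation_fin_num; exact: Lfun2_mul_Lfun1.
Qed.

Lemma cvg_of_dist (f g : R -> R) (l : R) : g t @[t --> +oo] --> (0 : R) ->
  (forall t : R, 0 < t -> `|f t - l| <= g t) -> f t @[t --> +oo] --> l.
Proof.
move=> g0 h; apply/cvgrPdist_lt => e e0; move/cvgrPdist_lt: g0 => /(_ e e0).
apply: filterS2 (nbhs_pinfty_gt (real0 R)) => t t0; rewrite sub0r normrN distrC => ge.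
by apply: le_lt_trans (h t t0) _; apply: le_lt_trans ge; exact: ler_norm.
Qed.

(** The differences X/q - C and (X/q)^2 - C^2 are bounded by dl L and by
    (dl + dl^2) (L^2 + C^2). *)
Lemma moments_cvg (X : R -> T -> R) C L (q dl : R -> R) :
  (forall t : R, 0 < t -> measurable_fun setT (X t)) ->
  C \in Lfun P 2%:E -> L \in Lfun P 2%:E -> (forall w, 0 <= L w) ->
  (forall t : R, 0 < t -> 0 < q t) -> (forall t : R, 0 < t -> 0 <= dl t) ->
  dl t @[t --> +oo] --> (0 : R) ->
  (forall t : R, 0 < t -> {ae P, forall w, `|X t w / q t - C w| <= dl t * L w}) ->
  ('E_P[X t] * ((q t)^-1)%:E)%E @[t --> +oo] --> ('E_P[C])%E /\
  ('V_P[X t] * ((q t ^+ 2)^-1)%:E)%E @[t --> +oo] --> ('V_P[C])%E.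
Proof.
move=> mX C2 L2 L0 q0 dl0 dlc le.
pose W t := fun w => X t w / q t.
have mC := Lfun2_measurable C2.
have W2 (t : R) : 0 < t -> W t \in Lfun P 2%:E.
  move=> t0; have nC2 : (fun w => `|C w|) \in Lfun P 2%:E.
    apply: Lfun2_of_sqr; first exact: measurableT_comp.
    by under eq_integral => w _ do rewrite /= real_normK ?num_real//; exact: Lfun2_sqr_fin.
  have g2 : ((fun w => `|C w|)) \+ (dl t \o* L) \in Lfun P 2%:E.
    have dL : dl t \o* L \in Lfun P 2%:E by apply: Lfun_scale; rewrite ?ler1n.
    by rewrite rpredD ?lee1n.
  apply: Lfun2_ae_le g2 _; first by apply: measurable_funM => //; exact: mX.
  apply: filterS (le t t0) => w h /=; rewrite mulrC in h *.
  rewrite /W mulrC; apply: le_trans (_ : _ <= `|C w| + `|(q t)^-1 * X t w - C w|) _.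
    by apply: le_trans (ler_normD _ _); rewrite addrC subrK.
  by rewrite lerD2l [leRHS]mulrC.
have XW (t : R) : 0 < t -> X t = q t \o* W t.
  by move=> t0; apply/funext => w; rewrite /= /W divfK// gt_eqF// q0.
have e1 : fine 'E_P[W t] @[t --> +oo] --> fine 'E_P[C].
  apply: (@cvg_of_dist _ (fun t => dl t * fine 'E_P[L])).
    by rewrite -[X in _ --> X](mul0r (fine 'E_P[L])); apply: cvgMl.
  move=> t t0; apply: expectation_dist; rewrite ?Lfun12 ?W2 ?dl0//; exact: le.
have e2 : fine 'E_P[W t \* W t] @[t --> +oo] --> fine 'E_P[C \* C].
  apply: (@cvg_of_dist _ (fun t => (dl t + dl t ^+ 2) * fine 'E_P[L \* L \+ C \* C])).
    rewrite -[X in _ --> X](mul0r (fine 'E_P[L \* L \+ C \* C])); apply: cvgMl.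
    rewrite -[X in _ --> X](addr0 0); apply: cvgD => //.
    by rewrite -[X in _ --> X](mulr0 0); under eq_fun => t do rewrite expr2; exact: cvgM.
  move=> t t0; have d0 := dl0 t t0; apply: expectation_dist; rewrite ?rpredD ?Lfun2_mul_Lfun1 ?W2//.
  - by rewrite addr_ge0 ?sqr_ge0.
  - by move=> w /=; rewrite -!expr2 addr_ge0 ?sqr_ge0.
  - apply: filterS (le t t0) => w; rewrite -/(W t w) /=.
    have l0 := L0 w; move: (W t w) (C w) (L w) (dl t) l0 d0 => x c l e l0 e0 h.
    rewrite -!expr2 subr_sqr normrM; apply: le_trans (_ : _ <= e * l * (e * l + 2 * `|c|)) _.
      apply: ler_pM => //; have -> : x + c = (x - c) + 2 * c by ring.
      by apply: le_trans (ler_normD _ _) _; rewrite lerD// normrM ger0_norm.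
    rewrite -subr_ge0 -[c ^+ 2]real_normK ?num_real//.
    have -> : (e + e ^+ 2) * (l ^+ 2 + `|c| ^+ 2) - e * l * (e * l + 2 * `|c|) =
      e * (l - `|c|) ^+ 2 + (e * `|c|) ^+ 2 by ring.
    by rewrite addr_ge0 ?sqr_ge0// mulr_ge0 ?sqr_ge0.
split.
- apply: cvg_trans (_ : EFin (fine 'E_P[W t]) @[t --> +oo] --> _).
    apply: near_eq_cvg; near=> t; have t0 : 0 < t by near: t; exact: nbhs_pinfty_gt.
    rewrite [X t]XW// expectationZl ?Lfun12 ?W2// fineK ?expectation_fin_num ?Lfun12 ?W2//.
    by rewrite muleAC -EFinM divff ?mul1e// gt_eqF// q0.
  rewrite -[X in _ --> X]fineK ?expectation_fin_num ?Lfun12//.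
  by apply: cvg_EFin => //; exact: nearW.
- apply: cvg_trans (_ : EFin (fine 'E_P[W t \* W t] - fine 'E_P[W t] ^+ 2) @[t --> +oo] --> _).
    apply: near_eq_cvg; near=> t; have t0 : 0 < t by near: t; exact: nbhs_pinfty_gt.
    rewrite [X t]XW// varianceZ ?W2// -varianceE_fine ?W2//.
    by rewrite muleAC -EFinM divff ?mul1e// expf_neq0// gt_eqF// q0.
  rewrite varianceE_fine//; apply: cvg_EFin; first exact: nearW.
  by apply: cvgB => //; under eq_fun => t do rewrite expr2; rewrite expr2; exact: cvgM.
Unshelve. all: by end_near.
Qed.

End Moments.

(** * Step functions on dyadic grids *)

Section StepFunctions.
Context {R : realType}.
Implicit Types (t c : nat -> R) (s : R) (n : nat).
Notation mu := (@lebesgue_measure R).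

Lemma exists_cell n t s : t 0%N < s -> s <= t n ->
  exists2 j, (j < n)%N & t j < s <= t j.+1.
Proof.
move=> t0s; elim: n => [|n ih] sn; first by rewrite leNgt t0s in sn.
have [le|lt] := leP s (t n); last by exists n => //; rewrite lt sn.
by have [j jn hj] := ih le; exists j => //; exact: ltnW.
Qed.

Lemma step_fun_cell n t c j s : {homo t : i j / (i <= j)%N >-> i <= j} ->
  (j < n)%N -> t j < s <= t j.+1 -> step_fun n t c s = c j.
Proof.
move=> tle jn /andP[js sj]; rewrite /step_fun (bigD1 (Ordinal jn))//= indicE mem_set/=; last first.
  by rewrite in_itv/= js sj.
rewrite mulr1 big1 ?addr0// => i ij; rewrite indicE memNset ?mulr0//= in_itv/= => /andP[is_ si].
have : (i != j :> nat) by apply: contra ij => /eqP e; apply/eqP/val_inj.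
rewrite neq_ltn => /orP[lt|lt].
- by have := lt_le_trans js si; rewrite ltNge tle.
- by have := lt_le_trans is_ sj; rewrite ltNge tle.
Qed.

Lemma step_fun_out n t c s : {homo t : i j / (i <= j)%N >-> i <= j} ->
  s <= t 0%N \/ t n < s -> step_fun n t c s = 0.
Proof.
move=> tle h; rewrite /step_fun big1// => i _; rewrite indicE memNset ?mulr0//= in_itv/= => /andP[is_ si].
case: h => h.
- by have := lt_le_trans is_ h; rewrite ltNge tle.
- by have := lt_le_trans h si; rewrite ltNge tle.
Qed.

Lemma step_fun_sqr n t c s : {homo t : i j / (i <= j)%N >-> i <= j} ->
  step_fun n t c s ^+ 2 = step_fun n t (fun i => c i ^+ 2) s.
Proof.
move=> tle; have [h|h] := leP s (t 0%N); first by rewrite !step_fun_out ?expr0n//; left.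
have [h'|h'] := leP s (t n); last by rewrite !step_fun_out ?expr0n//; right.
by have [j jn hj] := exists_cell h h'; rewrite !(step_fun_cell _ tle jn hj).
Qed.

Lemma measurable_step_fun n t c : measurable_fun setT (step_fun n t c).
Proof.
apply: measurable_sum => i; apply: measurable_funM; first exact: measurable_cst.
by apply: measurable_indic.
Qed.

Lemma integral_step_fun_sqr n t c : 0 <= t 0%N ->
  {homo t : i j / (i <= j)%N >-> i <= j} ->
  (\int[mu]_(s in `[0%R, +oo[) ((step_fun n t c s) ^+ 2)%:E =
    (\sum_(i < n) c i ^+ 2 * (t i.+1 - t i))%:E)%E.
Proof.
move=> t0 tle; under eq_integral => s _ do rewrite step_fun_sqr// /step_fun -sumEFin.
rewrite ge0_integral_sum//; last 2 first.
- move=> i; apply/measurable_EFinP/measurable_funTS.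
  by apply: measurable_funM; [exact: measurable_cst|exact: measurable_indic].
- by move=> i s _; rewrite lee_fin mulr_ge0 ?sqr_ge0.
rewrite -sumEFin; apply: eq_bigr => i _.
under eq_integral => s _ do rewrite EFinM.
rewrite ge0_integralZl ?lee_fin ?sqr_ge0//; last first.
  by apply/measurable_EFinP/measurable_funTS; exact: measurable_indic.
rewrite integral_indic// setIidl; last first.
  move=> s /=; rewrite !in_itv/= andbT => /andP[is_ _]; apply: ltW.
  by apply: le_lt_trans is_; apply: le_trans t0 _; exact: tle.
have e : mu `]t i, t i.+1] = (t i.+1 - t i)%:E.
  rewrite lebesgue_measure_itv/= lte_fin -EFinB; case: ifP => // h.
  by move: (tle i i.+1 (leqnSn i)); rewrite le_eqVlt h orbF => /eqP ->; rewrite subrr.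
by rewrite [X in (_ * X)%E](_ : _ = (t i.+1 - t i)%:E)// -EFinM.
Qed.

End StepFunctions.

Section DyadicSteps.
Context {R : realType} (f : R -> R) (K : R).
Notation mu := (@lebesgue_measure R).

(** The value on a cell is taken at its right end point, so that the step function of a
    decreasing f stays below f. *)
Definition dyadic_step (k : nat) : R -> R :=
  step_fun (k.+1 * 2 ^ k) (dyadic k) (fun i => f (dyadic k i.+1)).

Context (f_gt0 : forall s : R, 0 <= s -> 0 < f s)
  (f_dec : forall s t : R, 0 <= s -> s <= t -> f t <= f s)
  (f_cont : forall s : R, 0 <= s -> {for s, continuous f})
  (f_le : forall s : R, 0 <= s -> f s <= K * (1 + s)^-1).

Lemma dyadic_lt k : {homo dyadic k : i j / (i < j)%N >-> (i < j :> R)}.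
Proof. by move=> i j ij; rewrite /dyadic ltr_pM2r ?ltr_nat// invr_gt0 exprn_gt0. Qed.

Lemma dyadic_le k : {homo dyadic k : i j / (i <= j)%N >-> (i <= j :> R)}.
Proof. by move=> i j ij; rewrite /dyadic ler_pM2r ?ler_nat// invr_gt0 exprn_gt0. Qed.

Lemma dyadic_last k : dyadic k (k.+1 * 2 ^ k) = k.+1%:R :> R.
Proof. by rewrite /dyadic natrM natrX mulfK// expf_neq0. Qed.

Lemma dyadic0 k : dyadic k 0 = 0 :> R.
Proof. by rewrite /dyadic mul0r. Qed.

Lemma dyadic_step_bound k (s : R) : 0 <= s -> 0 <= dyadic_step k s <= f s.
Proof.
move=> s0; have fs := ltW (f_gt0 s0); have [h|h] := leP s (dyadic k 0).
  by rewrite /dyadic_step step_fun_out ?lexx//; [exact: dyadic_le|left].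
have [h'|h'] := leP s (dyadic k (k.+1 * 2 ^ k)); last first.
  by rewrite /dyadic_step step_fun_out ?lexx//; [exact: dyadic_le|right].
have [j jn /[dup] hj /andP[_ sj]] := exists_cell h h'.
rewrite /dyadic_step (step_fun_cell _ _ jn hj); last exact: dyadic_le.
by rewrite ltW ?f_gt0 ?dyadic_ge0// f_dec.
Qed.

Lemma dyadic_step_cvg (s : R) : 0 < s -> dyadic_step k s @[k --> \oo] --> f s.
Proof.
move=> s0; apply/cvgrPdist_lt => e e0.
have /cvgrPdist_lt/(_ e e0)[r /= r0 hr] := f_cont (ltW s0).
have : (2^-1 : R) ^+ k @[k --> \oo] --> (0 : R).
  by apply: cvg_expr; rewrite ger0_norm// invf_lt1// ltr1n.
move/cvgrPdist_lt => /(_ r r0) h; near=> k.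
have kr : 2^-1 ^+ k < r.
  have : `|0 - 2^-1 ^+ k| < r by near: k.
  by rewrite sub0r normrN ger0_norm// exprn_ge0.
have h1 : dyadic k 0 < s by rewrite dyadic0.
have h2 : s <= dyadic k (k.+1 * 2 ^ k).
  rewrite dyadic_last; apply: le_trans (ltW (truncnS_gt s)) _; rewrite ler_nat ltnS.
  by near: k; exact: nbhs_infty_ge.
have [j jn /[dup] hj /andP[js sj]] := exists_cell h1 h2.
rewrite /dyadic_step (step_fun_cell _ _ jn hj); last exact: dyadic_le.
apply: hr; rewrite /ball/= distrC ger0_norm ?subr_ge0//; apply: le_lt_trans kr.
by rewrite lerBlDr exprVn addrC; move: js; rewrite -lerBlDr dyadicS; lra.
Unshelve. all: by end_near.
Qed.

Lemma measurable_decreasing : measurable_fun (`[0, +oo[ : set R) f.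
Proof.
apply: subspace_continuous_measurable_fun => //; apply: continuous_in_subspaceT => s.
by rewrite inE/= in_itv/= andbT; exact: f_cont.
Qed.

Lemma integrable_sqr : mu.-integrable `[0, +oo[ (fun s => (f s ^+ 2)%:E).
Proof.
have mf2 : measurable_fun (`[0, +oo[ : set R) (fun s => (f s ^+ 2)%:E).
  by apply/measurable_EFinP; apply: measurable_funX; exact: measurable_decreasing.
have mD : measurable_fun (`[0, +oo[ : set R) (fun s : R => (oneDsqr s)^-1).
  by apply: measurable_funTS; apply: continuous_measurable_fun; exact: continuous_oneDsqrV.
have K0 : 0 <= K by have := f_le (lexx 0); rewrite addr0 invr1 mulr1; apply: le_trans; exact: ltW (f_gt0 _).
apply/integrableP; split => //.
apply: (@le_lt_trans _ _ (\int[mu]_(s in `[0%R, +oo[) ((K ^+ 2)%:E * (oneDsqr s)^-1%:E))%E).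
  apply: ge0_le_integral => //.
  - by apply: measurableT_comp.
  - by apply: emeasurable_funM => //; exact/measurable_EFinP.
  - move=> s; rewrite /= in_itv/= andbT => s0; rewrite lee_fin ger0_norm ?sqr_ge0//.
    apply: (@le_trans _ _ ((K * (1 + s)^-1) ^+ 2)).
      by apply: lerXn2r (f_le s0); rewrite nnegrE ?mulr_ge0 ?invr_ge0 ?addr_ge0// ltW// f_gt0.
    rewrite exprMn ler_wpM2l ?sqr_ge0// exprVn lef_pV2 ?posrE ?exprn_gt0 ?ltr_pwDl//.
      by rewrite /oneDsqr sqrrD expr1n mul1r lerD2r lerDl mulrn_wge0.
    exact: sqr_ge0.
rewrite ge0_integralZl//; last 2 first.
- exact/measurable_EFinP.
- by rewrite lee_fin sqr_ge0.
by rewrite integral0y_oneDsqr -EFinM ltry.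
Qed.

Lemma ae_pos : {ae mu, forall s : R, `[0, +oo[%classic s -> 0 < s}.
Proof.
exists [set 0]; split; first exact: measurable_set1.
  by rewrite lebesgue_measure_set1.
move=> s /= /not_implyP[]; rewrite in_itv/= andbT le_eqVlt => /predU1P[<-//|->].
by [].
Qed.

(** Dominated convergence, with f^2 as bound in both cases. *)
Lemma dyadic_step_L2 :
  (\int[mu]_(s in `[0%R, +oo[) ((f s - dyadic_step k s) ^+ 2)%:E)%E
     @[k --> \oo] --> (0 : \bar R) /\
  (\int[mu]_(s in `[0%R, +oo[) ((dyadic_step k s) ^+ 2)%:E)%E
     @[k --> \oo] --> (\int[mu]_(s in `[0%R, +oo[) (f s ^+ 2)%:E)%E.
Proof.
have m1 k : measurable_fun (`[0, +oo[ : set R) (dyadic_step k).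
  by apply: measurable_funTS; exact: measurable_step_fun.
have mf := measurable_decreasing.
have md k : measurable_fun (`[0, +oo[ : set R) (fun s => ((f s - dyadic_step k s) ^+ 2)%:E).
  by apply/measurable_EFinP; apply: measurable_funX; exact: measurable_funB.
have ms k : measurable_fun (`[0, +oo[ : set R) (fun s => ((dyadic_step k s) ^+ 2)%:E).
  by apply/measurable_EFinP; exact: measurable_funX.
have mf2 : measurable_fun (`[0, +oo[ : set R) (fun s => (f s ^+ 2)%:E).
  by apply/measurable_EFinP; exact: measurable_funX.
have m0 : measurable_fun (`[0, +oo[ : set R) (fun=> 0%E : \bar R) by exact: measurable_cst.
have cd : {ae mu, forall s : R, `[0, +oo[%classic s ->
    ((f s - dyadic_step k s) ^+ 2)%:E @[k --> \oo] --> (0%E : \bar R)}.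
  apply: (@filterS _ _ (ae_filter_ringOfSetsType mu)) ae_pos => s pos /pos s0; apply: cvg_EFin; first exact: nearW.
  rewrite -[X in _ --> X](mulr0 0) -{1 2}(subrr (f s)).
  under eq_fun => k do rewrite expr2.
  by apply: cvgM; apply: cvgB (dyadic_step_cvg s0); exact: cvg_cst.
have cs : {ae mu, forall s : R, `[0, +oo[%classic s ->
    ((dyadic_step k s) ^+ 2)%:E @[k --> \oo] --> (f s ^+ 2)%:E}.
  apply: (@filterS _ _ (ae_filter_ringOfSetsType mu)) ae_pos => s pos /pos s0; apply: cvg_EFin; first exact: nearW.
  rewrite expr2; under eq_fun => k do rewrite expr2.
  by apply: cvgM; exact: dyadic_step_cvg.
have bd : {ae mu, forall (s : R) k, `[0, +oo[%classic s ->
    (`|((f s - dyadic_step k s) ^+ 2)%:E| <= (f s ^+ 2)%:E)%E}.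
  apply: aeW => s k /=; rewrite in_itv/= andbT => s0.
  have /andP[l u] := dyadic_step_bound k s0; have fs := ltW (f_gt0 s0).
  rewrite lee_fin ger0_norm ?sqr_ge0//; apply: lerXn2r; rewrite ?nnegrE ?subr_ge0//.
  by rewrite gerBl.
have bs : {ae mu, forall (s : R) k, `[0, +oo[%classic s ->
    (`|((dyadic_step k s) ^+ 2)%:E| <= (f s ^+ 2)%:E)%E}.
  apply: aeW => s k /=; rewrite in_itv/= andbT => s0.
  have /andP[l u] := dyadic_step_bound k s0; have fs := ltW (f_gt0 s0).
  by rewrite lee_fin ger0_norm ?sqr_ge0//; apply: lerXn2r; rewrite ?nnegrE.
have mI : measurable (`[0, +oo[%classic : set R) by exact: measurable_itv.
have [_ _] := dominated_convergence (mu := mu) mI md m0 cd integrable_sqr bd.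
have [_ _] := dominated_convergence (mu := mu) mI ms mf2 cs integrable_sqr bs.
by rewrite integral0.
Qed.

End DyadicSteps.

(** * Gaussian limits and the Wiener integral *)

Section GaussianLimits.
Context {d : measure_display} {T : measurableType d} {R : realType} (P : probability T R).
Implicit Types (Y Z : T -> R) (m s c x : R).
Notation mu := (@lebesgue_measure R).

Lemma normal_ray_shift m s x : 0 < s ->
  (normal_prob 0 s `[x, +oo[ = normal_prob m s `[(m + x)%R, +oo[)%E.
Proof.
move=> s0; have sn := lt0r_neq0 s0; have dF (y : R) : is_derive y (1 : R) (+%R m) 1.
  by apply: (is_derive_eq (derD (derC y m) (derId y))); rewrite add0r.
have F'E : derive1 (+%R m) = cst 1 by apply/funext => y; exact: der_derive1 (dF y).
rewrite /normal_prob [RHS](@increasing_ge0_integration_by_substitutiony _ (+%R m)).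
- apply: eq_integral => y _; rewrite F'E/=; congr EFin; rewrite !fctE mulr1.
  rewrite !normal_pdfE ?gt_eqF// /normal_fun subr0.
  by have -> : m + y - m = y by rewrite addrAC subrr add0r.
- by move=> y z _ _ yz; rewrite ltrD2l.
- by rewrite F'E => y _; exact: cvg_cst.
- by rewrite F'E; exact: is_cvg_cst.
- by rewrite F'E; exact: is_cvg_cst.
- split; first by move=> y _; have [] := dF y.
  by apply: cvg_at_right_filter; exact: der_cont (dF x).
- exact: cvg_addrl.
- by apply: continuous_subspaceT; exact: continuous_normal_pdf.
- by move=> y _; exact: normal_pdf_ge0.
Unshelve. all: by end_near.
Qed.

Lemma is_normal_shift Y m s : is_normal P Y 0 s -> is_normal P (fun w => m + Y w) m s.
Proof.
move=> [mY s0 law]; have mmY : measurable_fun setT (fun w => m + Y w).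
  by apply: measurable_funD => //; exact: measurable_cst.
split => //.
apply: (@measure_unique_rays _ (distribution P (mfun_of mmY)) (normal_prob m s)) => x.
rewrite /= /distribution /pushforward.
have -> : mfun_of mmY @^-1` `[x, +oo[%classic = Y @^-1` `[x - m, +oo[%classic.
  by apply/seteqP; split => w /=; rewrite !in_itv/= !andbT lerBlDl.
have e : m + (x - m) = x by rewrite addrC subrK.
by rewrite law// (normal_ray_shift m _ s0) e.
Qed.

(** After rescaling, all variables have the law of the limit. *)
Lemma is_normal_cvg (Y : T -> R) (Yk : nat -> T -> R) (s : R) (sk : nat -> R) : 0 < s ->
  measurable_fun setT Y -> (forall k, is_normal P (Yk k) 0 (sk k)) ->
  sk k @[k --> \oo] --> s ->
  {ae P, forall w, Yk k w @[k --> \oo] --> Y w} -> is_normal P Y 0 s.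
Proof.
move=> s0 mY nYk sks ae.
have sk0 k : 0 < sk k by have [] := nYk k.
have nZ k : is_normal P (fun w => s / sk k * Yk k w) 0 s.
  have := is_normalZ (divr_gt0 s0 (sk0 k)) (nYk k).
  by rewrite divfK// gt_eqF.
apply: (is_normal_limit s0 mY nZ).
apply: filterS ae => w h; rewrite -[X in _ --> X]mul1r; apply: cvgM => //.
rewrite -[X in _ --> X](@divff _ s) ?gt_eqF//; apply: cvgM; first exact: cvg_cst.
by apply: cvgV => //; rewrite gt_eqF.
Qed.

End GaussianLimits.

Section NaturalSigma.
Context {d : measure_display} {T : measurableType d} {R : realType} (P : probability T R).
Context (B : R -> T -> R).
Context (P_complete : measure_is_complete P) (bm : brownian_motion P B).
Notation G := (completed_natural_sigma P B).
Notation generators := ([set E | exists t (A : set R),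
  [/\ 0 <= t, measurable A & E = B t @^-1` A]] `|` P.-negligible).

Lemma completed_natural_sigma_measurable : G `<=` measurable.
Proof.
apply: smallest_sub; first exact: sigma_algebra_measurable.
move=> E [[t [A [t0 mA ->]]]|]; last exact: P_complete.
by rewrite -[X in measurable X]setTI; exact: (bm_measurable bm t0).
Qed.

Lemma measurable_wrt_natural (Y : T -> R) : measurable_wrt G Y -> measurable_fun setT Y.
Proof.
by move=> mY _ A mA; rewrite setTI; apply: completed_natural_sigma_measurable; exact: mY.
Qed.

Lemma measurable_wrtP (Y : T -> R) :
  measurable_wrt G Y <-> measurable_fun setT (Y : g_sigma_algebraType generators -> R).
Proof.
split => [mY _ A mA|mY A mA]; first by rewrite setTI; exact: mY.
by have := mY measurableT A mA; rewrite setTI.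
Qed.

Lemma measurable_wrt_B t : 0 <= t -> measurable_wrt G (B t).
Proof.
by move=> t0 A mA; apply: sub_sigma_algebra; left; exists t, A.
Qed.

Lemma measurable_wrt_step n (t c : nat -> R) : (forall i, 0 <= t i) ->
  measurable_wrt G (step_integral B n t c).
Proof.
move=> t0; apply/measurable_wrtP; apply: measurable_sum => i.
apply: measurable_funM; first exact: measurable_cst.
by apply: measurable_funB; apply/measurable_wrtP; exact: measurable_wrt_B.
Qed.

Lemma measurable_wrt_affine (Y : T -> R) (m c : R) : measurable_wrt G Y ->
  measurable_wrt G (fun w => m + c * Y w).
Proof.
move/measurable_wrtP => mY; apply/measurable_wrtP.
by apply: measurable_funD; [exact: measurable_cst|apply: measurable_funM => //; exact: measurable_cst].
Qed.

(** The exceptional null set belongs to the completed sigma-algebra, so that the limit can be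
    redefined as 0 on it and becomes an everywhere limit of measurable functions. *)
Lemma measurable_wrt_limit (S : nat -> T -> R) (J : T -> R) :
  (forall k, measurable_wrt G (S k)) ->
  {ae P, forall w, S k w @[k --> \oo] --> J w} ->
  exists2 I : T -> R, measurable_wrt G I & {ae P, forall w, I w = J w}.
Proof.
move=> mS ae; set N := ~` [set w | S k w @[k --> \oo] --> J w].
have nN : P.-negligible N := ae.
pose I := fun w => \1_(~` N) w * J w : R.
exists I; last first.
  apply: filterS ae => w h; rewrite /I indicE mem_set ?mul1r//.
apply/measurable_wrtP.
have mN : measurable (N : set (g_sigma_algebraType generators)).
  by apply: sub_sigma_algebra; right.
apply: (@measurable_fun_cvg _ (g_sigma_algebraType generators) R setT
  (fun k w => \1_(~` N) w * S k w) I) => [k|w _].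
  apply: measurable_funM; first by apply: measurable_indic; exact: measurableC.
  by apply/measurable_wrtP.
rewrite /I indicE; have [h|h] := pselect ((~` N) w).
  by rewrite mem_set//= mul1r; under eq_fun => k do rewrite mul1r; exact: contrapT.
by rewrite memNset//= mul0r; under eq_fun => k do rewrite mul0r; exact: cvg_cst.
Qed.

End NaturalSigma.

Section WienerIntegral.
Context {d : measure_display} {T : measurableType d} {R : realType} (P : probability T R).
Context (B : R -> T -> R) (f : R -> R) (K : R).
Context (P_complete : measure_is_complete P) (bm : brownian_motion P B).
Context (f_gt0 : forall s : R, 0 <= s -> 0 < f s)
  (f_dec : forall s t : R, 0 <= s -> s <= t -> f t <= f s)
  (f_cont : forall s : R, 0 <= s -> {for s, continuous f})
  (f_le : forall s : R, 0 <= s -> f s <= K * (1 + s)^-1).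
Notation G := (completed_natural_sigma P B).
Notation mu := (@lebesgue_measure R).

Definition dyadic_sum (k : nat) : T -> R :=
  step_integral B (k.+1 * 2 ^ k) (dyadic k) (fun i => f (dyadic k i.+1)).

(** Almost sure convergence of the dyadic sums at a rate dl k * L with L square integrable
    is also convergence in L^2. The sums are normal, with the integrals of the squared
    step functions as variances, and these converge to the integral of f^2. *)
Lemma wiener_integral_of_limit (J L : T -> R) (dl : nat -> R) :
  L \in Lfun P 2%:E -> dl k @[k --> \oo] --> (0 : R) ->
  {ae P, forall w, forall k, `|dyadic_sum k w - J w| <= dl k * L w} ->
  exists (I : T -> R) (s : R),
    [/\ measurable_wrt G I, is_wiener_integral P B f I, {ae P, forall w, I w = J w},
        is_normal P I 0 s & (s ^+ 2)%:E = (\int[mu]_(x in `[0%R, +oo[) (f x ^+ 2)%:E)%E].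
Proof.
move=> L2 dlc le.
have mS k : measurable_wrt G (dyadic_sum k).
  by apply: measurable_wrt_step => i; exact: dyadic_ge0.
have Jc : {ae P, forall w, dyadic_sum k w @[k --> \oo] --> J w}.
  apply: filterS le => w h; apply/cvgrPdist_lt => e e0.
  have c : dl k * L w @[k --> \oo] --> (0 : R).
    by rewrite -[X in _ --> X](mul0r (L w)); apply: cvgMl.
  move/cvgrPdist_lt : c => /(_ e e0); apply: filterS => k; rewrite sub0r normrN => hk.
  by rewrite distrC; apply: le_lt_trans (h k) _; apply: le_lt_trans hk; exact: ler_norm.
have [I mI IJ] := measurable_wrt_limit mS Jc.
have mI' := measurable_wrt_natural P_complete bm mI.
have mS' k : measurable_fun setT (dyadic_sum k) := measurable_wrt_natural P_complete bm (mS k).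
have [L2a L2b] := dyadic_step_L2 f_gt0 f_dec f_cont f_le.
have fint := integrable_sqr f_gt0 f_cont f_le.
have Ic : {ae P, forall w, dyadic_sum k w @[k --> \oo] --> I w}.
  by apply: filterS2 Jc IJ => w h ->.
pose v k : R := \sum_(i < k.+1 * 2 ^ k) f (dyadic k i.+1) ^+ 2 * (dyadic k i.+1 - dyadic k i).
have vE k : (\int[mu]_(s in `[0%R, +oo[) ((dyadic_step f k s) ^+ 2)%:E)%E = (v k)%:E.
  by apply: integral_step_fun_sqr; [exact: dyadic_ge0|exact: dyadic_le].
have nS k : is_normal P (dyadic_sum k) 0 (Num.sqrt (v k)).
  apply: step_integral_normal => //.
  - by rewrite muln_gt0 expn_gt0.
  - exact: dyadic_ge0.
  - exact: dyadic_lt.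
  - by move=> i; apply: f_gt0; exact: dyadic_ge0.
have ffin : (\int[mu]_(x in `[0%R, +oo[) (f x ^+ 2)%:E)%E \is a fin_num.
  exact: (integrable_fin_num _ fint).
set V := fine (\int[mu]_(x in `[0%R, +oo[) (f x ^+ 2)%:E)%E.
have VE : (\int[mu]_(x in `[0%R, +oo[) (f x ^+ 2)%:E)%E = V%:E by rewrite fineK.
have vV : v k @[k --> \oo] --> V.
  move: L2b; rewrite VE; under eq_fun => k do rewrite vE.
  by move/fine_cvgP => [].
have V0 : 0 < V.
  have : 0 < v 0%N by have [_ + _] := nS 0%N; rewrite sqrtr_gt0.
  move=> /lt_le_trans; apply; rewrite -lee_fin -VE -vE; apply: ge0_le_integral => //.
  - by move=> x _; rewrite lee_fin sqr_ge0.
  - apply/measurable_EFinP/measurable_funX/measurable_funTS; exact: measurable_step_fun.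
  - by apply/measurable_EFinP/measurable_funX; exact: measurable_decreasing.
  - move=> s; rewrite /= in_itv/= andbT => s0; rewrite lee_fin.
    have /andP[l u] := dyadic_step_bound f_gt0 f_dec 0 s0.
    by apply: lerXn2r u; rewrite nnegrE// ltW// f_gt0.
exists I, (Num.sqrt V); split => //.
- split; [exact: measurable_decreasing|by []|].
  exists (fun k => k.+1 * 2 ^ k)%N, (@dyadic R), (fun k i => f (dyadic k i.+1)); split => //.
    by move=> k; split; [exact: dyadic_ge0|exact: dyadic_le].
  apply: (@squeeze_cvge _ _ _ _ (fun=> 0%E) _ (fun k => (dl k ^+ 2 * fine (\int[P]_w (L w ^+ 2)%:E))%:E)).
  + apply: nearW => k; rewrite unlock integral_ge0/=; last by move=> w _; rewrite lee_fin sqr_ge0.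
    rewrite EFinM fineK; last first.
      rewrite ge0_fin_numE ?Lfun2_sqr_fin//.
      by apply: integral_ge0 => w _; rewrite lee_fin sqr_ge0.
    rewrite -ge0_integralZl ?lee_fin ?sqr_ge0//; last 2 first.
    * by apply/measurable_EFinP/measurable_funX; exact: Lfun2_measurable L2.
    * by move=> w _; rewrite lee_fin sqr_ge0.
    apply: ae_ge0_le_integral => //.
    * by move=> w _; rewrite lee_fin sqr_ge0.
    * by apply/measurable_EFinP; apply: measurable_funX; exact: (measurable_funB mI' (mS' k)).
    * by move=> w _; rewrite mule_ge0 ?lee_fin ?sqr_ge0.
    * apply: emeasurable_funM => //.
      by apply/measurable_EFinP/measurable_funX; exact: Lfun2_measurable L2.
    apply: filterS2 IJ le => w -> /(_ k) h _; rewrite -EFinM lee_fin -exprMn distrC in h *.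
    rewrite -[leLHS]real_normK ?num_real//; have h0 := le_trans (normr_ge0 _) h.
    by apply: lerXn2r h; rewrite nnegrE.
  + exact: cvg_cst.
  + apply: cvg_EFin; first exact: nearW.
    rewrite -[X in _ --> X](mul0r (fine (\int[P]_w (L w ^+ 2)%:E))); apply: cvgMl.
    by rewrite -[X in _ --> X](mulr0 0); under eq_fun => k do rewrite expr2; exact: cvgM.
- apply: (is_normal_cvg (Yk := dyadic_sum) (sk := fun k => Num.sqrt (v k))) => //.
    by rewrite sqrtr_gt0.
  by apply: (cvg_comp v Num.sqrt vV); exact: sqrt_continuous.
- by rewrite sqr_sqrtr ?ltW.
Qed.

End WienerIntegral.

(** * The paths of the solution *)

Section SolutionPaths.
Context {R : realType} (a b sg eps K k : R) (psi x beta : R -> R).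
Let al := - a.
Let ka := b / al.
Let u := adju al ka.
Let v := adjv al ka.
Let dv := adjdv al ka.
Context (a0 : a < 0) (sg0 : 0 < sg) (eps0 : 0 < eps) (kaE : ka = 1 + 2 * eps)
  (adj : adjoint_pair al ka K k u v dv).

Let Z (t : R) := x t - sg * beta t.
Let Y (t : R) := \int[lebesgue_measure]_(s in `[-1, t]) x s.

Definition solution_limit := dual_limit u v Z Y.

(** The initial value of v Z + u Y, which is also the mean of its limit. *)
Definition mean_pairing :=
  v 0 * psi 0 + u 0 * \int[lebesgue_measure]_(s in `[-1, 0]) psi s.

(** The bound of [path_limit], up to the factor 1 + L. *)
Definition path_rate (t : R) :=
  (`|mean_pairing| + sg * K / eps) * `|growth al ka u t / Hinv al u t / t `^ (2 * eps) - rho al ka| +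
  (`|psi 0| + path_const al ka eps sg K k) * ((1 + t) `^ eps / t `^ (2 * eps)).

(** The bound of [step_sum_dist], up to the factor L, for the grid of mesh 2^(-j) on
    [0, j+1], which has (j+1) 2^j cells. *)
Definition sum_rate (j : nat) := K * (1 + eps^-1) * ((3 / 4) ^+ j + (1 + j.+1%:R) `^ (- eps)).

Lemma path_rate_cvg : path_rate t @[t --> +oo] --> (0 : R).
Proof. by apply: path_rate_cvg0 eps0 kaE adj _ _; rewrite /al oppr_gt0. Qed.

Lemma sum_rate_cvg : sum_rate j @[j --> \oo] --> (0 : R).
Proof.
rewrite -[X in _ --> X](mulr0 (K * (1 + eps^-1))); apply: cvgMr.
rewrite -[X in _ --> X](addr0 0); apply: cvgD.
  by apply: cvg_expr; rewrite ger0_norm ?divr_ge0// ltr_pdivrMr// mul1r ltr_nat.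
have c : (j.+1%:R : R) @[j --> \oo] --> +oo.
  by rewrite (cvg_shiftS (fun n => n%:R : R)); exact: cvgr_idn.
exact: (cvg_comp _ _ c (powRN_cvg0 eps0)).
Qed.

Context (cx : {within `[-1, +oo[, continuous x}) (cbeta : {within `[0, +oo[, continuous beta})
  (beta0 : beta 0 = 0) (xpsi : forall t : R, -1 <= t <= 0 -> x t = psi t)
  (eqx : forall t : R, 0 <= t ->
    x t = psi 0
      + \int[lebesgue_measure]_(s in `[0, t])
          (a * x s + b / (1 + s) * (\int[lebesgue_measure]_(r in `[-1, s]) x r))
      + sg * beta t).

Lemma cont_x0 : {within `[0, +oo[, continuous x}.
Proof.
apply: continuous_subspaceW cx => t /=; rewrite !in_itv/= !andbT.
by apply: le_trans; rewrite lerN10.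
Qed.

Lemma cont_Y : {within `[0, +oo[, continuous Y}.
Proof.
apply: continuous_subspaceW (primitive_cont cx) => t /=; rewrite !in_itv/= !andbT.
by apply: le_trans; rewrite lerN10.
Qed.

(** Differentiating the integral equation removes the noise, because Z is a primitive. *)
Lemma driven_path_of_solution (L : R) : 0 <= L -> dyadic_bound eps L beta ->
  driven_path al ka eps sg Z Y beta (9 * L).
Proof.
move=> L0 hb.
have cg : {within `[0, +oo[, continuous (fun s => a * x s + b / (1 + s) * Y s)}.
  apply: within_add; apply: within_mul; [exact: within_cst|exact: cont_x0| |exact: cont_Y].
  apply: within_mul; first exact: within_cst.
  apply: continuous_in_subspaceT => s; rewrite inE/= in_itv/= andbT => s0.
  apply: cvgV; first by rewrite gt_eqF// ltr_pwDl.
  by apply: cvgD; [exact: cvg_cst|exact: cvg_id].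
split.
- have h := within_add cont_x0 (within_mul (@within_cst _ (- sg) _) cbeta).
  have -> : Z = fun t => x t + - sg * beta t by apply/funext => t; rewrite /Z mulNr.
  exact: h.
- exact: cont_Y.
- move=> t t0; have D := derD (derC t (psi 0)) (primitive_der cg t0).
  have := der_near (g := Z) _ D.
  rewrite add0r => /(_ _)/is_derive_eq; apply.
    near=> s; have s0 : 0 <= s by apply: ltW; near: s; exact: lt_nbhsr.
    by rewrite /Z [x s]eqx// addrK.
  rewrite /Z subrK /ka /al opprK.
  by rewrite divrK// unitfE oppr_eq0 lt_eqF.
- move=> t t0; have := primitive_der cx (lt_trans (ltrN10 R) t0 : -1 < t).
  by rewrite /Z subrK.
- by rewrite mulr_ge0.
- exact: beta0.
- by move=> s t s0 st; exact: dyadic_modulus eps0 L0 cbeta hb s t s0 st.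
Unshelve. all: by end_near.
Qed.

Lemma solution_start : v 0 * Z 0 + u 0 * Y 0 = mean_pairing /\ Z 0 = psi 0.
Proof.
have Z0 : Z 0 = psi 0 by rewrite /Z beta0 mulr0 subr0 xpsi// lerN10 lexx.
split => //; rewrite Z0 /mean_pairing /Y; congr (_ + _ * _).
by apply: eq_Rintegral => s; rewrite inE/= in_itv/= => /xpsi.
Qed.

Lemma solution_path_limit (L t : R) : 0 <= L -> dyadic_bound eps L beta -> 0 < t ->
  `|x t / t `^ (2 * eps) - rho al ka * solution_limit| <= (1 + 9 * L) * path_rate t.
Proof.
move=> L0 hb t0; have al0 : 0 < al by rewrite /al oppr_gt0.
have := path_limit al0 eps0 kaE sg0 adj (driven_path_of_solution L0 hb) t0.
by have [-> ->] := solution_start; rewrite /Z subrK.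
Qed.

(** The cells of the dyadic grid satisfy the hypothesis of [step_sum_dist] by [dyadic_cell]. *)
Lemma solution_sum_dist (L : R) (j : nat) : 0 <= L -> dyadic_bound eps L beta ->
  `|\sum_(i < j.+1 * 2 ^ j) v (dyadic j i.+1) * (beta (dyadic j i.+1) - beta (dyadic j i)) -
    (solution_limit - mean_pairing) / sg| <= 9 * L * sum_rate j.
Proof.
move=> L0 hb.
have q0 : 0 <= (3 / 4 : R) ^+ j by rewrite exprn_ge0// divr_ge0.
have := step_sum_dist eps0 kaE sg0 adj (driven_path_of_solution L0 hb) (j.+1 * 2 ^ j)%N
  (dyadic0 j) (fun i => dyadic_le j (leqnSn i)) q0.
have [-> _] := solution_start; rewrite dyadic_last; apply.
move=> i s is_ si; apply: le_trans (dyadic_cell eps0 L0 cbeta hb is_ si) _.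
by rewrite ler_wpM2r ?powR_ge0// ler_wpM2r// ler_wpM2r// ler_nat.
Qed.

End SolutionPaths.

(** * The theorem *)

Section Constants.
Context {R : realType} (a b : R) (a0 : a < 0) (ab0 : 0 < a + b).
Let al := - a.
Let ka := b / al.

Lemma rate_gt1 : 1 < ka.
Proof. by rewrite ltr_pdivlMr ?oppr_gt0// mul1r; move: ab0; rewrite /al; lra. Qed.

Lemma ratioE : b / a = - ka.
Proof. by rewrite /ka /al invrN mulrN opprK. Qed.

Lemma rhoE : rho al ka = b * al `^ (ka - 1).
Proof.
have al0 : 0 < al by rewrite oppr_gt0.
rewrite /rho /ka -[in LHS](@powR_eqD R al 1 (b / al - 1))//; last by ring.
by rewrite powRr1 ?ltW// mulrA divfK// gt_eqF.
Qed.

(** Both sides are b al^(ka-1) (1 + s) U(1 + ka, 2, al (1 + s)), by [tricomiUE]. *)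
Lemma kernelE (s : R) : -1 < s ->
  b / `|a| `^ (1 + b / a) * (1 + s) * tricomiU (1 - b / a) 2 (`|a| * (1 + s)) =
  rho al ka * adjv al ka s.
Proof.
move=> s1; have al0 : 0 < al by rewrite oppr_gt0.
have ka1 := rate_gt1; have s0 : 0 < 1 + s by move: s1; lra.
rewrite ltr0_norm// -/al ratioE opprK rhoE /adjv.
have z0 : 0 < al * (1 + s) by rewrite mulr_gt0.
have ka0 : 0 < ka by apply: lt_trans ka1.
have := tricomiUE ka0 (ltW ka0) z0; rewrite addrAC subrr add0r (addrC ka) => ->.
by rewrite mulrA -powRN opprD opprK addrC.
Qed.

Lemma meanE (psi0 ipsi : R) :
  `|a| `^ (-1 - b / a) * b * (psi0 * tricomiU (1 - b / a) 2 `|a| + ipsi * tricomiU (- (b / a)) 1 `|a|) =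
  rho al ka * (adjv al ka 0 * psi0 + adju al ka 0 * ipsi).
Proof.
have al0 : 0 < al by rewrite oppr_gt0.
have ka1 := rate_gt1.
have ka0 : 0 < ka by apply: lt_trans ka1.
rewrite ltr0_norm// -/al ratioE !opprK rhoE /adjv /adju !addr0 mulr1 mul1r.
have := tricomiUE ka0 (ltW ka0) al0; rewrite addrAC subrr add0r (addrC ka) => ->.
have ka10 : 0 < ka - 1 by rewrite subr_gt0.
have := tricomiUE ka10 (ltW ka0) al0; rewrite subrK.
have -> : ka - 1 + 2 - ka = 1 by ring.
by move=> ->; rewrite (addrC (-1) ka) [b * _]mulrC [psi0 * _]mulrC [ipsi * _]mulrC.
Qed.

Lemma kernel_sqr_alg (p U y : R) : p != 0 -> b != 0 ->
  y ^+ 2 * U ^+ 2 = p ^+ 2 / b ^+ 2 * (b / p * y * U) ^+ 2.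
Proof. by move=> p0 b0; field; rewrite p0. Qed.

End Constants.

Theorem theorem4p1 (R : realType) (d : measure_display) (T : measurableType d)
    (P : probability T R) (F : R -> set (set T)) (B X : R -> T -> R)
    (a b sigma : R) (psi : R -> R)
    (P_complete : measure_is_complete P)
    (F_usual : usual_filtration P F)
    (B_brownian : brownian_motion P B)
    (B_adapted : adapted F B)
    (a_lt0 : a < 0) (ab_gt0 : 0 < a + b) (sigma_gt0 : 0 < sigma)
    (psi_cont : {within `[-1, 0], continuous psi})
    (X_sol : is_solution P F B a b sigma psi X) :
  let m : R :=
    `|a| `^ (-1 - b / a) * b *
      (psi 0 * tricomiU (1 - b / a) 2 `|a|
       + (\int[lebesgue_measure]_(s in `[-1, 0]) psi s)
         * tricomiU (- (b / a)) 1 `|a|) in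
  exists C : T -> R,
    [/\ (* (a) *)
        [/\ measurable_wrt (completed_natural_sigma P B) C,
            exists mu s : R, is_normal P C mu s &
            {ae P, forall w,
              X t w / t `^ (- (1 + b / a)) @[t --> +oo] --> C w}],
        (* (b) *)
        exists2 I : T -> R,
          is_wiener_integral P B
            (fun s => b / `|a| `^ (1 + b / a) * (1 + s)
                      * tricomiU (1 - b / a) 2 (`|a| * (1 + s))) I &
          {ae P, forall w, C w = m + sigma * I w},
        (* (c) *)
        [/\ ('E_P[C])%E = m%:E,
            'V_P[C] =
              ((sigma ^+ 2 * (b ^+ 2 / `|a| `^ (2 + 2 * b / a)))%:E *
               \int[lebesgue_measure]_(s in `[0%R, +oo[)
                 ((1 + s) ^+ 2
                  * tricomiU (1 - b / a) 2 (`|a| * (1 + s)) ^+ 2)%:E)%E &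
            (0 < 'V_P[C])%E] &
        (* (d) *)
        ('E_P[X t] * ((t `^ (-1 - b / a))^-1)%:E)%E @[t --> +oo] --> ('E_P[C])%E
        /\
        ('V_P[X t] * ((t `^ (-2 - 2 * b / a))^-1)%:E)%E @[t --> +oo]
          --> 'V_P[C]].
Proof.
move=> m.
set al := - a; set ka := b / al.
have al0 : 0 < al by rewrite oppr_gt0.
have ka1 : 1 < ka := rate_gt1 a_lt0 ab_gt0.
(* Half of the exponent of growth: the noise is O(t^eps) and the solution is of order t^(2 eps). *)
pose eps := (ka - 1) / 2.
have eps0 : 0 < eps by rewrite divr_gt0// subr_gt0.
have kaE : ka = 1 + 2 * eps by rewrite /eps; field.
have ratio : b / a = - ka := ratioE a b.
have ka0 : 0 < ka by apply: lt_trans ka1.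
have [K [k adj]] := adjoint_exists al0 ka1.
have [L [mL L0 Lfin Lbound]] := random_dyadic_bound B_brownian eps0.
have L2 : L \in Lfun P 2%:E by exact: Lfun2_of_sqr.
have rho0 : 0 < rho al ka := mulr_gt0 ka0 (powR_gt0 ka al0).
have b0 : 0 < b by clear -a_lt0 ab_gt0; lra.
pose ker (s : R) := b / `|a| `^ (1 + b / a) * (1 + s) * tricomiU (1 - b / a) 2 (`|a| * (1 + s)).
have kerE (s : R) : -1 < s -> ker s = rho al ka * adjv al ka s by exact: kernelE.
have pos1 (s : R) : 0 <= s -> -1 < s by apply: lt_le_trans; rewrite ltrN10.
have ker_gt0 (s : R) : 0 <= s -> 0 < ker s.
  by move=> s0; rewrite kerE ?pos1// mulr_gt0// (adj_v_gt0 adj).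
have ker_dec (s t : R) : 0 <= s -> s <= t -> ker t <= ker s.
  move=> s0 st; rewrite !kerE ?pos1 ?(le_trans s0)// ler_pM2l// -lerN2.
  have dN (x : R) : s <= x -> is_derive x (1 : R) (fun x => - adjv al ka x) (adjdv al ka x).
    by move=> sx; rewrite -[adjdv _ _ _]opprK; apply: derN; exact: (adj_der_v adj (le_trans s0 sx)).
  apply: (@le_of_der_ge0 _ (fun x => - adjv al ka x) (adjdv al ka) s t) => //.
  - by apply: (@der_within _ _ (adjdv al ka)) => x /andP[sx _]; exact: dN.
  - by move=> x /andP[sx _]; apply: dN; exact: ltW.
  - by move=> x /andP[sx _]; apply: (adj_dv_ge0 adj); exact: (le_trans s0 (ltW sx)).
have ker_cont (s : R) : 0 <= s -> {for s, continuous ker}.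
  move=> s0; apply: der_cont; apply: (der_near _ (derZ (rho al ka) (adj_der_v adj s0))).
  near=> x; rewrite kerE//; near: x; exact: lt_nbhsr (pos1 s s0).
have ker_le (s : R) : 0 <= s -> ker s <= rho al ka * K * (1 + s)^-1.
  move=> s0; rewrite kerE ?pos1// -mulrA ler_pM2l//; apply: le_trans (adj_v_le adj s0) _.
  rewrite ler_wpM2l ?(ltW (adj_K0 adj))// -powR_inv1 ?addr_ge0//.
  by apply: ler_powR; rewrite ?lerDl// lerN2 ltW.
pose mp := mean_pairing a b psi.
have mE : m = rho al ka * mp by rewrite /m meanE.
(* The pathwise value of the stochastic integral, defined through the limit of v Z + u Y. *)
pose J w := rho al ka * ((solution_limit a b sigma (X^~ w) (B^~ w) - mp) / sigma).
(* The almost sure event on which the deterministic results apply. *)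
pose good w := [/\ {within `[-1, +oo[, continuous (X^~ w)}, {within `[0, +oo[, continuous (B^~ w)},
  B 0 w = 0, (forall t : R, -1 <= t <= 0 -> X t w = psi t) &
  (forall t : R, 0 <= t -> X t w = psi 0
      + \int[lebesgue_measure]_(s in `[0, t])
          (a * X s w
           + b / (1 + s) * (\int[lebesgue_measure]_(u in `[-1, s]) X u w))
      + sigma * B t w)].
have ae_good : {ae P, forall w, good w}.
  have h1 : {ae P, forall w, {within `[-1, +oo[, continuous (X^~ w)} /\
      {within `[0, +oo[, continuous (B^~ w)}}.
    by apply: filterS2 (sol_continuous X_sol) (bm_continuous B_brownian) => w cX cB; split.
  have h2 : {ae P, forall w, ({within `[-1, +oo[, continuous (X^~ w)} /\
      {within `[0, +oo[, continuous (B^~ w)}) /\ B 0 w = 0}.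
    by apply: filterS2 h1 (bm_zero B_brownian) => w c B0; split.
  by apply: filterS3 h2 (sol_initial X_sol) (sol_equation X_sol) => w [[cX cB] B0] Xpsi Xeq; split.
pose dl j := rho al ka * (9 * sum_rate eps K j).
have sum_dist : {ae P, forall w, forall j, `|dyadic_sum B ker j w - J w| <= dl j * L w}.
  apply: filterS2 ae_good Lbound => w [cX cB B0 Xpsi Xeq] hL j.
  have := @solution_sum_dist R a b sigma eps K k psi (X^~ w) (B^~ w) a_lt0 sigma_gt0 eps0 kaE adj
    cX cB B0 Xpsi Xeq (L w) j (L0 w) hL.
  move=> h.
  have -> : dyadic_sum B ker j w = rho al ka *
      \sum_(i < j.+1 * 2 ^ j) adjv al ka (dyadic j i.+1) * (B (dyadic j i.+1) w - B (dyadic j i) w).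
    rewrite /dyadic_sum /step_integral mulr_sumr; apply: eq_bigr => i _.
    by rewrite kerE ?mulrA// pos1// dyadic_ge0.
  rewrite /J -mulrBr normrM (gtr0_norm rho0) /dl -mulrA ler_pM2l//.
  by rewrite mulrAC.
have dlc : dl j @[j --> \oo] --> (0 : R).
  rewrite -[X in _ --> X](mulr0 (rho al ka)); apply: cvgMr.
  by rewrite -[X in _ --> X](mulr0 9); apply: cvgMr; exact: sum_rate_cvg.
have [I [s [mI wI IJ nI sE]]] :=
  wiener_integral_of_limit P_complete B_brownian ker_gt0 ker_dec ker_cont ker_le L2 dlc sum_dist.
have s0 : 0 < s by have [] := nI.
pose C w := m + sigma * I w.
have nC : is_normal P C m (sigma * s) by apply: is_normal_shift; exact: is_normalZ.
have mI' : measurable_fun setT I by have [] := nI.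
have I2 : I \in Lfun P 2%:E.
  by apply: Lfun2_of_sqr => //; rewrite (normal_expectation_sqr nI) ltry.
have I1 := Lfun12 I2.
have CE : C = cst m \+ sigma \o* I by apply/funext => w; rewrite /C /= mulrC.
have sI2 : sigma \o* I \in Lfun P 2%:E by apply: Lfun_scale; rewrite ?ler1n.
have cst2 : (cst m : T -> R) \in Lfun P 2%:E by exact: Lfun_cst.
have C2 : C \in Lfun P 2%:E by rewrite CE rpredD ?lee1n.
have EC : ('E_P[C] = m%:E)%E.
  rewrite CE expectationD ?Lfun12// expectation_cst expectationZl//.
  by rewrite (normal_expectation0 nI) mule0 adde0.
have EII : fine ('E_P[I \* I])%E = s ^+ 2.
  by rewrite unlock (_ : s ^+ 2 = fine (s ^+ 2)%:E)// -(normal_expectation_sqr nI).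
have VC : ('V_P[C] = (sigma ^+ 2 * s ^+ 2)%:E)%E.
  rewrite CE varianceD_cst_l// varianceZ// varianceE_fine// (normal_expectation0 nI) EII.
  by rewrite /= expr0n/= subr0.
pose rate t := `|path_rate a b sigma eps K k psi t|.
have ratec : rate t @[t --> +oo] --> (0 : R).
  by rewrite -[X in _ --> X](@normr0 _ R); apply: cvg_norm; exact: (path_rate_cvg sigma psi a_lt0 eps0 kaE adj).
(* The constant 9 comes from [dyadic_modulus]. *)
pose L' := fun w => 1 + 9 * L w.
have L'2 : L' \in Lfun P 2%:E.
  have h9 : 9 \o* L \in Lfun P 2%:E by apply: Lfun_scale; rewrite ?ler1n.
  have h1 : (cst 1 : T -> R) \in Lfun P 2%:E by exact: Lfun_cst.
  have -> : L' = cst 1 \+ 9 \o* L by apply/funext => w; rewrite /L' /= mulrC.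
  by rewrite rpredD ?lee1n.
have L'0 w : 0 <= L' w by rewrite addr_ge0// mulr_ge0.
have path_dist : {ae P, forall w, forall t : R, 0 < t ->
    `|X t w / t `^ (2 * eps) - C w| <= rate t * L' w}.
  apply: filterS3 ae_good Lbound IJ => w [cX cB B0 Xpsi Xeq] hL IJw t t0.
  have -> : C w = rho al ka * solution_limit a b sigma (X^~ w) (B^~ w).
    rewrite /C IJw mE /J mulrCA -mulrDr; congr (_ * _).
    by rewrite mulrC divfK ?gt_eqF// addrC subrK.
  have := @solution_path_limit R a b sigma eps K k psi (X^~ w) (B^~ w) a_lt0 sigma_gt0 eps0 kaE adj
    cX cB B0 Xpsi Xeq (L w) t (L0 w) hL t0.
  move=> /le_trans; apply; rewrite mulrC; apply: ler_wpM2r (L'0 w) _ _ (ler_norm _).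
have e1 : - (1 + b / a) = 2 * eps by rewrite ratio kaE; ring.
have e2 : -1 - b / a = 2 * eps by rewrite ratio kaE; ring.
have e3 : -2 - 2 * b / a = 2 * eps * 2 by rewrite -(mulrA 2 b) ratio kaE; ring.
have VCE : 'V_P[C] = ((sigma ^+ 2 * (b ^+ 2 / `|a| `^ (2 + 2 * b / a)))%:E *
    \int[lebesgue_measure]_(s in `[0%R, +oo[)
      ((1 + s) ^+ 2 * tricomiU (1 - b / a) 2 (`|a| * (1 + s)) ^+ 2)%:E)%E.
  pose p := `|a| `^ (1 + b / a); have p0 : 0 < p by rewrite powR_gt0// normr_gt0 lt_eqF.
  have -> : `|a| `^ (2 + 2 * b / a) = p ^+ 2.
    rewrite -(powR_mulrn 2 (ltW p0)) -powRrM; congr (_ `^ _).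
    by rewrite -(mulrA 2 b); move: (b / a) => r; ring.
  have -> : (\int[lebesgue_measure]_(s in `[0%R, +oo[)
      ((1 + s) ^+ 2 * tricomiU (1 - b / a) 2 (`|a| * (1 + s)) ^+ 2)%:E =
      \int[lebesgue_measure]_(s in `[0%R, +oo[) ((p ^+ 2 / b ^+ 2)%:E * (ker s ^+ 2)%:E))%E.
    apply: eq_integral => x _; rewrite -EFinM; congr (_%:E).
    by apply: kernel_sqr_alg; rewrite gt_eqF.
  rewrite ge0_integralZl//; last 3 first.
  - by apply/measurable_EFinP/measurable_funX; exact: measurable_decreasing ker_cont.
  - by move=> x _; rewrite lee_fin sqr_ge0.
  - by rewrite lee_fin divr_ge0// sqr_ge0.
  rewrite -sE -!EFinM VC; congr (_%:E); field.
  by rewrite !gt_eqF.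
exists C; split.
- split.
  + exact: measurable_wrt_affine.
  + by exists m, (sigma * s).
  + apply: filterS path_dist => w h; rewrite e1.
    apply: (@cvg_of_dist _ _ (fun t => rate t * L' w)) => //.
    by rewrite -[X in _ --> X](mul0r (L' w)); apply: cvgMl.
- by exists I => //; exact: aeW.
- split => //; rewrite VC lte_fin mulr_gt0 ?exprn_gt0//.
- have mX (t : R) : 0 < t -> measurable_fun setT (X t).
    move=> t0 _ A mA; rewrite setTI; apply: (filtration_sub F_usual (ltW t0)).
    exact: (sol_adapted X_sol (ltW t0)).
  have q0 (t : R) : 0 < t -> 0 < t `^ (2 * eps) by exact: powR_gt0.
  have r0 (t : R) : 0 < t -> 0 <= rate t by move=> _; exact: normr_ge0.
  have dist (t : R) : 0 < t -> {ae P, forall w, `|X t w / t `^ (2 * eps) - C w| <= rate t * L' w}.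
    by move=> t0; apply: filterS path_dist => w h; exact: h.
  rewrite e2 e3; have [E V] := moments_cvg mX C2 L'2 L'0 q0 r0 ratec dist.
  split => //; under eq_fun => t do rewrite powRrM powR_mulrn ?powR_ge0//.
  exact: V.
Unshelve. all: by end_near.
Qed.
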